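(* Let $n\ge 0$ be an integer and let $b_n$ denote the number of plane bipolar posets with $n+2$ vertices. Then $b_n$ is equal to the number of plane permutations on $n$ elements.
   Context: A planar map is a connected multigraph embedded on the oriented sphere, up to orientation-preserving homeomorphism; it is rooted if a corner is marked; the vertex and face at this corner are the root vertex and the root (outer) face. A plane bipolar orientation is a rooted planar map (with at least one edge) endowed with an acyclic orientation having a unique source, which is the root vertex, and a unique sink, which is incident to the outer face. An edge $e=(u,v)$ is transitive if there is a directed path from $u$ to $v$ avoiding $e$. A plane bipolar poset is a plane bipolar orientation with no transitive edge. A permutation $\pi$ of $\{1,\dots,n\}$ is a plane permutation if it avoids the vincular pattern $2\,\underline{14}\,3$, i.e., there are no indices $i<j<j+1<k$ such that $\pi(j)<\pi(i)<\pi(k)<\pi(j+1)$. *)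

(* Defs.v *)
From mathcomp Require Import all_boot all_fingroup.

Set Implicit Arguments.
Unset Strict Implicit.
Unset Printing Implicit Defensive.

(* A planar map with at least one edge is encoded by its darts (half-edges):
   [vnext] turns counterclockwise around the origin of a dart and [opp]
   exchanges the two halves of an edge, so vertices, edges and faces are the
   orbits of [vnext], [opp] and [fnext] below.  An arbitrary pair
   ([vnext], [opp]) that is connected describes a map on an oriented closed
   surface, and Euler's formula selects the sphere; it also excludes the empty
   set of darts. *)

Definition fnext (D : finType) (vnext opp : {perm D}) : {perm D} :=
  (opp * vnext^-1)%g.

(* Permutations compose from left to right: [fnext] maps d to the dart that
   precedes [opp d] counterclockwise around the head of d, and hence follows
   the boundary of the face on the left of d. *)

Record planar_map := PlanarMap {
  dart :> finType;
  vnext : {perm dart};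
  opp : {perm dart};
  oppK : involutive opp;
  opp_neq : forall d, opp d != d;
  map_connected : forall d d' : dart,
    connect (fun x y => (y == vnext x) || (y == opp x)) d d';
  map_euler : #|porbits vnext| + #|porbits (fnext vnext opp)|
              = #|porbits opp| + 2 }.

Definition vertices (M : planar_map) : {set {set M}} := porbits (vnext M).

(* The vertex at which the dart d starts, and the one at which it ends. *)
Definition tail (M : planar_map) (d : M) : {set M} := porbit (vnext M) d.
Definition head (M : planar_map) (d : M) : {set M} := tail (opp M d).

Definition left_face (M : planar_map) (d : M) : {set M} :=
  porbit (fnext (vnext M) (opp M)) d.

(* A corner is represented by the dart d for which it is the angular sector
   between d and [vnext d]: it lies at the vertex [tail d] in the face
   [left_face d].  An orientation is the set of those darts that point in the
   direction of their edge, exactly one for each edge. *)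
Record oriented_map := OrientedMap {
  omap :> planar_map;
  root : omap;
  fwd : {set omap};
  fwd_opp : forall d : omap, (opp omap d \in fwd) = (d \notin fwd) }.

Definition root_vertex (M : oriented_map) : {set M} := tail (root M).
Definition root_face (M : oriented_map) : {set M} := left_face (root M).

Section Orientation.
Variable M : oriented_map.

Definition incident (v f : {set M}) : Prop :=
  exists d : M, tail d = v /\ left_face d = f.

(* [dwalk u p v]: the edges p form a directed walk from u to v. *)
Fixpoint dwalk (u : {set M}) (p : seq M) (v : {set M}) : bool :=
  if p is d :: p' then [&& d \in fwd M, tail d == u & dwalk (head d) p' v]
  else u == v.

Definition acyclic : Prop :=
  forall (u : {set M}) (p : seq M), dwalk u p u -> p = [::].

Definition source (v : {set M}) : Prop :=
  v \in vertices M /\ forall d : M, d \in fwd M -> head d <> v.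

Definition sink (v : {set M}) : Prop :=
  v \in vertices M /\ forall d : M, d \in fwd M -> tail d <> v.

Definition bipolar_orientation : Prop :=
  [/\ acyclic,
      forall v, source v <-> v = root_vertex M
    & exists t, (forall v, sink v <-> v = t) /\ incident t (root_face M)].

(* In an acyclic orientation, directed walks and directed paths coincide. *)
Definition transitive_edge (e : M) : Prop :=
  e \in fwd M /\ exists p : seq M, dwalk (tail e) p (head e) /\ e \notin p.

Definition bipolar_poset : Prop :=
  bipolar_orientation /\ forall e, ~ transitive_edge e.

End Orientation.

(* Rooted oriented maps up to orientation-preserving homeomorphism. *)
Definition map_iso (M N : oriented_map) : Prop :=
  exists f : M -> N,
    [/\ bijective f,
        {morph f : d / vnext M d >-> vnext N d},
        {morph f : d / opp M d >-> opp N d},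
        f (root M) = root N
      & forall d, (f d \in fwd N) = (d \in fwd M)].

Definition bipolar_poset_on (k : nat) (M : oriented_map) : Prop :=
  bipolar_poset M /\ #|vertices M| = k.

(* Among the elements of T satisfying P there are exactly k classes for E:
   [rep] lists one representative of each class. *)
Definition classes_number (T : Type) (E : T -> T -> Prop) (P : T -> Prop)
    (k : nat) : Prop :=
  exists rep : 'I_k -> T,
    [/\ forall i, P (rep i),
        forall i j, E (rep i) (rep j) -> i = j
      & forall x, P x -> exists i, E x (rep i)].

Definition has_2_14_3 (n : nat) (p : 'S_n) : bool :=
  [exists i : 'I_n, exists j : 'I_n, exists j' : 'I_n, exists k : 'I_n,
    [&& i < j, j' == j.+1 :> nat, j' < k,
        p j < p i, p i < p k & p k < p j']].

Definition plane_permutations (n : nat) : {set 'S_n} :=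
  [set p | ~~ has_2_14_3 p].

Lemma map_iso_sym (M N : oriented_map) : map_iso M N -> map_iso N M.
Proof.
case=> f [[g fK gK] fv fo fr ff]; exists g; split.
- by exists f.
- by move=> d; rewrite -{1}[d]gK -fv fK.
- by move=> d; rewrite -{1}[d]gK -fo fK.
- by rewrite -fr fK.
by move=> d; rewrite -ff gK.
Qed.

Lemma map_iso_trans (M N K : oriented_map) :
  map_iso M N -> map_iso N K -> map_iso M K.
Proof.
case=> f [fb fv fo fr ff] [g [gb gv go gr gf]]; exists (g \o f); split=> /=.
- exact: bij_comp.
- by move=> d /=; rewrite fv gv.
- by move=> d /=; rewrite fo go.
- by rewrite fr.
by move=> d; rewrite gf ff.
Qed.

Lemma classes_number_uniq (P : oriented_map -> Prop) (k l : nat) :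
  classes_number map_iso P k -> classes_number map_iso P l -> k = l.
Proof.
have le m n : classes_number map_iso P m -> classes_number map_iso P n -> m <= n.
  case=> r [rP rI _] [s [_ _ sS]].
  have /fin_all_exists[f fP] : forall i, exists j, map_iso (r i) (s j).
    by move=> i; exact/sS/rP.
  have fI : injective f.
    move=> i j eq_f; apply: rI; apply: map_iso_trans (fP i) _.
    by rewrite eq_f; exact/map_iso_sym/fP.
  by have := leq_card f fI; rewrite !card_ord.
by move=> Hk Hl; apply/eqP; rewrite eqn_leq !le.
Qed.

(* Main.v *)
Require Import Defs.
From mathcomp Require Import all_boot all_fingroup.
From mathcomp Require Import zify.
Import Defs.

(** Vertices and frontier edges are ranked together, because a new vertex is placed relative to the
    edges entering it, and these need a rank before their head has one. The second ranking satisfies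
    the invariants of the first for the reversed frontier, so left and right share one proof. That
    dominance implies reachability rests on one invariant: the frontier edge that follows a swept
    vertex in a ranking starts at a vertex reachable from it.

    One double count serves both directions. An edge either has another outgoing edge next to it on
    its left, and marks a bottom corner of a face, or it ends the outgoing edges on the left. Every
    face has at least one bottom and every inner vertex at least one leftmost outgoing edge, so V +
    F = E + 2 amounts to equality in both bounds.

    An isomorphism of orders is not enough: the embedding has to match as well. The sweep therefore
    also records that the ranking agrees with the left-to-right order of the edges at each vertex.
    Conversely, rotation around a vertex fixes the order of its covers, except at the lowest point,
    where the marked corner decides. *)

(** Idea.  Extend a permutation of size n by two fixed end points and read it as
    the dominance order on the points (i, p(i)).  Avoiding the pattern means
    exactly that this order is a lattice (if two elements are both below two
    others, some element lies in between), and then its Hasse diagram, drawn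
    with the points at their coordinates, is a plane bipolar poset.  Euler's formula for this drawing amounts to the fact
    that every face has a single bottom corner: the two sides of a face go up
    from consecutive covers v, w of its bottom to the join of v and w.

    Conversely, Euler's formula for a plane bipolar poset forces every face to
    have one bottom and every inner vertex one leftmost outgoing edge.  Sweep
    the vertices along a linear extension; the edges crossing the frontier are
    linearly ordered from left to right, and the edges entering the next vertex
    form a block of consecutive ones.  Inserting the new vertex at the right end
    of the block in one list, and at its left end in another, builds two linear
    orders whose intersection is reachability, hence the permutation. *)

Set Implicit Arguments.
Unset Strict Implicit.
Unset Printing Implicit Defensive.

(** * Orbits of a permutation *)

Section PermOrbits.
Variables (T : finType) (phi : {perm T}).

Lemma porbit_step (x : T) : porbit phi (phi x) = porbit phi x.
Proof. by rewrite -{2}[phi]expg1 porbit_perm. Qed.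

Lemma porbits_hit (A : {set T}) :
  (forall x, exists2 y, y \in A & y \in porbit phi x) ->
  porbits phi = [set porbit phi y | y in A].
Proof.
move=> hit; apply/setP => F; apply/imsetP/imsetP => [[x _ ->]|[x _ ->]]; last by exists x.
by have [y yA yx] := hit x; exists y => //; apply/eqP; rewrite eq_porbit_mem porbit_sym.
Qed.

Lemma card_porbits_hit (A : {set T}) :
  (forall x, exists2 y, y \in A & y \in porbit phi x) ->
  #|porbits phi| <= #|A|.
Proof. by move/porbits_hit->; exact: leq_imset_card. Qed.

Lemma card_porbits_transversal (A : {set T}) :
  (forall x, exists2 y, y \in A & y \in porbit phi x) ->
  {in A &, forall x y, y \in porbit phi x -> x = y} ->
  #|porbits phi| = #|A|.
Proof.
move=> /porbits_hit-> uniqA; apply: card_in_imset => x y xA yA eq_xy.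
by apply: uniqA => //; rewrite eq_xy porbit_id.
Qed.

Lemma porbit_iter_closed (P : pred T) (x : T) :
  (forall y, P y -> P (phi y)) -> P x -> {in porbit phi x, forall y, P y}.
Proof.
move=> Pphi Px y /porbitP[i ->]; elim: i => [|i IH]; first by rewrite expg0 perm1.
by rewrite expgSr permM; exact: Pphi.
Qed.

Lemma porbit_next (x y : T) : (phi y \in porbit phi x) = (y \in porbit phi x).
Proof. by rewrite -!eq_porbit_mem porbit_step. Qed.

Lemma card_porbits_involution (up : pred T) :
  involutive phi -> (forall x, up (phi x) = ~~ up x) ->
  #|porbits phi| = #|[set x | up x]|.
Proof.
move=> phiK upN; have orbit2 x y : y \in porbit phi x -> y = x \/ y = phi x.
  move=> /(@porbit_iter_closed [pred y | (y == x) || (y == phi x)]) /= closed.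
  have /orP[/eqP|/eqP] : (y == x) || (y == phi x); [|by left|by right].
  by apply: closed => [z /orP[]/eqP->|]; rewrite ?phiK eqxx ?orbT.
apply: card_porbits_transversal => [x|x y].
  case: (boolP (up x)) => ux; first by exists x; rewrite ?inE ?porbit_id.
  by exists (phi x); rewrite ?inE ?upN // porbit_next porbit_id.
by rewrite !inE => ux uy /orbit2[//|e]; move: uy; rewrite e upN ux.
Qed.

Lemma porbit_iterP (x y : T) :
  reflect (exists i, y = iter i phi x) (y \in porbit phi x).
Proof.
by apply: (iffP (@porbitP _ phi x y)) => -[i ->]; exists i; rewrite permX.
Qed.

Lemma porbit_prev (x y : T) : ((phi^-1)%g y \in porbit phi x) = (y \in porbit phi x).
Proof. by rewrite -porbit_next permKV. Qed.

Variable up : pred T.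

(* A rise is a point of [up] whose predecessor is not in [up]: with a single
   rise on a cycle, the points of [up] form one run starting at the rise. *)
Lemma up_run (x0 : T) (k : nat) :
  {in porbit phi x0, forall z, up z -> ~~ up ((phi^-1)%g z) -> z = x0} ->
  up (iter k phi x0) ->
  exists2 k', iter k phi x0 = iter k' phi x0 &
    forall i, i <= k' -> up (iter i phi x0).
Proof.
move=> rise; elim: k => [|k IH] upk; first by exists 0 => // i; rewrite leqn0 => /eqP->.
case: (boolP (up (iter k phi x0))) => [/IH[k' eqk upi] | nup].
  exists k'.+1; first by rewrite /= -eqk.
  by move=> i; rewrite leq_eqVlt => /predU1P[->|/upi//]; rewrite /= -eqk.
have/rise: iter k.+1 phi x0 \in porbit phi x0 by apply/porbit_iterP; exists k.+1.
rewrite {2}iterS permK => /(_ upk nup) eq0.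
by exists 0 => // i; rewrite leqn0 => /eqP->; rewrite /= -eq0.
Qed.

(** Without a rise, [phi] would preserve the complement of [up], which would then fill the whole
    cycle. *)
Lemma porbit_rise (x : T) :
  (exists2 y, y \in porbit phi x & up y) ->
  (exists2 y, y \in porbit phi x & ~~ up y) ->
  exists2 y, y \in porbit phi x & up y && ~~ up ((phi^-1)%g y).
Proof.
move=> [y yx upy] [z zx nz].
case: (pickP [pred w in porbit phi x | up w && ~~ up ((phi^-1)%g w)]) => [w /andP[]|none].
  by exists w.
case/negP: nz; have zy : y \in porbit phi z.
  by move: zx; rewrite -eq_porbit_mem => /eqP->.
case/porbit_iterP: zy upy => i ->; elim: i => [|i IH] //= upS; apply: IH.
have ix : iter i phi z \in porbit phi x by elim: i {upS} => //= i; rewrite porbit_next.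
by have := none (iter i.+1 phi z); rewrite inE /= permK porbit_next ix upS /= => /negbFE.
Qed.

End PermOrbits.

Section SeqFacts.
Variable T : eqType.

Lemma filter_split (up : pred T) (s : seq T) :
  sorted (fun x y => up y ==> up x) s ->
  s = [seq x <- s | up x] ++ [seq x <- s | ~~ up x].
Proof.
elim: s => //= x s IH pxs; have {}IH := IH (path_sorted pxs).
case: (boolP (up x)) => upx; first by rewrite /= {1}IH.
have : all (fun y => up y ==> up x) s.
  by apply: order_path_min pxs => y z w /implyP h1 /implyP h2; apply/implyP => /h2/h1.
move=> /allP all_s; have /all_filterP-> : all (fun x => ~~ up x) s.
  by apply/allP => y /all_s; rewrite (negbTE upx) implybF.
suff -> : [seq x <- s | up x] = [::] by [].
by apply/eqP; rewrite -[_ == _]negbK -has_filter; apply/hasPn => y /all_s; rewrite (negbTE upx) implybF.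
Qed.

Lemma sub_fpath (f : T -> T) (e : rel T) (x : T) (p : seq T) :
  (forall y, f y \in p -> e y (f y)) -> fpath f x p -> path e x p.
Proof.
elim: p x => //= y p IH x ep /andP[/eqP eqy pp].
rewrite -{1}eqy ep ?eqy ?mem_head //=.
by apply: IH pp => z zp; apply: ep; rewrite inE zp orbT.
Qed.

End SeqFacts.

(** * Rankings of a swept poset *)

Lemma pairwise_index (T : eqType) (s : seq T) :
  uniq s -> pairwise (fun x y => index x s < index y s) s.
Proof.
move=> us; have -> : (fun x y => index x s < index y s) = (fun x y => ltn (index x s) (index y s)) by [].
rewrite -(pairwise_map (index^~ s) ltn) -sorted_pairwise; last exact: ltn_trans.
suff -> : map (index^~ s) s = iota 0 (size s) by exact: iota_ltn_sorted.
case: s us => // x0 s us; apply: (@eq_from_nth _ 0); first by rewrite size_map size_iota.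
move=> i; rewrite size_map => i_s; rewrite (nth_map x0) // index_uniq //.
by rewrite nth_iota.
Qed.

Lemma pairwise_in (T : eqType) (s : seq T) (r r' : rel T) :
  pairwise r s -> {in s &, subrel r r'} -> pairwise r' s.
Proof. by move=> rs h; exact: (sub_in_pairwise h (allss s)). Qed.

Lemma pairwise_rev_sym (T : eqType) (r : rel T) (s : seq T) :
  pairwise r (rev s) -> pairwise (fun x y => r y x) s.
Proof.
elim: s => //= a s IH; rewrite rev_cons -cats1 pairwise_cat => /and3P[/allrelP h /IH -> _].
by rewrite andbT; apply/allP => b bs; apply: h; rewrite ?mem_rev ?inE.
Qed.

Lemma lex_le (a b : nat) (c : bool) : (a < b) || (a == b) && c -> a <= b.
Proof. by case: ltngtP. Qed.

Lemma seq_argmax (T : eqType) (f : T -> nat) (s : seq T) :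
  s != [::] -> exists2 a, a \in s & forall b, b \in s -> f b <= f a.
Proof.
elim: s => // a s IH _; case: (s =P [::]) => [->|/eqP /IH[b bs b_max]].
  by exists a => [|c]; rewrite inE // => /eqP->.
case: (leqP (f a) (f b)) => ab.
  by exists b => [|c]; rewrite inE ?bs ?orbT // => /predU1P[->//|]; exact: b_max.
exists a => [|c]; rewrite inE ?eqxx // => /predU1P[->//|/b_max cb].
exact: leq_trans cb (ltnW ab).
Qed.

Section Sweep.
Variables (V D : finType) (reach : rel V) (tl : D -> V).
Hypotheses (reach_refl : reflexive reach) (reach_tr : transitive reach).

Definition active (S : {set V}) (F : seq D) (p : V + D) : bool :=
  match p with inl u => u \in S | inr e => e \in F end.

Definition foot (p : V + D) : V := match p with inl u => u | inr e => tl e end.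

(* S is the set of swept vertices, F the list of the edges leaving it; x ranks
   both of them as in a drawing where paths go rightwards. *)
Record sweep (S : {set V}) (F : seq D) (x : V + D -> nat) : Prop := Sweep {
  sweep_inj : forall u p, u \in S -> active S F p -> x (inl u) = x p -> inl u = p;
  sweep_sorted : pairwise (fun d e => x (inr d) < x (inr e)) F;
  sweep_reach : forall u p, u \in S -> active S F p -> reach u (foot p) -> x (inl u) <= x p;
  sweep_next : forall u, u \in S -> exists e, [/\ e \in F, reach u (tl e), x (inl u) < x (inr e)
    & forall f, f \in F -> x (inr f) < x (inr e) -> x (inr f) < x (inl u)] }.

(** A new point, v or one of its outgoing edges, is put in the place of the edge e; an old point
    keeps its own place. *)
Definition parent (v : V) (O : seq D) (e : D) (p : V + D) : V + D :=
  match p with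
  | inl u => if u == v then inr e else p
  | inr d => if d \in O then inr e else p
  end.

(** Breaks ties between points put in the same place: 0 for old points, 1 for v, and from 2 on for
    the outgoing edges in list order. *)
Definition offset (v : V) (O : seq D) (p : V + D) : nat :=
  match p with
  | inl u => u == v
  | inr d => if d \in O then (index d O).+2 else 0
  end.

(** The rank of the parent and the offset are two digits in base [(size O).+2], which exceeds every
    offset, so comparison is lexicographic. *)
Definition update (v : V) (O : seq D) (e : D) (x : V + D -> nat) (p : V + D) : nat :=
  x (parent v O e p) * (size O).+2 + offset v O p.

Lemma offset_lt (v : V) (O : seq D) (p : V + D) : offset v O p < (size O).+2.
Proof.
case: p => [u|d] /=; first by case: eqP.
by case: ifP => // dO; rewrite !ltnS index_mem.
Qed.

Lemma update_lt (v : V) (O : seq D) (e : D) (x : V + D -> nat) (p q : V + D) :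
  (update v O e x p < update v O e x q) =
  (x (parent v O e p) < x (parent v O e q)) ||
  (x (parent v O e p) == x (parent v O e q)) && (offset v O p < offset v O q).
Proof.
rewrite /update; have := offset_lt v O p; have := offset_lt v O q.
move: (x _) (x _) (offset _ _ _) (offset _ _ _) (size O).+2 => a b i j k ik jk.
by case: (ltngtP a b) => [ab|ab|->] /=; nia.
Qed.

Lemma update_le (v : V) (O : seq D) (e : D) (x : V + D -> nat) (p q : V + D) :
  (update v O e x p <= update v O e x q) =
  (x (parent v O e p) < x (parent v O e q)) ||
  (x (parent v O e p) == x (parent v O e q)) && (offset v O p <= offset v O q).
Proof. by rewrite leqNgt update_lt; case: ltngtP => //= _; rewrite -leqNgt. Qed.

(** * One new vertex in one ranking *)

Section Step.
Variables (S : {set V}) (l1 B l2 O : seq D) (v : V).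
Hypotheses (vS : v \notin S) (tlS : forall e, e \in l1 ++ B ++ l2 -> tl e \in S)
  (tlO : forall d, d \in O -> tl d = v) (uO : uniq O) (O0 : O != [::])
  (reach_v : forall u, u \in S -> reach u v -> exists2 e, e \in B & reach u (tl e))
  (B_reach : forall e, e \in B -> reach (tl e) v)
  (v_max : forall u, u \in S -> ~~ reach v u).

Let newF := l1 ++ O ++ l2.
Let newS := v |: S.

Lemma step_notin (e : D) : e \in l1 ++ B ++ l2 -> e \notin O.
Proof. by move=> /tlS eS; apply: contraNN vS => /tlO <-. Qed.

(** Separates the new points from the old ones, whose rank [update] merely rescales. *)
Lemma step_active (p : V + D) : active newS newF p ->
  (foot p = v /\ (p = inl v \/ exists2 d, d \in O & p = inr d)) \/
  [/\ foot p \in S, active S (l1 ++ B ++ l2) p, offset v O p = 0,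
      forall e, parent v O e p = p & match p with inl u => True | inr d => d \in l1 ++ l2 end].
Proof.
case: p => [u|d] /=.
  rewrite in_setU1 => /predU1P[->|uS]; first by left; split; [|left].
  have /negbTE -> : u != v by apply: contraNneq vS => <-.
  by right; split.
rewrite !mem_cat; case: (boolP (d \in O)) => [dO _|dO]; first by left; split; [exact: tlO|right; exists d].
rewrite orFb => d12; right.
have d' : d \in l1 ++ B ++ l2 by rewrite !mem_cat; case/orP: d12 => ->; rewrite ?orbT.
by split=> //; [exact: tlS| rewrite -!mem_cat].
Qed.

Lemma parent_new (e : D) (p : V + D) : foot p = v -> active newS newF p -> parent v O e p = inr e.
Proof.
case: p => [u|d] /=; first by move->; rewrite eqxx.
move=> td; rewrite !mem_cat; case: (boolP (d \in O)) => // _; rewrite orFb => d12.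
case/negP: vS; rewrite -td; apply: tlS; rewrite !mem_cat.
by case/orP: d12 => ->; rewrite ?orbT.
Qed.

Variables (x : V + D -> nat) (el : D).
Hypotheses (swx : sweep S (l1 ++ B ++ l2) x) (elB : el \in B)
  (el_max : forall e, e \in B -> x (inr e) <= x (inr el)).

Lemma step_left (f e : D) : f \in l1 -> e \in B -> x (inr f) < x (inr e).
Proof.
have := sweep_sorted swx; rewrite !pairwise_cat => /and3P[/allrelP h _ _] f1 eB.
by apply: h => //; rewrite mem_cat eB.
Qed.

Lemma step_right (f e : D) : f \in l2 -> e \in B -> x (inr e) < x (inr f).
Proof.
have := sweep_sorted swx; rewrite !pairwise_cat => /and3P[_ _ /and3P[/allrelP h _ _]] f2 eB.
exact: h.
Qed.

(** A swept vertex that reaches v does so through an edge of B, ranked at most [el]. Putting the new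
    points at the maximum of the block therefore keeps them after everything that reaches them, and
    still before l2. *)
Lemma sweep_step : sweep newS newF (update v O el x).
Proof.
have memF f : f \in newF -> f \in O \/ (f \in l1 ++ B ++ l2 /\ f \in l1 ++ l2).
  rewrite !mem_cat; case: (f \in O); first by left.
  by right; move: H; rewrite orFb => /orP[]->; rewrite ?orbT.
split.
- move=> u p uS pA eq_up.
  have : ~~ (update v O el x (inl u) < update v O el x p) by rewrite eq_up ltnn.
  have : ~~ (update v O el x p < update v O el x (inl u)) by rewrite eq_up ltnn.
  rewrite !update_lt => h1 h2.
  have {h1 h2} [eqx eqo] : x (parent v O el (inl u)) = x (parent v O el p) /\ offset v O (inl u) = offset v O p by lia.
  case: (step_active (p := inl u) uS) => [[/= uv _]|[uS' _ off0 par _]].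
    move: eqo; rewrite uv /= eqxx; case: (step_active pA) => [[_ [->//|[d dO ->]]]|[_ _ -> _ _]] //=.
    by rewrite dO.
  move: eqo eqx; rewrite off0 par; case: (step_active pA) => [[_ [->|[d dO ->]]]|[_ pA' _ -> _] _ eqx].
  + by rewrite /= eqxx.
  + by rewrite /= dO.
  exact: (sweep_inj swx) eqx.
- have off_old f : f \in l1 ++ B ++ l2 -> parent v O el (inr f) = inr f /\ offset v O (inr f) = 0.
    by move=> fF /=; rewrite (negbTE (step_notin fF)).
  have old1 f : f \in l1 -> f \in l1 ++ B ++ l2 by move=> h; rewrite mem_cat h.
  have old2 f : f \in l2 -> f \in l1 ++ B ++ l2 by move=> h; rewrite !mem_cat h !orbT.
  have srt := sweep_sorted swx; rewrite pairwise_cat in srt; case/and3P: srt => /allrelP s1 s2 s3.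
  rewrite pairwise_cat in s3; case/and3P: s3 => /allrelP s4 s5 s6.
  rewrite !pairwise_cat; apply/and3P; split; first last.
  + apply/and3P; split.
    * apply/allrelP => d f dO f2; have [pf of0] := off_old f (old2 _ f2).
      by rewrite update_lt pf /= dO s4.
    * apply: pairwise_in (pairwise_index uO) _ => d e dO eO lt_de.
      by rewrite update_lt /= dO eO eqxx !ltnS lt_de orbT.
    * apply: pairwise_in s6 _ => d e d2 e2 lt_de.
      by rewrite update_lt !(proj1 (off_old _ (old2 _ _))) // lt_de.
  + apply: pairwise_in s2 _ => d e d1 e1 lt_de.
    by rewrite update_lt !(proj1 (off_old _ (old1 _ _))) // lt_de.
  apply/allrelP => d f d1; have [pd od] := off_old d (old1 _ d1).
  rewrite mem_cat => /orP[fO|f2]; rewrite update_lt pd.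
    by rewrite /= fO s1 // mem_cat elB.
  by have [-> _] := off_old f (old2 _ f2); rewrite s1 // mem_cat f2 orbT.
- move=> u p uS pA r_up; rewrite update_le.
  case: (step_active (p := inl u) uS) => [[/= uv _]|[/= uS' _ _ _ _]].
    rewrite uv eqxx; case: (step_active pA) => [[fp [->|[d dO ->]]]|[fp _ _ _ _]].
    + by rewrite /= !eqxx orbT.
    + by rewrite /= dO !eqxx orbT.
    by have := v_max fp; rewrite -uv r_up.
  have -> /= : (u == v) = false by apply: contraNF vS => /eqP <-.
  case: (step_active pA) => [[fp _]|[_ pA' _ -> _]]; last first.
    by rewrite leq0n andbT orbC -leq_eqVlt; exact: (sweep_reach swx uS' pA' r_up).
  rewrite parent_new //; have [e eB re] := reach_v uS' (etrans (congr1 _ (esym fp)) r_up).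
  have := sweep_reach swx (p := inr e) uS' _ re; rewrite /= !mem_cat eB orbT => /(_ isT).
  by rewrite leq0n andbT orbC -leq_eqVlt => h; apply: leq_trans h (el_max eB).
move=> u; rewrite in_setU1.
have [o [O' eqO]] : exists o O', O = o :: O' by case: O O0 => // o O' _; exists o, O'.
have oO : o \in O by rewrite eqO mem_head.
have io : index o O = 0 by rewrite eqO /= eqxx.
have oF : o \in newF by rewrite !mem_cat oO orbT.
have to : tl o = v by exact: tlO.
case/predU1P => [->|uS].
  exists o; split=> //; first by rewrite to.
    by rewrite update_lt /= eqxx oO eqxx io orbT.
  move=> f /memF[fO|[fF _]]; rewrite !update_lt /=; first by rewrite fO oO eqxx io ltnn !ltnS ltn0.
  by rewrite (negbTE (step_notin fF)) oO eqxx.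
have uv : (u == v) = false by apply: contraNF vS => /eqP <-.
have [e [eF re lt_ue e_next]] := sweep_next swx uS.
(* If the edge following u belongs to the block, the first outgoing edge o of v takes over. A
   remaining edge ranked before [el] lies in l1, hence before e, so nothing comes between u and
   o. *)
case: (boolP (e \in B)) => eB.
  exists o; split=> //.
  - by rewrite to; apply: reach_tr re _; exact: B_reach.
  - by rewrite update_lt /= uv oO (leq_trans lt_ue) // el_max.
  move=> f /memF[fO|[fF f12]]; rewrite !update_lt /= uv.
    by rewrite fO oO eqxx io ltnn !ltnS ltn0.
  rewrite (negbTE (step_notin fF)) oO => h; apply/orP; left; apply: e_next => //.
  move: f12; rewrite mem_cat => /orP[f1|f2]; first exact: step_left.
  have := step_right f2 elB; case/orP: h => [/ltnW|/andP[/eqP-> _]]; last by rewrite ltnn.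
  by rewrite leqNgt => /negbTE->.
have eF' : e \in newF.
  by move: eF; rewrite !mem_cat (negbTE eB) /= => /orP[]->; rewrite ?orbT.
exists e; split=> //; first by rewrite update_lt /= uv (negbTE (step_notin eF)) lt_ue.
move=> f /memF[fO|[fF _]]; rewrite !update_lt /= uv (negbTE (step_notin eF)).
  rewrite fO ltn0 andbF orbF => h; apply/orP; left; apply: e_next => //.
  by rewrite !mem_cat elB orbT.
by rewrite (negbTE (step_notin fF)) ltn0 andbF orbF => h; rewrite e_next.
Qed.

End Step.

Lemma active_rev (S : {set V}) (F : seq D) (p : V + D) :
  active S (rev F) p = active S F p.
Proof. by case: p => //= e; rewrite mem_rev. Qed.

(** In y the frontier is read from right to left, so [sweep2_sym] turns each statement into its
    mirror image. Dominance and interpolation see a frontier edge through its tail. *)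
Record sweep2 (S : {set V}) (F : seq D) (x y : V + D -> nat) : Prop := Sweep2 {
  sweep2_x : sweep S F x;
  sweep2_y : sweep S (rev F) y;
  sweep2_dom : forall u p, u \in S -> active S F p ->
    x (inl u) <= x p -> y (inl u) <= y p -> reach u (foot p);
  sweep2_lat : forall u z p q, u \in S -> z \in S -> active S F p -> active S F q ->
    reach u (foot p) -> reach u (foot q) -> reach z (foot p) -> reach z (foot q) ->
    exists m, [/\ m \in S, reach u m, reach z m, reach m (foot p) & reach m (foot q)] }.

Lemma sweep2_sym (S : {set V}) (F : seq D) (x y : V + D -> nat) :
  sweep2 S F x y -> sweep2 S (rev F) y x.
Proof.
case=> sx sy dom lat; split; rewrite ?revK //.
- by move=> u p uS; rewrite active_rev => pA yp xp; exact: dom.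
- by move=> u z p q uS zS; rewrite !active_rev; exact: lat.
Qed.

(** * The block of edges entering the new vertex, seen from both rankings *)

Section Step2.
Variables (S : {set V}) (l1 B l2 O : seq D) (v : V).
Hypotheses (vS : v \notin S) (tlS : forall e, e \in l1 ++ B ++ l2 -> tl e \in S)
  (tlO : forall d, d \in O -> tl d = v) (uO : uniq O) (O0 : O != [::])
  (reach_v : forall u, u \in S -> reach u v -> exists2 e, e \in B & reach u (tl e))
  (B_reach : forall e, e \in B -> reach (tl e) v)
  (v_max : forall u, u \in S -> ~~ reach v u).

Lemma rev_cat3 (l l' l'' : seq D) : rev (l ++ l' ++ l'') = rev l'' ++ rev l' ++ rev l.
Proof. by rewrite !rev_cat catA. Qed.

Variables (x y : V + D -> nat) (el ef : D).
Hypotheses (sw : sweep2 S (l1 ++ B ++ l2) x y) (elB : el \in B) (efB : ef \in B)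
  (el_max : forall e, e \in B -> x (inr e) <= x (inr el))
  (ef_max : forall e, e \in B -> y (inr e) <= y (inr ef)).

Let F := l1 ++ B ++ l2.

Lemma block_active (e : D) : e \in B -> active S F (inr e).
Proof. by move=> eB; rewrite /= !mem_cat eB orbT. Qed.

Lemma y_left (f e : D) : f \in l1 -> e \in B -> y (inr e) < y (inr f).
Proof.
move=> f1 eB; have sy := sweep2_y sw; rewrite rev_cat3 in sy.
by apply: (step_right sy); rewrite mem_rev.
Qed.

Lemma y_right (f e : D) : f \in l2 -> e \in B -> y (inr f) < y (inr e).
Proof.
move=> f1 eB; have sy := sweep2_y sw; rewrite rev_cat3 in sy.
by apply: (step_left sy); rewrite mem_rev.
Qed.

Lemma x_left (f e : D) : f \in l1 -> e \in B -> x (inr f) < x (inr e).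
Proof. exact: (step_left (sweep2_x sw)). Qed.

Lemma x_right (f e : D) : f \in l2 -> e \in B -> x (inr e) < x (inr f).
Proof. exact: (step_right (sweep2_x sw)). Qed.

Lemma next_x (u : V) : u \in S -> exists e, [/\ e \in F, reach u (tl e), x (inl u) < x (inr e)
    & forall f, f \in F -> x (inr f) < x (inr e) -> x (inr f) < x (inl u)].
Proof. exact: (sweep_next (sweep2_x sw)). Qed.

Lemma next_y (u : V) : u \in S -> exists e, [/\ e \in F, reach u (tl e), y (inl u) < y (inr e)
    & forall f, f \in F -> y (inr f) < y (inr e) -> y (inr f) < y (inl u)].
Proof.
move=> uS; have [e [eF re lt_ue nx]] := sweep_next (sweep2_y sw) uS.
rewrite mem_rev in eF; exists e; split=> // f fF; apply: nx; by rewrite mem_rev.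
Qed.

Lemma reach_x (u : V) (p : V + D) : u \in S -> active S F p -> reach u (foot p) -> x (inl u) <= x p.
Proof. exact: (sweep_reach (sweep2_x sw)). Qed.

Lemma reach_y (u : V) (p : V + D) : u \in S -> active S F p -> reach u (foot p) -> y (inl u) <= y p.
Proof. by move=> uS pA; apply: (sweep_reach (sweep2_y sw)) => //; rewrite active_rev. Qed.

(* A vertex below the right end of B in x and below its left end in y reaches
   an edge of B: its next edges in both rankings cannot avoid B. *)
Lemma dom_block (u : V) : u \in S -> x (inl u) <= x (inr el) -> y (inl u) <= y (inr ef) ->
  reach u v.
Proof.
move=> uS ux uy; have viaB e : e \in B -> reach u (tl e) -> reach u v.
  by move=> eB re; apply: reach_tr re _; exact: B_reach.
have [e [eF re lt_ue nx]] := next_x uS; have [g [gF rg lt_ug ny]] := next_y uS.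
have elA := block_active elB; have efA := block_active efB.
have e_el : x (inr e) <= x (inr el).
  by rewrite leqNgt; apply/negP => /(nx _ elA); rewrite ltnNge ux.
have g_ef : y (inr g) <= y (inr ef).
  by rewrite leqNgt; apply/negP => /(ny _ efA); rewrite ltnNge uy.
move: (eF); rewrite !mem_cat => /or3P[e1|eB|e2]; [|exact: viaB eB re|]; last first.
  by have := x_right e2 elB; rewrite ltnNge e_el.
move: (gF); rewrite !mem_cat => /or3P[g1|gB|g2]; [|exact: viaB gB rg|].
  by have := y_left g1 efB; rewrite ltnNge g_ef.
apply: viaB efB _; apply: (sweep2_dom sw (p := inr ef)) => //=.
exact/ltnW/(ltn_trans lt_ue)/x_left.
Qed.

(** In x, u precedes an edge of the block and hence [el]. In y, u precedes q, and q precedes [el]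
    because it is to the right of [el] in x. So [el] dominates u. *)
Lemma right_of_block (u : V) (q : V + D) : u \in S -> active S F q -> x (inr el) < x q ->
  reach u v -> reach u (foot q) -> reach u (tl el).
Proof.
move=> uS qA xq uv uq; have [e eB ue] := reach_v uS uv.
have eA := block_active eB; have elA := block_active elB.
apply: (sweep2_dom sw (p := inr el)) => //.
  by apply: leq_trans (el_max eB); exact: (reach_x (p := inr e)).
have uyq := reach_y uS qA uq.
apply: leq_trans uyq _; rewrite leqNgt; apply/negP.
(* For an edge this is the opposite order of the two rankings; a vertex c is compared through the
   frontier edge that follows it in y. *)
case: q qA xq uq => [c|f] /= qA xq uq ltq.
  have [g [gF cg lt_cg ny]] := next_y qA.
  have gx : x (inr el) < x (inr g).
    by apply: (leq_trans xq); exact: (reach_x (p := inr g)).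
  move: (gF); rewrite !mem_cat => /or3P[g1|gB|g2].
  - by have := x_left g1 elB; rewrite ltnNge ltnW.
  - by have := el_max gB; rewrite leqNgt gx.
  - by have := ltn_trans ltq lt_cg; rewrite ltnNge ltnW // y_right.
move: qA; rewrite !mem_cat => /or3P[g1|gB|g2].
- by have := x_left g1 elB; rewrite ltnNge ltnW.
- by have := el_max gB; rewrite leqNgt xq.
- by have := y_right g2 elB; rewrite ltnNge ltnW.
Qed.

(** By [right_of_block] both u and z reach [tl el], so the interpolation known for old points
    applies with [el] in place of v. *)
Lemma lat_right (u z : V) (q : V + D) : u \in S -> z \in S -> active S F q -> x (inr el) < x q ->
  reach u v -> reach u (foot q) -> reach z v -> reach z (foot q) ->
  exists m, [/\ m \in S, reach u m, reach z m, reach m v & reach m (foot q)].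
Proof.
move=> uS zS qA xq uv uq zv zq.
have [||m [mS um zm m1 m2]] := sweep2_lat sw uS zS (block_active elB) qA _ uq _ zq.
- exact: right_of_block xq uv uq.
- exact: right_of_block xq zv zq.
by exists m; split=> //; apply: reach_tr m1 _; exact: B_reach.
Qed.

End Step2.

Section Step3.
Variables (S : {set V}) (l1 B l2 O : seq D) (v : V).
Hypotheses (vS : v \notin S) (tlS : forall e, e \in l1 ++ B ++ l2 -> tl e \in S)
  (tlO : forall d, d \in O -> tl d = v) (uO : uniq O) (O0 : O != [::])
  (reach_v : forall u, u \in S -> reach u v -> exists2 e, e \in B & reach u (tl e))
  (B_reach : forall e, e \in B -> reach (tl e) v)
  (v_max : forall u, u \in S -> ~~ reach v u).
Variables (x y : V + D -> nat) (el ef : D).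
Hypotheses (sw : sweep2 S (l1 ++ B ++ l2) x y) (elB : el \in B) (efB : ef \in B)
  (el_max : forall e, e \in B -> x (inr e) <= x (inr el))
  (ef_max : forall e, e \in B -> y (inr e) <= y (inr ef)).

Let F := l1 ++ B ++ l2.

Lemma parent_rev (e : D) (p : V + D) : parent v (rev O) e p = parent v O e p.
Proof. by case: p => //= d; rewrite mem_rev. Qed.

Lemma lat_left (u z : V) (q : V + D) : u \in S -> z \in S -> active S F q -> y (inr ef) < y q ->
  reach u v -> reach u (foot q) -> reach z v -> reach z (foot q) ->
  exists m, [/\ m \in S, reach u m, reach z m, reach m v & reach m (foot q)].
Proof.
have sw' := sweep2_sym sw; rewrite rev_cat3 in sw' => uS zS qA.
apply: (lat_right _ _ sw' _ _ uS zS); rewrite -?rev_cat3 ?active_rev ?mem_rev //.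
- by move=> w wS /(reach_v wS)[e eB we]; exists e; rewrite ?mem_rev.
- by move=> e; rewrite mem_rev; exact: B_reach.
- by move=> e; rewrite mem_rev; exact: ef_max.
Qed.

(** A vertex on neither side of the block is dominated by its ends and reaches v by [dom_block]; it
    can then serve as its own interpolating element. The other two cases go to [lat_right] and
    [lat_left]. *)
Lemma old_beside (q : V + D) : active (v |: S) (l1 ++ O ++ l2) q -> foot q \in S ->
  [\/ reach (foot q) v /\ q = inl (foot q), x (inr el) < x q | y (inr ef) < y q].
Proof.
move=> qA fq; case: (step_active vS tlS tlO qA) => [[fv _]|[_ + _ _ qm]].
  by case/negP: vS; rewrite -fv.
case: q {qA} qm fq => [w _ /= wS _|f /=].
  case: (ltnP (x (inr el)) (x (inl w))) => xw; first by constructor 2.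
  case: (ltnP (y (inr ef)) (y (inl w))) => yw; first by constructor 3.
  by constructor 1; split => //; exact: (dom_block B_reach sw elB efB).
rewrite mem_cat => /orP[f1|f2] _ _.
  by constructor 3; exact: (y_left sw).
by constructor 2; exact: (x_right sw).
Qed.

Lemma sweep2_step : sweep2 (v |: S) (l1 ++ O ++ l2)
  (update v O el x) (update v (rev O) ef y).
Proof.
have sx := sweep2_x sw; have sy := sweep2_y sw; split.
- exact: (sweep_step vS tlS).
- rewrite rev_cat3; rewrite rev_cat3 in sy.
  apply: (sweep_step vS _ _ _ _ _ _ _ sy); rewrite -?rev_cat3 ?rev_uniq ?mem_rev //.
  + by move=> e; rewrite mem_rev; exact: tlS.
  + by move=> e; rewrite mem_rev; exact: tlO.
  + by apply: contraNneq O0 => eqO; rewrite -[O]revK eqO.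
  + by move=> w wS /(reach_v wS)[e eB we]; exists e; rewrite ?mem_rev.
  + by move=> e; rewrite mem_rev; exact: B_reach.
  + by move=> e; rewrite mem_rev; exact: ef_max.
- move=> u p uS' pA; rewrite !update_le !parent_rev.
  have off_rev : offset v O p = 0 -> offset v (rev O) p = 0.
    by case: (p) => //= d; rewrite mem_rev; case: ifP.
  case: (step_active (p := inl u) vS tlS tlO uS') => [[/= uv _]|[/= uS _ _ paru _]].
    rewrite uv eqxx; case: (step_active vS tlS tlO pA) => [[-> _]|[fp pA' off0 par _]].
      by move=> _ _; exact: reach_refl.
    (* No old point exceeds v in both rankings: exceeding [el] in x puts it, or the frontier edge
       following it, in l2, and the edges of l2 precede the block in y. *)
    rewrite !par off0 andbF orbF off_rev // andbF orbF => xp yp; exfalso.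
    case: p pA pA' fp off0 xp yp {off_rev par} => [w _ _ /= wS _ xw yw|f fF fF' /= _ off0 xf yf].
      have [e [eF we lt_we ne]] := next_x sw wS.
      have le_we := reach_y sw (p := inr e) wS eF we.
      have xe : x (inr el) < x (inr e) by exact: ltn_trans lt_we.
      move: (eF); rewrite !mem_cat => /or3P[e1|eB|e2].
      - by have := x_left sw e1 elB; rewrite ltnNge ltnW.
      - by have := el_max eB; rewrite leqNgt xe.
      - by have := leq_trans (ltn_trans (y_right sw e2 efB) yw) le_we; rewrite ltnn.
    move: (fF'); rewrite /= !mem_cat => /or3P[f1|fB|f2].
    - by have := x_left sw f1 elB; rewrite ltnNge ltnW.
    - by have := el_max fB; rewrite leqNgt xf.
    - by have := y_right sw f2 efB; rewrite ltnNge ltnW.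
  have -> : (u == v) = false by apply: contraNF vS => /eqP <-.
  case: (step_active vS tlS tlO pA) => [[fp _]|[fp pA' _ par _]].
    rewrite !(parent_new vS tlS _ fp pA) => xu yu; rewrite fp.
    exact: (dom_block B_reach sw elB efB uS (lex_le xu) (lex_le yu)).
  by rewrite !par => xu yu; exact: (sweep2_dom sw uS pA' (lex_le xu) (lex_le yu)).
move=> u z p q uS' zS' pA qA.
(* So far v reaches no vertex but itself; hence if u or z is v, both p and q stand for v, and v
   interpolates. *)
have v_stuck w : w \in v |: S -> reach v w -> w = v.
  by rewrite in_setU1 => /predU1P[//|/v_max /negP].
have footS r : active (v |: S) (l1 ++ O ++ l2) r -> foot r \in v |: S.
  by case/(step_active vS tlS tlO) => [[-> _]|[fr _ _ _ _]]; rewrite in_setU1 ?eqxx ?fr ?orbT.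
move=> rp rq zp zq.
have both_new : foot p = v -> foot q = v ->
    exists m, [/\ m \in v |: S, reach u m, reach z m, reach m (foot p) & reach m (foot q)].
  move=> fp fq; exists v; rewrite in_setU1 eqxx fp fq reach_refl.
  by move: rp zp; rewrite fp.
case: (u =P v) => [uv|nuv].
  by apply: both_new; apply: v_stuck (footS _ _) _ => //; rewrite -uv.
case: (z =P v) => [zv|nzv].
  by apply: both_new; apply: v_stuck (footS _ _) _ => //; rewrite -zv.
have {uS'}uS : u \in S by move: uS'; rewrite in_setU1 => /predU1P[].
have {zS'}zS : z \in S by move: zS'; rewrite in_setU1 => /predU1P[].
have one_new r r' : active (v |: S) (l1 ++ O ++ l2) r' -> foot r = v -> foot r' \in S ->
    reach u (foot r) -> reach u (foot r') -> reach z (foot r) -> reach z (foot r') ->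
    exists m, [/\ m \in v |: S, reach u m, reach z m, reach m (foot r) & reach m (foot r')].
  move=> rA fr fr'; rewrite fr => ur ur' zr zr'.
  have old m : [/\ m \in S, reach u m, reach z m, reach m v & reach m (foot r')] ->
      exists m, [/\ m \in v |: S, reach u m, reach z m, reach m v & reach m (foot r')].
    by case=> mS *; exists m; split=> //; rewrite in_setU1 mS orbT.
  have rA' : active S (l1 ++ B ++ l2) r'.
    by case: (step_active vS tlS tlO rA) => [[fv _]|[]//]; case/negP: vS; rewrite -fv.
  case: (old_beside rA fr') => [[rv rE]|xr|yr].
  - by apply: (old (foot r')); split.
  - have [m mP] := lat_right reach_v B_reach sw elB el_max uS zS rA' xr ur ur' zr zr'.
    exact: old mP.
  - by have [m mP] := lat_left uS zS rA' yr ur ur' zr zr'; exact: old mP.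
case: (step_active vS tlS tlO pA) => [[fp _]|[fp pA' _ _ _]];
  case: (step_active vS tlS tlO qA) => [[fq _]|[fq qA' _ _ _]].
- exact: both_new.
- exact: one_new.
- by have [m [mS um zm mq mp]] := one_new q p pA fq fp rq rp zq zp; exists m.
have [m [mS um zm mp mq]] := sweep2_lat sw uS zS pA' qA' rp rq zp zq.
by exists m; rewrite in_setU1 mS orbT.
Qed.

End Step3.

Definition start_rank (O : seq D) (p : V + D) : nat :=
  match p with inl _ => 0 | inr d => (index d O).+1 end.

Lemma sweep_start (v : V) (O : seq D) : (forall d, d \in O -> tl d = v) -> uniq O ->
  O != [::] -> sweep [set v] O (start_rank O).
Proof.
move=> tlO uO O0; split.
- by move=> u [w|d] //= /set1P-> /set1P->.
- by apply: pairwise_in (pairwise_index uO) _ => d e _ _ /=; rewrite ltnS.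
- by [].
move=> u /set1P->; case: O tlO {uO} O0 => // o O' tlO _.
exists o; rewrite /= mem_head eqxx tlO ?mem_head //; split=> //.
Qed.

Lemma sweep2_start (v : V) (O : seq D) : (forall d, d \in O -> tl d = v) -> uniq O ->
  O != [::] -> sweep2 [set v] O (start_rank O) (start_rank (rev O)).
Proof.
move=> tlO uO O0; split.
- exact: sweep_start.
- apply: sweep_start; rewrite ?rev_uniq //; first by move=> d; rewrite mem_rev; exact: tlO.
  by apply: contraNneq O0 => eqO; rewrite -[O]revK eqO.
- by move=> u [w|d] /= /set1P-> => [/set1P->|/tlO->] _ _; exact: reach_refl.
move=> u z p q /set1P-> /set1P-> _ _ vp vq _ _.
by exists v; rewrite in_set1 eqxx; split.
Qed.

End Sweep.

(** * Plane bipolar posets *)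

Section Poset.
Variable M : oriented_map.

Definition face_perm : {perm M} := fnext (vnext M) (opp M).
Definition cw : {perm M} := ((vnext M)^-1)%g.

Definition edge (u v : {set M}) : bool :=
  [exists d : M, [&& d \in fwd M, tail d == u & head d == v]].

Definition reach : rel {set M} := connect edge.

Lemma face_permE (d : M) : face_perm d = cw (opp M d).
Proof. by rewrite /face_perm /fnext permM. Qed.

Lemma oppP (d : M) : opp M (opp M d) = d. Proof. exact: oppK. Qed.

Lemma face_permV (d : M) : (face_perm^-1)%g d = opp M (vnext M d).
Proof. by apply: (@perm_inj _ face_perm); rewrite permKV face_permE oppP /cw permK. Qed.

Lemma fwd_oppN (d : M) : (opp M d \in fwd M) = (d \notin fwd M).
Proof. exact: fwd_opp. Qed.

Lemma tail_vnext (d : M) : tail (vnext M d) = tail d.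
Proof. by rewrite /tail porbit_step. Qed.

Lemma tail_cw (d : M) : tail (cw d) = tail d.
Proof. by rewrite -[in RHS](permKV (vnext M) d) tail_vnext. Qed.

Lemma tail_eqP (d e : M) : tail d = tail e -> e \in porbit (vnext M) d.
Proof. by rewrite /tail => ->; exact: porbit_id. Qed.

Lemma head_opp (d : M) : head (opp M d) = tail d.
Proof. by rewrite /head oppP. Qed.

Lemma tail_vertices (d : M) : tail d \in vertices M.
Proof. exact: imset_f. Qed.

Lemma tail_face_perm (d : M) : tail (face_perm d) = head d.
Proof. by rewrite face_permE tail_cw. Qed.

Lemma left_face_step (d : M) : left_face (face_perm d) = left_face d.
Proof. by rewrite /left_face porbit_step. Qed.

Lemma fwd_edge (d : M) : d \in fwd M -> edge (tail d) (head d).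
Proof. by move=> fd; apply/existsP; exists d; rewrite fd !eqxx. Qed.

Lemma fwd_reach (d : M) : d \in fwd M -> reach (tail d) (head d).
Proof. by move/fwd_edge/connect1. Qed.

Lemma reach_trans : transitive reach. Proof. exact: connect_trans. Qed.

Lemma reach_walk (u v : {set M}) : reach u v -> exists p, dwalk u p v.
Proof.
case/connectP => p; elim: p u => [|w p IH] u /=; first by move=> _ ->; exists [::] => /=.
case/andP => /existsP[d /and3P[fd /eqP <- /eqP hd]] pp vl.
by have [q q1] := IH _ pp vl; exists (d :: q); rewrite /= fd eqxx hd.
Qed.

Lemma walk_reach (u v : {set M}) (p : seq M) : dwalk u p v -> reach u v.
Proof.
elim: p u => [|d p IH] u /=; first by move/eqP->; exact: connect0.
by case/and3P => fd /eqP <- /IH; apply: reach_trans; exact: fwd_reach.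
Qed.

Lemma card_opp_porbits : #|porbits (opp M)| = #|fwd M|.
Proof.
rewrite (card_porbits_involution (up := mem (fwd M)) oppP); last exact: fwd_oppN.
by apply: eq_card => d; rewrite inE.
Qed.

(** * Poles, bottom corners and Euler's formula *)

Variables (t : {set M}) (tau : M).
Hypotheses (acyM : acyclic M)
  (sourceM : forall v : {set M}, source v <-> v = root_vertex M)
  (sinkM : forall v : {set M}, sink v <-> v = t)
  (tail_tau : tail tau = t) (face_tau : left_face tau = root_face M)
  (irredM : forall e : M, ~ transitive_edge e).

Let s := root_vertex M.

Lemma edge_acyclic (d : M) : d \in fwd M -> ~~ reach (head d) (tail d).
Proof.
move=> fd; apply/negP => /reach_walk[p walk_p].
by have /acyM : dwalk (tail d) (d :: p) (tail d) by rewrite /= fd eqxx.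
Qed.

Lemma edge_neq (d : M) : d \in fwd M -> tail d <> head d.
Proof. by move=> fd eq_d; have := edge_acyclic fd; rewrite eq_d /reach connect0. Qed.

Lemma reach_anti (u v : {set M}) : reach u v -> reach v u -> u = v.
Proof.
case/connectP => -[|w p] /=; first by move=> _ ->.
case/andP => /existsP[d /and3P[fd /eqP <- /eqP <-]] pp vl rv.
case/negP: (edge_acyclic fd); apply: reach_trans rv.
by apply/connectP; exists p.
Qed.

Lemma head_source (d : M) : d \in fwd M -> head d <> s.
Proof. by have [_ /(_ d)] : source s by apply/sourceM. Qed.

Lemma tail_sink (d : M) : d \in fwd M -> tail d <> t.
Proof. by have [_ /(_ d)] : sink t by apply/sinkM. Qed.

Lemma in_edge_ex (v : {set M}) : v \in vertices M -> v <> s ->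
  exists2 d, d \in fwd M & head d = v.
Proof.
move=> vV vs; case: (pickP [pred d in fwd M | head d == v]) => [d /andP[fd /eqP]|none].
  by exists d.
by case: vs; apply/sourceM; split=> // d fd hd; have := none d; rewrite /= fd hd eqxx.
Qed.

Lemma out_edge_ex (v : {set M}) : v \in vertices M -> v <> t ->
  exists2 d, d \in fwd M & tail d = v.
Proof.
move=> vV vt; case: (pickP [pred d in fwd M | tail d == v]) => [d /andP[fd /eqP]|none].
  by exists d.
by case: vt; apply/sinkM; split=> // d fd hd; have := none d; rewrite /= fd hd eqxx.
Qed.

Lemma source_fwd (d : M) : tail d = s -> d \in fwd M.
Proof.
move=> tds; apply: contraT => nfd.
by have := @head_source (opp M d); rewrite fwd_oppN nfd head_opp => /(_ isT).
Qed.

Lemma sink_bwd (d : M) : tail d = t -> d \notin fwd M.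
Proof. by move=> tdt; apply/negP => /tail_sink. Qed.

Lemma source_neq_sink : s <> t.
Proof. by move=> st; have /tail_sink := @source_fwd (root M) erefl. Qed.

Lemma source_vertex : s \in vertices M. Proof. exact: tail_vertices. Qed.
Lemma sink_vertex : t \in vertices M. Proof. by rewrite -tail_tau tail_vertices. Qed.

(** The corner between d and [vnext d] is a bottom corner of the face on the left of d when both
    darts go out. When only d goes out, d is the left end of a run of outgoing edges. Each edge is
    of exactly one kind. *)
Definition bottoms : {set M} := [set d in fwd M | vnext M d \in fwd M].
Definition leftmost_outs : {set M} := [set d in fwd M | vnext M d \notin fwd M].

Lemma iter_face_fwd (d : M) (k : nat) :
  (forall i, i < k -> iter i face_perm d \in fwd M) ->
  reach (tail d) (tail (iter k face_perm d)).
Proof.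
elim: k => [|k IH] fk; first exact: connect0.
apply: reach_trans (IH _) _ => [i ik|]; first by apply: fk; exact: ltnW.
by rewrite iterS tail_face_perm; apply: fwd_reach; exact: fk.
Qed.

Lemma iter_face_bwd (d : M) (k : nat) :
  (forall i, i < k -> iter i face_perm d \notin fwd M) ->
  reach (tail (iter k face_perm d)) (tail d).
Proof.
elim: k => [|k IH] fk; first exact: connect0.
apply: reach_trans (IH _) => [|i ik]; last by apply: fk; exact: ltnW.
rewrite iterS tail_face_perm -[X in reach _ (tail X)]oppP -/(head _).
by apply: fwd_reach; rewrite fwd_oppN fk.
Qed.

(** A face boundary made of forward darts only would be a directed cycle. *)
Lemma face_has_bwd (d : M) : exists2 e, e \in porbit face_perm d & e \notin fwd M.
Proof.
case: (pickP [pred e in porbit face_perm d | e \notin fwd M]) => [e /andP[]|all_fwd].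
  by exists e.
have fwdP i : iter i face_perm d \in fwd M.
  have := all_fwd (iter i face_perm d); rewrite /= => /negbT; rewrite negb_and negbK.
  by case/orP => //; case/negP; apply/porbit_iterP; exists i.
have : reach (tail (face_perm d)) (tail (iter (#|porbit face_perm d|).-1 face_perm (face_perm d))).
  by apply: iter_face_fwd => i _; rewrite -iterSr.
rewrite -iterSr prednK ?iter_porbit; last by apply/card_gt0P; exists d; exact: porbit_id.
by rewrite tail_face_perm; have /negbTE-> := edge_acyclic (fwdP 0).
Qed.

Lemma face_has_fwd (d : M) : exists2 e, e \in porbit face_perm d & e \in fwd M.
Proof.
case: (pickP [pred e in porbit face_perm d | e \in fwd M]) => [e /andP[]|all_bwd].
  by exists e.
have bwdP i : iter i face_perm d \notin fwd M.
  have := all_bwd (iter i face_perm d); rewrite /= => /negbT; rewrite negb_and.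
  by case/orP => //; case/negP; apply/porbit_iterP; exists i.
have : reach (tail (iter (#|porbit face_perm d|).-1 face_perm (face_perm d))) (tail (face_perm d)).
  by apply: iter_face_bwd => i _; rewrite -iterSr.
rewrite -iterSr prednK ?iter_porbit; last by apply/card_gt0P; exists d; exact: porbit_id.
rewrite tail_face_perm -(head_opp d).
have := @edge_acyclic (opp M d); rewrite fwd_oppN (bwdP 0) => /(_ isT) /negP nr rr.
by case: nr.
Qed.

Lemma rise_bottoms (d : M) : (d \in bottoms) = (d \in fwd M) && ((face_perm^-1)%g d \notin fwd M).
Proof. by rewrite inE face_permV fwd_oppN negbK. Qed.

Lemma face_bottom (d : M) : exists2 e, e \in bottoms & e \in porbit face_perm d.
Proof.
have [e ed] := porbit_rise (face_has_fwd d) (face_has_bwd d).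
by rewrite -rise_bottoms; exists e.
Qed.

(** An inner vertex has darts of both directions, so turning clockwise passes at some point from an
    incoming dart to an outgoing one. *)
Lemma leftmost_out_ex (v : {set M}) : v \in vertices M -> v <> s -> v <> t ->
  exists2 d, d \in leftmost_outs & tail d = v.
Proof.
move=> vV vs vt.
have [d fd td] := out_edge_ex vV vt; have [e fe he] := in_edge_ex vV vs.
have [||f fd'] := @porbit_rise _ cw (mem (fwd M)) d.
- by exists d => //; exact: porbit_id.
- exists (opp M e); last by rewrite /= fwd_oppN negbK.
  by rewrite porbitV; apply: tail_eqP; rewrite td -he.
rewrite /= invgK => /andP[ff nf]; exists f; first by rewrite inE ff.
by move: fd'; rewrite porbitV => fd'; rewrite -td /tail; apply/eqP; rewrite eq_porbit_mem.
Qed.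

Lemma card_fwd_split : #|fwd M| = #|bottoms| + #|leftmost_outs|.
Proof.
rewrite -(cardsID [set d | vnext M d \in fwd M] (fwd M)).
by congr (_ + _); apply: eq_card => d; rewrite !inE // andbC.
Qed.

(* Euler's formula forces equality in both counts: every vertex other than the
   poles has one leftmost outgoing edge, every face has one bottom corner. *)
Lemma bottom_count :
  #|porbits face_perm| = #|bottoms| /\ #|vertices M :\: [set s; t]| = #|leftmost_outs|.
Proof.
have le1 : #|porbits face_perm| <= #|bottoms| by apply: card_porbits_hit => x; exact: face_bottom.
have le2 : #|vertices M :\: [set s; t]| <= #|leftmost_outs|.
  apply: leq_trans (leq_imset_card (@tail M) _); apply/subset_leq_card/subsetP => v.
  rewrite !inE negb_or => /andP[/andP[/eqP vs /eqP vt] vV].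
  by have [d dL <-] := leftmost_out_ex vV vs vt; apply: imset_f.
have card_st : #|vertices M :\: [set s; t]| + 2 = #|vertices M|.
  have <- : #|[set s; t]| = 2 by rewrite cards2; have /eqP -> := source_neq_sink.
  rewrite addnC -[in RHS](cardsID [set s; t]) (setIidPr _) //.
  by apply/subsetP => v; rewrite !inE => /orP[]/eqP->; rewrite ?source_vertex ?sink_vertex.
(* The number of edges is [#|bottoms| + #|leftmost_outs|], so V + F = E + 2 leaves no slack in [le1]
   and [le2]. *)
have := map_euler M; rewrite card_opp_porbits card_fwd_split.
change (porbits (vnext M)) with (vertices M); rewrite -/face_perm -card_st; lia.
Qed.

(** A surjection between finite sets of the same size, here from bottoms to faces, is injective. *)
Lemma bottom_uniq (d e : M) : d \in bottoms -> e \in bottoms ->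
  left_face d = left_face e -> d = e.
Proof.
have [+ _] := bottom_count; rewrite (porbits_hit face_bottom) => /eqP/imset_injP inj_b.
by move=> db eb; exact: inj_b.
Qed.

Lemma leftmost_out_uniq (d e : M) : d \in leftmost_outs -> e \in leftmost_outs ->
  tail d = tail e -> d = e.
Proof.
have [_ eqc] := bottom_count.
suff /imset_injP inj_b : #|(@tail M) @: leftmost_outs| == #|leftmost_outs|.
  by move=> db eb; exact: inj_b.
rewrite eqn_leq leq_imset_card -eqc; apply/subset_leq_card/subsetP => v.
rewrite !inE negb_or => /andP[/andP[/eqP vs /eqP vt] vV].
by have [d' dL <-] := leftmost_out_ex vV vs vt; apply: imset_f.
Qed.

(** Where the clockwise list of darts at v is cut open: at the leftmost outgoing edge of an inner
    vertex, and at the outer corner of a pole, whose darts all have one direction. For a vertex of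
    the map the default of [odflt] is never reached. *)
Definition start (v : {set M}) : M :=
  if v == s then root M else if v == t then tau
  else odflt tau [pick d in leftmost_outs | tail d == v].

Lemma start_leftmost (v : {set M}) : v \in vertices M -> v <> s -> v <> t ->
  start v \in leftmost_outs /\ tail (start v) = v.
Proof.
rewrite /start => vV vs vt; case: eqP => // _; case: eqP => // _.
case: pickP => [d /andP[dL /eqP] //|none].
by have [d dL /eqP td] := leftmost_out_ex vV vs vt; have := none d; rewrite dL td.
Qed.

Lemma tail_start (v : {set M}) : v \in vertices M -> tail (start v) = v.
Proof.
move=> vV; case: (v =P s) => [->|vs]; first by rewrite /start eqxx.
case: (v =P t) => [->|vt]; last by have [] := start_leftmost vV vs vt.
by rewrite /start eqxx; case: eqP => // ts; case: source_neq_sink.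
Qed.

(* The darts at v, clockwise: the outgoing edges from left to right, then the
   incoming ones from right to left. *)
Definition around (v : {set M}) : seq M := fingraph.orbit cw (start v).
Definition outs (v : {set M}) : seq M := [seq d <- around v | d \in fwd M].
Definition ins (v : {set M}) : seq M :=
  rev [seq opp M d | d <- around v & d \notin fwd M].

Lemma around_uniq (v : {set M}) : uniq (around v). Proof. exact: orbit_uniq. Qed.

Lemma around_cycle (v : {set M}) : fcycle cw (around v).
Proof. exact/cycle_orbit/perm_inj. Qed.

Lemma mem_around (v : {set M}) (d : M) : v \in vertices M -> (d \in around v) = (tail d == v).
Proof.
move=> vV; rewrite /around -fconnect_orbit -[in RHS](tail_start vV) /tail eq_porbit_mem.
rewrite -[in RHS]porbitV.
apply/idP/porbit_iterP => [/iter_findex <-|[i ->]]; last exact: fconnect_iter.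
by exists (findex cw (start v) d).
Qed.

Lemma around_start (v : {set M}) : exists p, around v = start v :: p.
Proof. by rewrite /around /fingraph.orbit -orderSpred; eexists. Qed.

(** An outgoing dart directly after an incoming one is a leftmost outgoing edge. There is only one,
    and the list already begins with it, so the outgoing darts form a prefix. *)
Lemma around_split (v : {set M}) : v \in vertices M ->
  around v = outs v ++ [seq opp M d | d <- rev (ins v)].
Proof.
move=> vV; rewrite /ins revK -map_comp (eq_map (_ : _ =1 id)) ?map_id; last exact: oppP.
apply: filter_split; have [p ap] := around_start v.
have := around_cycle v; have := around_uniq v; have memv := fun d => mem_around d vV.
move: memv; rewrite {}ap => memv /= /andP[np _]; rewrite rcons_path => /andP[pp _].
apply: sub_fpath pp => d dp; apply/implyP => fd; apply: contraT => nd.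
have tv : tail d = v by rewrite -tail_cw; apply/eqP; rewrite -memv inE dp orbT.
case: (v =P s) => [vs|vs]; first by move: nd; rewrite source_fwd ?tv.
case: (v =P t) => [vt|vt]; first by have := @sink_bwd (cw d); rewrite tail_cw tv fd => /(_ vt).
case/negP: np; rewrite (_ : start v = cw d) //.
have [stL tst] := start_leftmost vV vs vt.
by apply: leftmost_out_uniq => //; rewrite ?tail_cw ?tv // inE fd /cw permKV.
Qed.

Lemma mem_outs (v : {set M}) (d : M) : v \in vertices M ->
  (d \in outs v) = (d \in fwd M) && (tail d == v).
Proof. by move=> vV; rewrite mem_filter mem_around. Qed.

Lemma mem_ins (v : {set M}) (d : M) : v \in vertices M ->
  (d \in ins v) = (d \in fwd M) && (head d == v).
Proof.
move=> vV; rewrite mem_rev -{1}(oppP d) mem_map; last exact: (can_inj oppP).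
by rewrite mem_filter mem_around // fwd_oppN negbK.
Qed.

Lemma outs_uniq (v : {set M}) : uniq (outs v).
Proof. exact/filter_uniq/around_uniq. Qed.

Lemma ins_uniq (v : {set M}) : uniq (ins v).
Proof.
by rewrite rev_uniq map_inj_uniq ?filter_uniq ?around_uniq //; exact: (can_inj oppP).
Qed.

(** * Faces met along a left-to-right list of edges *)

Definition lf (d : M) : {set M} := left_face d.
Definition rf (d : M) : {set M} := left_face (opp M d).

Lemma rf_cw (d : M) : rf d = lf (cw d).
Proof. by rewrite /rf -left_face_step face_permE oppP. Qed.

Lemma lf_cw_opp (d : M) : lf d = lf (cw (opp M d)).
Proof. by rewrite /lf -left_face_step face_permE. Qed.

(* Consecutive edges of the list p separate consecutive faces, from the face a
   on its left to the face b on its right. *)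
Fixpoint fchain (a : {set M}) (p : seq M) (b : {set M}) : bool :=
  if p is d :: p' then (lf d == a) && fchain (rf d) p' b else a == b.

Lemma fchain_cat (a b : {set M}) (p q : seq M) :
  fchain a (p ++ q) b <-> exists2 c, fchain a p c & fchain c q b.
Proof.
elim: p a => [|d p IH] a /=.
  by split=> [h|[c /eqP-> //]]; exists a.
split=> [/andP[-> /IH[c pc qc]]|[c /andP[-> pc] qc]]; first by exists c.
by apply/IH; exists c.
Qed.

Lemma fchain_inj (a b a' b' : {set M}) (p : seq M) :
  p != [::] -> fchain a p b -> fchain a' p b' -> a = a' /\ b = b'.
Proof.
case: p => // d p _ /= /andP[/eqP <- h1] /andP[/eqP <- h2]; split=> //.
elim: p d h1 h2 => [|e p IH] d /=; first by move=> /eqP <- /eqP <-.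
by case/andP => _ h1 /andP[_ h2]; exact: IH h1 h2.
Qed.

Lemma fpath_fchain (d : M) (p : seq M) :
  fpath cw d p -> fchain (lf d) (d :: p) (rf (last d p)).
Proof.
elim: p d => [|e p IH] d /=; first by rewrite !eqxx.
case/andP => /eqP de pp; have /= /andP[_ h] := IH _ pp.
by rewrite eqxx (rf_cw d) de eqxx.
Qed.

(** Incoming darts run clockwise from right to left, so e is the incoming edge immediately to the
    right of d. *)
Definition next_in : rel M := fun d e => cw (opp M e) == opp M d.

Lemma next_in_fchain (d : M) (p : seq M) :
  path next_in d p -> fchain (lf d) (d :: p) (rf (last d p)).
Proof.
elim: p d => [|e p IH] d /=; first by rewrite !eqxx.
case/andP => /eqP de pp; have /= /andP[_ h] := IH _ pp.
by rewrite eqxx (lf_cw_opp e) de eqxx.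
Qed.

Lemma around_sorted (v : {set M}) : sorted (frel cw) (around v).
Proof.
have [p ap] := around_start v; have := around_cycle v; rewrite ap /=.
by rewrite rcons_path => /andP[].
Qed.

Lemma outs_sorted (v : {set M}) : v \in vertices M -> sorted (frel cw) (outs v).
Proof.
by move=> vV; have := around_sorted v; rewrite around_split // => /cat_sorted2[].
Qed.

Lemma ins_sorted (v : {set M}) : v \in vertices M -> sorted next_in (ins v).
Proof.
move=> vV; have := around_sorted v; rewrite around_split // => /cat_sorted2[_].
by rewrite sorted_map rev_sorted.
Qed.

Lemma around_source : around s = outs s.
Proof.
rewrite /outs (all_filterP _) //; apply/allP => d; rewrite mem_around ?source_vertex // => /eqP.
exact: source_fwd.
Qed.

Lemma fchain_source : fchain (root_face M) (outs s) (root_face M).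
Proof.
rewrite -around_source; have [p ap] := around_start s; have := around_cycle s.
rewrite ap /= rcons_path => /andP[pp /eqP lastp].
have st : start s = root M by rewrite /start eqxx.
have := fpath_fchain pp; rewrite rf_cw lastp st /=.
by rewrite /root_face /lf !eqxx.
Qed.

Lemma around_sink : around t = [seq opp M d | d <- rev (ins t)].
Proof.
rewrite {1}(around_split sink_vertex) (_ : outs t = [::]) //.
apply/eqP; rewrite -[_ == _]negbK -has_filter; apply/hasPn => d.
by rewrite mem_around ?sink_vertex // => /eqP /sink_bwd.
Qed.

Lemma start_sink : start t = tau.
Proof. by rewrite /start eqxx; case: eqP => // /esym /source_neq_sink. Qed.

Lemma last_ins_sink : exists p, ins t = rcons p (opp M tau).
Proof.
have [p ap] := around_start t; move: around_sink; rewrite ap start_sink => eqi.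
exists (rev [seq opp M d | d <- p]); rewrite -rev_cons -map_cons eqi -map_comp.
by rewrite (eq_map (_ : _ =1 id)) ?map_id ?revK //; exact: oppP.
Qed.

(** The two corners of v between an incoming and an outgoing edge lie in the faces a and b. This
    allows [outs v] to replace [ins v] in a frontier without breaking its chain of faces. *)
Lemma fchains (v : {set M}) : v \in vertices M -> v <> s -> v <> t ->
  exists a b, [/\ fchain a (outs v) b, fchain a (ins v) b, outs v != [::] & ins v != [::]].
Proof.
move=> vV vs vt.
have [d fd td] := out_edge_ex vV vt; have [e fe he] := in_edge_ex vV vs.
have : d \in outs v by rewrite mem_outs // fd td eqxx.
have : e \in ins v by rewrite mem_ins // fe he eqxx.
have := around_cycle v; rewrite around_split //.
have := outs_sorted vV; have := ins_sorted vV.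
case: (ins v) => // i p; case: (outs v) => // o q pp pq.
rewrite rev_cons map_rcons -rcons_cat /= rcons_path last_rcons rcons_path cat_path.
move=> /andP[/andP[/andP[_ c1] c2] c3] _ _.
(* [c3] is the turn on the left, from the first incoming to the first outgoing edge; the turn on the
   right, from the last outgoing to the last incoming edge, is in [c1], or in [c2] if only one edge
   enters. *)
exists (lf o), (rf (last o q)); split=> //; first exact: fpath_fchain.
suff [eql eqr] : lf i = lf o /\ rf (last o q) = rf (last i p).
  by rewrite -eql eqr; apply: next_in_fchain.
split; first by rewrite lf_cw_opp -(eqP c3).
rewrite rf_cw; move: c1 c2; case/lastP: p {pp c3} => [|p j].
  by rewrite /= cats0 => _ /eqP->; rewrite /rf /lf.
by rewrite (rev_rcons p j) last_rcons /= => /andP[/eqP-> _] _; rewrite /rf /lf.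
Qed.

(** By [bottom_uniq], b is the only rise of its face, so [up_run] applies. *)
Lemma face_run (b d : M) : b \in bottoms -> d \in fwd M -> left_face d = left_face b ->
  exists2 k, d = iter k face_perm b & forall i, i <= k -> iter i face_perm b \in fwd M.
Proof.
move=> bB fd eq_face.
have rise : {in porbit face_perm b, forall z, z \in fwd M -> (face_perm^-1)%g z \notin fwd M -> z = b}.
  move=> z zb fz nz; apply: bottom_uniq => //; first by rewrite rise_bottoms fz.
  by apply/eqP; rewrite /left_face eq_porbit_mem.
have /porbit_iterP[k dk] : d \in porbit face_perm b.
  by rewrite -eq_porbit_mem -[_ == _]/(left_face d == left_face b) eq_face.
by move: fd; rewrite dk => /(up_run rise).
Qed.

(** Both darts lie on the single directed run that climbs one side of the face from its bottom. *)
Lemma face_fwd_total (d e : M) : d \in fwd M -> e \in fwd M -> lf d = lf e ->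
  [\/ d = e, reach (head d) (tail e) | reach (head e) (tail d)].
Proof.
move=> fd fe eq_de; have [b bB bd] := face_bottom d.
have db : left_face d = left_face b by apply/eqP; rewrite eq_porbit_mem porbit_sym.
have [k dk fk] := face_run bB fd db.
have [l el fl] := face_run bB fe (etrans (esym eq_de) db).
have run i j : i < j -> (forall m, m <= j -> iter m face_perm b \in fwd M) ->
    reach (head (iter i face_perm b)) (tail (iter j face_perm b)).
  move=> ij fj; rewrite -tail_face_perm -iterS -(subnK ij) iterD.
  by apply: iter_face_fwd => m ms; rewrite -iterD; apply: fj; lia.
by case: (ltngtP k l) => [kl|kl|kl]; [constructor 2|constructor 3|constructor 1]; rewrite dk el ?kl //; exact: run.
Qed.

(** The dart before d on its face is forward and d is not, so d comes right after the forward run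
    from the bottom, and a face has only one such run. *)
Lemma top_uniq (d e : M) : d \notin fwd M -> e \notin fwd M ->
  vnext M d \notin fwd M -> vnext M e \notin fwd M -> left_face d = left_face e -> d = e.
Proof.
move=> nd ne vd ve eq_de; have [b bB bd] := face_bottom d.
have db : left_face d = left_face b by apply/eqP; rewrite eq_porbit_mem porbit_sym.
have prev c : vnext M c \notin fwd M -> left_face c = left_face b ->
    exists2 k, c = iter k.+1 face_perm b & forall i, i <= k -> iter i face_perm b \in fwd M.
  move=> vc cb; have cE : face_perm ((face_perm^-1)%g c) = c by rewrite permKV.
  have [||k ck fk] := @face_run b ((face_perm^-1)%g c) bB.
  - by rewrite face_permV fwd_oppN.
  - by rewrite -left_face_step cE.
  by exists k => //; rewrite iterS -ck cE.
have [k dk fk] := prev d vd db; have [l el fl] := prev e ve (etrans (esym eq_de) db).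
case: (ltngtP k l) => kl; last by rewrite dk el kl.
  by move: nd; rewrite dk fl.
by move: ne; rewrite el fk.
Qed.

(** The corner between d and e is a top corner of the outer face, and so is the corner of [tau]. *)
Lemma root_face_top (d e : M) : d \in fwd M -> e \in fwd M -> next_in d e ->
  rf d = root_face M -> opp M d = tau.
Proof.
move=> fd fe /eqP nde rd; have vd : vnext M (opp M d) = opp M e by rewrite -nde permKV.
apply: top_uniq; rewrite ?fwd_oppN ?fd ?vd ?fwd_oppN ?fe //; first exact: sink_bwd.
  by apply: sink_bwd; rewrite tail_vnext.
by rewrite face_tau.
Qed.

(** * Downsets of vertices and the frontiers they cut out *)

Definition downset (S : {set {set M}}) : Prop :=
  [/\ S \subset vertices M, s \in S, t \notin S &
      forall d : M, d \in fwd M -> head d \in S -> tail d \in S].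

Definition crossing (S : {set {set M}}) (d : M) : bool :=
  [&& d \in fwd M, tail d \in S & head d \notin S].

Lemma downset_reach (S : {set {set M}}) (u v : {set M}) :
  downset S -> reach u v -> v \in S -> u \in S.
Proof.
case=> _ _ _ closed /reach_walk[p]; elim: p u => [|d p IH] u /=; first by move/eqP->.
by case/and3P => fd /eqP <- wp vS; apply: closed => //; exact: IH.
Qed.

(** Of two edges on the same side of a face, the higher one starts at or above the head of the lower
    one; if both crossed, that head would belong to S. *)
Lemma crossing_inj (S : {set {set M}}) (d e : M) :
  downset S -> crossing S d -> crossing S e -> lf d = lf e -> d = e.
Proof.
move=> dS /and3P[fd td hd] /and3P[fe te he] /(face_fwd_total fd fe)[//|r|r].
  by case/negP: hd; exact: downset_reach r te.
by case/negP: he; exact: downset_reach r td.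
Qed.

(** The frontier and the list [ins v] are followed together: the next edge of each has [rf d] on its
    left and both cross S, so [crossing_inj] identifies them. *)
Lemma ins_prefix (S : {set {set M}}) (v : {set M}) (F pre p : seq M) (d : M) :
  downset S -> v \in vertices M -> ins v = pre ++ d :: p ->
  all (crossing S) p -> all (crossing S) F -> fchain (rf d) F (root_face M) ->
  exists l, F = p ++ l.
Proof.
move=> dS vV; elim: p F pre d => [|e p IH] F pre d eq_ins; first by exists F.
move=> /= /andP[ce cp] cF chF.
have eI : e \in ins v by rewrite eq_ins mem_cat !inE eqxx !orbT.
have dI : d \in ins v by rewrite eq_ins mem_cat !inE eqxx !orbT.
have [fd hd] : d \in fwd M /\ head d = v by move: dI; rewrite mem_ins // => /andP[? /eqP].
have [fe he] : e \in fwd M /\ head e = v by move: eI; rewrite mem_ins // => /andP[? /eqP].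
have de : next_in d e.
  by have := ins_sorted vV; rewrite eq_ins => /cat_sorted2[_] /= /andP[].
case: F cF chF => [|f F] /=.
  (* The frontier cannot stop at d: with the outer face on its right, d would be the rightmost edge
     into the sink, yet e follows it. *)
  move=> _ /eqP rd; have od := root_face_top fd fe de rd.
  have vt : v = t by rewrite -hd -tail_tau -od.
  have [q eq_last] := last_ins_sink.
  have lst : last d (ins v) = d by rewrite vt eq_last last_rcons -od oppP.
  have := ins_uniq v; rewrite eq_ins cat_uniq => /and3P[_ _ /=].
  by rewrite -{1}lst eq_ins last_cat /= mem_last.
case/andP => cf cF /andP[/eqP lf_f chF].
have ef : f = e.
  by apply: crossing_inj dS _ _ _ => //; rewrite lf_f (lf_cw_opp e) (eqP de).
have eq' : ins v = rcons pre d ++ e :: p by rewrite cat_rcons.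
rewrite {}ef in chF *; have [l ->] := IH _ _ _ eq' cp cF chF.
by exists l.
Qed.

Definition frontier (S : {set {set M}}) (F : seq M) : Prop :=
  [/\ uniq F, F =i crossing S & fchain (root_face M) F (root_face M)].

Lemma frontier_block (S : {set {set M}}) (v : {set M}) (F : seq M) :
  downset S -> frontier S F -> v \in vertices M -> v \notin S ->
  (forall d, d \in fwd M -> head d = v -> tail d \in S) ->
  exists l1 l2, F = l1 ++ ins v ++ l2.
Proof.
move=> dS [uF memF chF] vV vS predS.
have cI d : d \in ins v -> crossing S d.
  by rewrite mem_ins // => /andP[fd /eqP hd]; rewrite /crossing fd hd vS (predS d).
case eq_ins : (ins v) => [|d p]; first by exists [::], F.
have dF : d \in F by rewrite memF; apply: cI; rewrite eq_ins mem_head.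
case/splitPr: dF uF memF chF => F1 F2 uF memF /fchain_cat[c _ /= /andP[_ ch2]].
have [||l ->] := @ins_prefix S v F2 [::] p d dS vV eq_ins _ _ ch2.
- by apply/allP => e ep; apply: cI; rewrite eq_ins inE ep orbT.
- apply/allP => e ep; have := memF e; rewrite mem_cat inE ep !orbT.
  by move/esym.
by exists F1, l.
Qed.

Lemma crossing_setU (S : {set {set M}}) (v : {set M}) (d : M) :
  downset S -> v \in vertices M -> v \notin S ->
  (forall d, d \in fwd M -> head d = v -> tail d \in S) ->
  crossing (v |: S) d = (d \in outs v) || crossing S d && (d \notin ins v).
Proof.
move=> dS vV vS predS; rewrite /crossing !inE mem_outs // mem_ins // negb_or.
case fd: (d \in fwd M) => //=.
case: (tail d =P v) => [td|ntd] /=; last first.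
  by case: (tail d \in S) => //=; rewrite andbC.
case: (head d =P v) => [hd|nhd] /=; first by have := edge_neq fd; rewrite td hd.
case hS: (head d \in S) => //=; have [_ _ _ closed] := dS.
by case/negP: vS; rewrite -td; apply: closed.
Qed.

Lemma frontier_step (S : {set {set M}}) (v : {set M}) (l1 l2 : seq M) :
  downset S -> frontier S (l1 ++ ins v ++ l2) -> v \in vertices M -> v \notin S -> v <> t ->
  (forall d, d \in fwd M -> head d = v -> tail d \in S) ->
  frontier (v |: S) (l1 ++ outs v ++ l2).
Proof.
move=> dS [uF memF chF] vV vS vt predS; have [sV sS tS closed] := dS.
have vs : v <> s by move=> vs; move: vS; rewrite vs sS.
have outsN d : d \in outs v -> ~~ crossing S d.
  by rewrite mem_outs // /crossing => /andP[_ /eqP->]; rewrite (negbTE vS) andbF.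
split.
- move: uF; rewrite uniq_catCA cat_uniq => /and3P[_ _ u12].
  rewrite uniq_catCA cat_uniq outs_uniq u12 andbT.
  apply/hasPn => d; rewrite mem_cat => d12; apply/negP => /outsN; rewrite -[crossing S d]memF.
  by rewrite !mem_cat; case/orP: d12 => ->; rewrite ?orbT.
- move=> d; rewrite [RHS](crossing_setU _ dS vV vS predS) -[crossing S d]memF !mem_cat.
  move: uF; rewrite uniq_catCA cat_uniq => /and3P[_ /hasPn disj _].
  case: (boolP (d \in outs v)) => dO; first by rewrite orbT.
  case: (boolP (d \in ins v)) => dI; last by rewrite andbT.
  rewrite andbF /=; apply/negP => d12.
  by have := disj d; rewrite mem_cat d12 => /(_ isT); rewrite dI.
have [a [b [chO chI _ nI]]] := fchains vV vs vt.
move: chF => /fchain_cat[c ch1 /fchain_cat[c' chI' ch2]].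
apply/fchain_cat; exists c => //; apply/fchain_cat; exists c' => //.
by have [<- <-] := fchain_inj nI chI chI'.
Qed.

(** * Detours and reachability between the poles *)

Lemma dwalk_mem (u v : {set M}) (p : seq M) (d : M) : dwalk u p v -> d \in p ->
  reach u (tail d) /\ reach (head d) v.
Proof.
elim: p u => //= e p IH u /and3P[fe /eqP <- wp]; rewrite inE => /predU1P[->|dp].
  by split; [exact: connect0 | exact: walk_reach wp].
have [r1 r2] := IH _ wp dp; split=> //; apply: reach_trans r1; exact: fwd_reach.
Qed.

Lemma dwalk_cat (u v w : {set M}) (p q : seq M) : dwalk u p v -> dwalk v q w -> dwalk u (p ++ q) w.
Proof. by elim: p u => [|d p IH] u /=; [move/eqP-> | case/and3P => -> -> /= /IH]. Qed.

(** The absence of transitive edges enters here: a walk from the tail of d through e to the head of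
    d avoids d by acyclicity. In particular there are no parallel edges. *)
Lemma no_detour (d e : M) : d \in fwd M -> e \in fwd M -> e <> d ->
  reach (tail d) (tail e) -> ~~ reach (head e) (head d).
Proof.
move=> fd fe ed r1; apply/negP => r2.
have [p wp] := reach_walk r1; have [q wq] := reach_walk r2.
apply: (@irredM d); split=> //; exists (p ++ e :: q); split.
  by apply: dwalk_cat wp _; rewrite /= fe eqxx.
rewrite mem_cat inE !negb_or; apply/and3P; split.
- apply/negP => dp; have [_ r3] := dwalk_mem wp dp.
  by case/negP: (edge_acyclic fe); apply: reach_trans r3.
- by apply/eqP => de; case: ed.
apply/negP => dq; have [r3 _] := dwalk_mem wq dq.
by case/negP: (edge_acyclic fe); apply: reach_trans r1.
Qed.

Lemma reach_last (u v : {set M}) : reach u v -> u = v \/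
  exists d, [/\ d \in fwd M, head d = v & reach u (tail d)].
Proof.
case/connectP => p; case/lastP: p => [|p w]; first by left.
rewrite rcons_path last_rcons => /andP[pp /existsP[d /and3P[fd /eqP td /eqP hd]]] ->.
by right; exists d; split=> //; apply/connectP; exists p.
Qed.

Lemma below_proper (d : M) : d \in fwd M ->
  #|[set u | reach u (tail d)]| < #|[set u | reach u (head d)]|.
Proof.
move=> fd; apply: proper_card; apply/properP; split.
  by apply/subsetP => u; rewrite !inE => ru; apply: reach_trans ru _; exact: fwd_reach.
by exists (head d); rewrite inE ?edge_acyclic //; exact: connect0.
Qed.

Lemma above_proper (d : M) : d \in fwd M ->
  #|[set u | reach (head d) u]| < #|[set u | reach (tail d) u]|.
Proof.
move=> fd; apply: proper_card; apply/properP; split.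
  by apply/subsetP => u; rewrite !inE; apply: reach_trans; exact: fwd_reach.
by exists (tail d); rewrite inE ?edge_acyclic //; exact: connect0.
Qed.

Lemma source_reach (v : {set M}) : v \in vertices M -> reach s v.
Proof.
have [m] := ubnP #|[set u | reach u v]|; elim: m v => // m IH v vm vV.
case: (v =P s) => [->|vs]; first exact: connect0.
have [d fd hd] := in_edge_ex vV vs; rewrite -hd.
apply: reach_trans (fwd_reach fd); apply: IH; last exact: tail_vertices.
by apply: leq_trans (below_proper fd) _; rewrite hd.
Qed.

Lemma reach_sink (v : {set M}) : v \in vertices M -> reach v t.
Proof.
have [m] := ubnP #|[set u | reach v u]|; elim: m v => // m IH v vm vV.
case: (v =P t) => [->|vt]; first exact: connect0.
have [d fd td] := out_edge_ex vV vt; rewrite -td.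
apply: reach_trans (fwd_reach fd) _; apply: IH; last exact: tail_vertices.
by apply: leq_trans (above_proper fd) _; rewrite td.
Qed.

(** * Sweeping all vertices but the sink *)

Definition pos (S : {set {set M}}) (d : M) : {set M} + M :=
  if head d \in S then inl (head d) else inr d.

(** The last two fields state that x agrees with the embedding at each vertex; they later turn an
    isomorphism of orders into one of maps. In [swept_outs] an edge stands for itself until its head
    is swept, and for its head afterwards. *)
Record swept (S : {set {set M}}) (F : seq M) (x y : {set M} + M -> nat) : Prop := Swept {
  swept_down : downset S;
  swept_frontier : frontier S F;
  swept_rank : sweep2 reach (@tail M) S F x y;
  swept_outs : forall u, u \in S -> pairwise (fun d e => x (pos S d) < x (pos S e)) (outs u);
  swept_ins : forall v, v \in S ->
    pairwise (fun d e => x (inl (tail d)) < x (inl (tail e))) (ins v) }.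

Lemma reach_refl : reflexive reach. Proof. exact: connect0. Qed.

Lemma outs_neq0 (v : {set M}) : v \in vertices M -> v <> t -> outs v != [::].
Proof.
move=> vV vt; have [d fd td] := out_edge_ex vV vt.
by apply/eqP => o0; have := mem_outs d vV; rewrite o0 fd td eqxx.
Qed.

Lemma ins_neq0 (v : {set M}) : v \in vertices M -> v <> s -> ins v != [::].
Proof.
move=> vV vs; have [d fd td] := in_edge_ex vV vs.
by apply/eqP => o0; have := mem_ins d vV; rewrite o0 fd td eqxx.
Qed.

Lemma swept_start : swept [set s] (outs s) (start_rank (outs s)) (start_rank (rev (outs s))).
Proof.
have tlO d : d \in outs s -> tail d = s by rewrite mem_outs ?source_vertex // => /andP[_ /eqP].
have headN d : d \in fwd M -> (head d \in [set s]) = false.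
  by move=> fd; rewrite in_set1; apply/eqP; exact: head_source.
split.
- split; rewrite ?sub1set ?source_vertex ?set11 //.
    by apply/set1P => /esym /source_neq_sink.
  by move=> d fd; rewrite headN.
- split; [exact: outs_uniq | move=> d | exact: fchain_source].
  rewrite mem_outs ?source_vertex // -[RHS]/(crossing [set s] d) /crossing in_set1.
  by case fd: (d \in fwd M) => //=; rewrite headN ?andbT.
- apply: sweep2_start; rewrite ?outs_uniq ?outs_neq0 ?source_vertex //; [exact: reach_refl|].
  exact: source_neq_sink.
- move=> u /set1P->; apply: pairwise_in (pairwise_index (outs_uniq s)) _ => d e.
  rewrite !mem_outs ?source_vertex // => /andP[fd _] /andP[fe _].
  by rewrite /pos !headN //= ltnS.
move=> v /set1P->; rewrite (_ : ins s = [::]) //.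
case eq_ins: (ins s) => [//|d p]; have := mem_ins d source_vertex.
rewrite eq_ins mem_head => /esym /andP[fd /eqP hd].
by case: (head_source fd hd).
Qed.

Section SweptStep.
Variables (S : {set {set M}}) (l1 l2 : seq M) (v : {set M}) (x y : {set M} + M -> nat).
Hypotheses (sw : swept S (l1 ++ ins v ++ l2) x y) (vV : v \in vertices M) (vS : v \notin S)
  (predS : forall d, d \in fwd M -> head d = v -> tail d \in S).

Lemma swept_crossing (e : M) : e \in l1 ++ ins v ++ l2 -> crossing S e.
Proof. by case: (swept_frontier sw) => _ memF _; rewrite memF. Qed.

(** Let d be to the left of e. If their tails were in the other order in x, then either the tail of
    e would be dominated by the tail of d, or the tail of d by the edge e. Each gives a path between
    the tails, hence a transitive edge into v. *)
Lemma swept_ins_new : pairwise (fun d e => x (inl (tail d)) < x (inl (tail e))) (ins v).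
Proof.
have sw2 := swept_rank sw; have sx := sweep2_x sw2; have sy := sweep2_y sw2.
have := pairwise_rev_sym (sweep_sorted sy); rewrite !pairwise_cat => /and3P[_ _ /and3P[_ py _]].
have := sweep_sorted sx; rewrite !pairwise_cat => /and3P[_ _ /and3P[_ px _]].
have {px py} : pairwise (fun d e => (x (inr d) < x (inr e)) && (y (inr e) < y (inr d))) (ins v).
  by rewrite pairwise_relI px.
move=> pxy; apply: pairwise_in pxy _ => d e dI eI /andP[xde yed].
have [dA eA] : active S (l1 ++ ins v ++ l2) (inr d) /\ active S (l1 ++ ins v ++ l2) (inr e).
  by rewrite /= !mem_cat dI eI !orbT.
have [/and3P[fd tdS _] /and3P[fe teS _]] := (swept_crossing dA, swept_crossing eA).
have [hd he] : head d = v /\ head e = v.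
  by move: dI eI; rewrite !mem_ins // => /andP[_ /eqP->] /andP[_ /eqP->].
have ned : e <> d by move=> ed; rewrite ed ltnn in xde.
have nde : d <> e by move=> ed; rewrite ed ltnn in xde.
have self f : active S (l1 ++ ins v ++ l2) (inr f) -> tail f \in S ->
    x (inl (tail f)) <= x (inr f) /\ y (inl (tail f)) <= y (inr f).
  move=> fA tfS; split; first by apply: (sweep_reach sx) => //; exact: connect0.
  by apply: (sweep_reach sy) => //; rewrite ?active_rev //; exact: connect0.
have [[xd yd] [xe ye]] := (self d dA tdS, self e eA teS).
rewrite ltnNge; apply/negP => xed.
case: (leqP (y (inl (tail e))) (y (inl (tail d)))) => yed'.
  have r := sweep2_dom sw2 (p := inl (tail d)) teS tdS xed yed'.
  by have := no_detour fe fd nde r; rewrite hd he reach_refl.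
have r := sweep2_dom sw2 (p := inr e) tdS eA (ltnW (leq_ltn_trans xd xde)) (ltnW (leq_trans yed' ye)).
by have := no_detour fd fe ned r; rewrite hd he reach_refl.
Qed.

Hypothesis vt : v <> t.

Lemma swept_step : exists F x' y', swept (v |: S) F x' y'.
Proof.
have dS := swept_down sw; have [sV sS tS closed] := dS.
have vs : v <> s by move=> vs; move: vS; rewrite vs sS.
have sw2 := swept_rank sw; have sx := sweep2_x sw2; have sy := sweep2_y sw2.
have [el elB el_max] := seq_argmax (x \o inr) (ins_neq0 vV vs).
have [ef efB ef_max] := seq_argmax (y \o inr) (ins_neq0 vV vs).
have tlS e : e \in l1 ++ ins v ++ l2 -> tail e \in S by move=> /swept_crossing/and3P[].
have tlO d : d \in outs v -> tail d = v by rewrite mem_outs // => /andP[_ /eqP].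
have reach_v u : u \in S -> reach u v -> exists2 e, e \in ins v & reach u (tail e).
  move=> uS /reach_last[uv|[d [fd hd rd]]]; first by move: vS; rewrite -uv uS.
  by exists d => //; rewrite mem_ins // fd hd eqxx.
have B_reach e : e \in ins v -> reach (tail e) v.
  by rewrite mem_ins // => /andP[fe /eqP <-]; exact: fwd_reach.
have v_max u : u \in S -> ~~ reach v u.
  by move=> uS; apply/negP => /(downset_reach dS)/(_ uS); exact/negP.
exists (l1 ++ outs v ++ l2), (update v (outs v) el x), (update v (rev (outs v)) ef y).
split.
- split; rewrite ?in_setU1 ?sS ?orbT //.
  + by apply/subsetP => w /setU1P[->//|]; exact: (subsetP sV).
  + by rewrite (negbTE tS) orbF; apply/eqP => tv; case: vt.
  + move=> d fd /setU1P[/(predS fd) h|/(closed _ fd) h]; by rewrite in_setU1 h orbT.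
- exact: frontier_step (swept_frontier sw) vV vS vt predS.
- exact: (sweep2_step reach_refl reach_trans vS tlS tlO (outs_uniq v) (outs_neq0 vV vt)
    reach_v B_reach v_max sw2 elB efB el_max ef_max).
- move=> u /setU1P uS.
  have posO d : d \in outs v -> pos (v |: S) d = inr d.
    rewrite mem_outs // => /andP[fd /eqP td]; rewrite /pos in_setU1.
    have /negbTE-> : head d != v by apply/eqP => hd; case: (edge_neq fd); rewrite td hd.
    by case hS: (head d \in S) => //; move: vS; rewrite -td (closed d fd).
  case: (u =P v) => [->|nuv].
    apply: pairwise_in (pairwise_index (outs_uniq v)) _ => d e dO eO lt_de.
    by rewrite !posO // update_lt /= dO eO eqxx !ltnS lt_de orbT.
  have {}uS : u \in S by case: uS.
  have uV : u \in vertices M by exact: (subsetP sV).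
  have posI d : d \in outs u -> head d = v -> [/\ pos S d = inr d, d \in ins v &
      update v (outs v) el x (pos (v |: S) d) = update v (outs v) el x (inl v)].
    rewrite mem_outs // => /andP[fd _] hd.
    by rewrite /pos in_setU1 hd eqxx (negbTE vS) mem_ins // fd hd eqxx.
  have posN d : d \in outs u -> head d <> v -> pos (v |: S) d = pos S d /\
      forall a, parent v (outs v) a (pos S d) = pos S d.
    rewrite mem_outs // => /andP[fd /eqP td] /eqP hd.
    rewrite /pos in_setU1 (negbTE hd) /=; split=> // a.
    case: ifP => hS /=; first by rewrite (negbTE hd).
    by rewrite mem_outs // td fd /=; case: eqP.
  apply: pairwise_in (swept_outs sw uS) _ => d e dO eO lt_de.
  have [/andP[fd /eqP td] /andP[fe /eqP te]] : (d \in fwd M) && (tail d == u) /\ (e \in fwd M) && (tail e == u).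
    by move: dO eO; rewrite !mem_outs.
  have ned : e <> d by move=> ed; rewrite ed ltnn in lt_de.
  case: (head d =P v) => hd; case: (head e =P v) => he.
  + have := no_detour fd fe ned; rewrite td te hd he => /(_ (reach_refl _)).
    by rewrite reach_refl.
  + have [pd dI ->] := posI d dO hd; have [-> pe] := posN e eO he.
    rewrite update_lt pe /= eqxx; apply/orP; left; rewrite pd in lt_de.
    case: (boolP (head e \in S)) => heS; move: lt_de; rewrite /pos ?heS ?(negbTE heS) => lt_de.
      (* If the head of e came before [el], its next frontier edge would lie in the block; that head
         would reach v, and d would be transitive. *)
      rewrite ltnNge; apply/negP => le_e.
      have [f [fF rf lt_f nx]] := sweep_next sx heS.
      have fI : f \in ins v.
        move: (fF); rewrite !mem_cat => /or3P[f1|//|f2].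
          by have := ltn_trans lt_de lt_f; rewrite ltnNge ltnW // (step_left sx).
        have := nx el; rewrite (step_right sx) // !mem_cat elB orbT.
        by move=> /(_ isT isT); rewrite ltnNge le_e.
      have := no_detour fd fe ned; rewrite td te => /(_ (reach_refl _)) /negP; apply.
      by apply: reach_trans rf _; rewrite hd; exact: B_reach.
    have eF : e \in l1 ++ ins v ++ l2.
      have [_ memF _] := swept_frontier sw.
      by rewrite memF -[e \in _]/(crossing S e) /crossing fe te uS heS.
    move: eF; rewrite !mem_cat => /or3P[e1|eI|e2].
    * by move: lt_de; rewrite ltnNge ltnW // (step_left sx).
    * by move: eI; rewrite mem_ins // => /andP[_ /eqP]; case/he.
    * exact: (step_right sx).
  + have [-> pd] := posN d dO hd; have [pe eI ->] := posI e eO he.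
    rewrite pe in lt_de; rewrite update_lt pd /= eqxx.
    by rewrite (leq_trans lt_de) // el_max.
  have [-> pd] := posN d dO hd; have [-> pe] := posN e eO he.
  by rewrite update_lt pd pe lt_de.
move=> w /setU1P wS.
have old z : z \in S -> parent v (outs v) el (inl z : {set M} + M) = inl z.
  by move=> zS /=; case: eqP => // zv; move: vS; rewrite -zv zS.
have predP d : d \in ins w -> tail d \in S.
  case: wS => [->|wS]; first by rewrite mem_ins // => /andP[fd /eqP]; exact: predS.
  by rewrite mem_ins ?(subsetP sV) // => /andP[fd /eqP hd]; apply: closed; rewrite ?hd.
have : pairwise (fun d e => x (inl (tail d)) < x (inl (tail e))) (ins w).
  by case: wS => [->|/(swept_ins sw)//]; exact: swept_ins_new.
move=> pw; apply: pairwise_in pw _ => d e /predP dS' /predP eS' lt_de.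
by rewrite update_lt !old // lt_de.
Qed.

End SweptStep.

Lemma addable_ex (S : {set {set M}}) : downset S -> S != vertices M :\ t ->
  exists v, [/\ v \in vertices M, v \notin S, v <> t &
    forall d, d \in fwd M -> head d = v -> tail d \in S].
Proof.
case=> sV sS tS _ neqS.
have /set0Pn[v0] : (vertices M :\ t) :\: S != set0.
  apply: contraNneq neqS => /eqP; rewrite setD_eq0 => subS; rewrite eqEsubset subS andbT.
  by apply/subsetP => u uS; rewrite !inE (subsetP sV) // andbT; apply: contraNneq tS => <-.
move=> v0U; pose below v := #|[set u | reach u v]|.
case: (arg_minnP (P := [in (vertices M :\ t) :\: S]) below v0U) => v.
rewrite /= !inE => /and3P[vS vt vV] v_min; exists v; split=> // [|d fd hd]; first exact/eqP.
apply: contraT => tdS; have := v_min (tail d); rewrite !inE tdS tail_vertices andbT.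
have -> : tail d != t by apply/eqP; exact: tail_sink.
by move=> /(_ isT); rewrite leqNgt /below -hd below_proper.
Qed.

(** The sweep stops before the sink, since a step inserts a nonempty list of outgoing edges. *)
Lemma swept_all : exists F x y, swept (vertices M :\ t) F x y.
Proof.
have : exists F x y, swept [set s] F x y by do 3!eexists; exact: swept_start.
move eqn : (#|(vertices M :\ t) :\: [set s]|) => n.
elim: n [set s] eqn => [|n IH] S cardS [F [x [y sw]]]; have dS := swept_down sw.
  have [sV sS tS _] := dS; case: (S =P vertices M :\ t) => [<-|/eqP neqS].
    by exists F, x, y.
  have [v [vV vS /eqP vt _]] := addable_ex dS neqS.
  by have := cards0_eq cardS; move/setP/(_ v); rewrite !inE vV vt vS.
have neqS : S != vertices M :\ t by apply/eqP => eqS; move: cardS; rewrite eqS setDv cards0.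
have [v [vV vS vt predS]] := addable_ex dS neqS.
have [l1 [l2 eqF]] := frontier_block dS (swept_frontier sw) vV vS predS; rewrite eqF in sw.
apply: (IH (v |: S)); last exact: swept_step sw vV vS predS vt.
have vU : v \in (vertices M :\ t) :\: S by rewrite !inE vV vS andbT; exact/eqP.
have -> : (vertices M :\ t) :\: (v |: S) = ((vertices M :\ t) :\: S) :\ v.
  by apply/setP => u; rewrite !inE negb_or -!andbA.
by move: cardS; rewrite (cardsD1 v) vU => -[].
Qed.

Definition coordinates (x y : {set M} -> nat) : Prop :=
  [/\ {in vertices M &, injective x}, {in vertices M &, injective y},
      {in vertices M &, forall u v, reach u v = (x u <= x v) && (y u <= y v)},
      forall v, v \in vertices M -> pairwise (fun d e => x (head d) < x (head e)) (outs v) /\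
                pairwise (fun d e => x (tail d) < x (tail e)) (ins v)
    & forall u z v w, u \in vertices M -> z \in vertices M -> v \in vertices M -> w \in vertices M ->
        reach u v -> reach u w -> reach z v -> reach z w ->
        exists m, [/\ m \in vertices M, reach u m, reach z m, reach m v & reach m w]].

Lemma coordinates_ex : exists x y, coordinates x y.
Proof.
have [F [x0 [y0 sw]]] := swept_all; set S := _ :\ t in sw.
have dS := swept_down sw; have [sV sS tS closed] := dS.
have sw2 := swept_rank sw; have sx := sweep2_x sw2; have sy := sweep2_y sw2.
have [_ memF _] := swept_frontier sw.
have inS v : v \in vertices M -> v <> t -> v \in S by move=> vV /eqP vt; rewrite !inE vt.
have t_reach v : v \in S -> ~~ reach t v.
  by move=> vS; apply/negP => /(downset_reach dS)/(_ vS); exact/negP.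
(* The sink, not being swept, is put beyond all other vertices in both rankings. *)
pose ext (f : {set M} + M -> nat) v := if v == t then (\max_(u : {set M}) f (inl u)).+1 else f (inl v).
have ext_lt f v : v <> t -> ext f v < ext f t.
  by rewrite /ext eqxx => /eqP/negbTE->; rewrite ltnS; exact: (leq_bigmax (F := fun u => f (inl u))).
have ext_inj f : {in S &, forall u v, f (inl u) = f (inl v) -> u = v} ->
    {in vertices M &, injective (ext f)}.
  move=> fI u v uV vV; case: (u =P t) => [->|ut]; case: (v =P t) => [->|vt] // eqf.
  - by have := ext_lt f _ vt; rewrite eqf ltnn.
  - by have := ext_lt f _ ut; rewrite eqf ltnn.
  by apply: fI; rewrite ?inS //; move: eqf; rewrite /ext; do 2!case: eqP => //.
have extE f v : v \in S -> ext f v = f (inl v).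
  by rewrite /ext; case: eqP => // -> ; rewrite (negbTE tS).
exists (ext x0), (ext y0); split.
- by apply: ext_inj => u v uS vS /(sweep_inj sx uS (p := inl v) vS) [].
- by apply: ext_inj => u v uS vS /(sweep_inj sy uS (p := inl v) vS) [].
- move=> u v uV vV; case: (v =P t) => [->|vt].
    rewrite reach_sink //; case: (u =P t) => [->|ut]; first by rewrite !leqnn.
    by rewrite !(ltnW (ext_lt _ _ ut)).
  have vS := inS v vV vt; case: (u =P t) => [->|ut].
    by rewrite (negbTE (t_reach _ vS)) leqNgt ext_lt.
  have uS := inS u uV ut; rewrite !extE //; apply/idP/andP => [r|[xu yu]].
    by split; [exact: (sweep_reach sx uS (p := inl v) vS)|exact: (sweep_reach sy uS (p := inl v) vS)].
  exact: (sweep2_dom sw2 uS (p := inl v) vS).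
- move=> v vV; split.
    case: (v =P t) => [->|vt].
      case eq_o : (outs t) => [//|d p]; have := mem_outs d sink_vertex.
      by rewrite eq_o mem_head => /esym /andP[fd /eqP /(tail_sink fd)].
    have vS := inS v vV vt; have pw := swept_outs sw vS.
    apply: pairwise_in pw _ => d e dO eO lt_de.
    have [/andP[fd /eqP td] /andP[fe /eqP te]] : (d \in fwd M) && (tail d == v) /\ (e \in fwd M) && (tail e == v).
      by move: dO eO; rewrite !mem_outs.
    have ned : e <> d by move=> ed; rewrite ed ltnn in lt_de.
    have nde : d <> e by move=> ed; rewrite ed ltnn in lt_de.
    (* If v has another outgoing edge, an edge from v to the sink would be transitive, because every
       vertex reaches the sink. *)
    have hd : head d <> t.
      move=> hd; have := no_detour fd fe ned.
      by rewrite td te hd reach_sink ?tail_vertices ?reach_refl // => /(_ isT).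
    have he : head e <> t.
      move=> he; have := no_detour fe fd nde.
      by rewrite td te he reach_sink ?tail_vertices ?reach_refl // => /(_ isT).
    move: lt_de; rewrite /pos !(inS _ (tail_vertices _)) // !extE //; exact: inS (tail_vertices _) _.
  have tail_S d : d \in fwd M -> tail d \in S by move=> fd; apply: inS (tail_vertices _) (tail_sink fd).
  have : pairwise (fun d e => x0 (inl (tail d)) < x0 (inl (tail e))) (ins v).
    case: (v =P t) => [->|vt]; last exact: (swept_ins sw) (inS v vV vt).
    (* The edges into the sink form a block of the final frontier, to which [swept_ins_new] applies
       although the sink itself is not swept. *)
    have predS d : d \in fwd M -> head d = t -> tail d \in S by move=> fd _; exact: tail_S.
    have [l1 [l2 eqF]] := frontier_block dS (swept_frontier sw) sink_vertex tS predS.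
    rewrite eqF in sw; exact: (swept_ins_new sw sink_vertex).
  move=> pw; apply: pairwise_in pw _ => d e.
  by rewrite !mem_ins // => /andP[fd _] /andP[fe _]; rewrite !extE ?tail_S.
move=> u z v w uV zV vV wV uv uw zv zw.
case: (v =P t) => [->|vt]; first by exists w; split=> //; [exact: reach_sink|exact: reach_refl].
case: (w =P t) => [->|wt]; first by exists v; split=> //; [exact: reach_refl|exact: reach_sink].
have [vS wS] := (inS v vV vt, inS w wV wt).
have below a : a \in vertices M -> reach a v -> a \in S.
  by move=> aV av; apply: inS => // at_; move: av; rewrite at_ (negbTE (t_reach _ vS)).
have [m [mS *]] := sweep2_lat sw2 (below u uV uv) (below z zV zv)
  (p := inl v) (q := inl w) vS wS uv uw zv zw.
by exists m; split=> //; exact: (subsetP sV).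
Qed.

End Poset.

(** * Interpolating dominance orders *)

(* Boolean hypotheses that are not comparisons slow lia down considerably. *)
Ltac nat_lia :=
  intros;
  repeat match goal with
  | H : ?T |- _ =>
    lazymatch T with
    | is_true (leq _ _) => fail
    | is_true (~~ leq _ _) => fail
    | @eq nat _ _ => fail
    | False => fail
    | _ => clear H
    end
  end; lia.

Section Cover.
Variables (V : finType) (le : rel V).

Definition cov (u v : V) : bool :=
  [&& u != v, le u v & [forall w, le u w && le w v ==> (w == u) || (w == v)]].

Lemma covP (u v : V) : cov u v ->
  [/\ u <> v, le u v & forall w, le u w -> le w v -> w = u \/ w = v].
Proof.
case/and3P => /eqP uv luv /forallP h; split=> // w uw wv.
by have := h w; rewrite uw wv => /orP[]/eqP; [left|right].
Qed.

Lemma cov_le (u v : V) : cov u v -> le u v. Proof. by case/covP. Qed.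

End Cover.

(* The right boundary of the interval [v, j]: its elements with no element of
   the interval on their lower right; exchanging x and y gives the left one. *)
Definition chain (V : finType) (le : rel V) (x y : V -> nat) (v j c : V) : Prop :=
  [/\ le v c, le c j & forall z, le v z -> le z j -> y z < y c -> x z <= x c].

Section Plane.
Variables (V : finType) (le : rel V) (x y : V -> nat).
Hypotheses (leE : forall u v, le u v = (x u <= x v) && (y u <= y v))
  (x_inj : injective x) (y_inj : injective y)
  (lat : forall u z v w, le u v -> le u w -> le z v -> le z w ->
    exists m, [/\ le u m, le z m, le m v & le m w]).
Local Notation cov := (cov le).

Lemma le_refl (u : V) : le u u. Proof. by rewrite leE !leqnn. Qed.

Lemma le_trans : transitive le.
Proof. by move=> v u w; rewrite !leE => /andP[a b] /andP[c d]; rewrite (leq_trans a) ?(leq_trans b). Qed.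

Lemma le_anti (u v : V) : le u v -> le v u -> u = v.
Proof. by rewrite !leE => /andP[a _] /andP[b _]; apply: x_inj; apply/eqP; rewrite eqn_leq a. Qed.

Lemma cov_lt (u v : V) : cov u v -> x u < x v /\ y u < y v.
Proof.
case/covP => uv; rewrite leE => /andP[a b] _; rewrite !ltn_neqAle a b !andbT.
by split; apply/eqP; [move/x_inj|move/y_inj].
Qed.

Lemma cov_asym (u v : V) : cov u v -> ~~ cov v u.
Proof. by case/cov_lt => xuv _; apply/negP => /cov_lt[xvu _]; nat_lia. Qed.

Lemma cov_above (u v : V) : le u v -> u <> v -> exists2 k, cov u k & le k v.
Proof.
move=> uv /eqP nuv.
case: (@arg_minnP V v (fun k => [&& le u k, le k v & u != k]) x); first by rewrite uv le_refl nuv.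
move=> k /and3P[uk kv nuk] k_min; exists k => //; rewrite /cov nuk uk /=.
apply/forallP => w; apply/implyP => /andP[uw wk]; case: (eqVneq w u) => //= nwu.
have /k_min : [&& le u w, le w v & u != w] by rewrite uw (le_trans wk) // eq_sym.
by move: wk; rewrite leE => /andP[a _] b; apply/eqP/x_inj/eqP; rewrite eqn_leq a.
Qed.

Lemma cov_below (u v : V) : le u v -> u <> v -> exists2 k, cov k v & le u k.
Proof.
move=> uv /eqP nuv.
case: (@arg_maxnP V u (fun k => [&& le u k, le k v & k != v]) x); first by rewrite uv le_refl nuv.
move=> k /and3P[uk kv nkv] k_max; exists k => //; rewrite /cov nkv kv /=.
apply/forallP => w; apply/implyP => /andP[kw wv]; case: (eqVneq w v) => //= nwv; first by rewrite orbT.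
have /k_max : [&& le u w, le w v & w != v] by rewrite wv nwv (le_trans uk).
by move: kw; rewrite orbF leE => /andP[a _] b; apply/eqP/x_inj/eqP; rewrite eqn_leq a andbT.
Qed.

Lemma cov_up_anti (u v w : V) : cov u v -> cov u w -> x v < x w -> y w < y v.
Proof.
move=> /covP[uv luv _] /covP[_ _ h] xvw; rewrite ltnNge; apply/negP => yvw.
case: (h v luv) => [|vu|vw]; first by rewrite leE yvw ltnW.
  by case: uv.
by rewrite vw ltnn in xvw.
Qed.

Lemma cov_down_anti (u v w : V) : cov v u -> cov w u -> x v < x w -> y w < y v.
Proof.
move=> /covP[_ _ h] /covP[wu lwu _] xvw; rewrite ltnNge; apply/negP => yvw.
case: (h w) => [||vu|//]; [by rewrite leE yvw ltnW|done|].
by rewrite vu ltnn in xvw.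
Qed.

(** Take the common upper bound smallest in x. Interpolating between it and another bound z gives a
    common bound below both, which minimality identifies with j. *)
Lemma join_ex (v w t : V) : le v t -> le w t ->
  exists j, [/\ le v j, le w j & forall z, le v z -> le w z -> le j z].
Proof.
move=> vt wt; case: (@arg_minnP V t (fun z => le v z && le w z) x); first by rewrite vt.
move=> j /andP[vj wj] j_min; exists j; split=> // z vz wz.
have [m [vm wm mj mz]] := lat vj vz wj wz.
suff <- : m = j by [].
apply: x_inj; apply/eqP; rewrite eqn_leq; move: (mj); rewrite leE => /andP[-> _].
by apply: j_min; rewrite vm.
Qed.

(* The bottom corner of a face: u, its consecutive covers v and w, and the
   join j of v and w, which is the top of that face. *)
Definition corner (u v w j : V) : Prop :=
  [/\ cov u v, cov u w, x v < x w, forall k, cov u k -> x v < x k -> x w <= x k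
    & [/\ le v j, le w j & forall z, le v z -> le w z -> le j z]].

Lemma chain_bottom (v j : V) : le v j -> chain le x y v j v.
Proof. by move=> vj; split; rewrite ?le_refl // => z; rewrite leE => /andP[_ a] _; nat_lia. Qed.

Lemma chain_top (v j : V) : le v j -> chain le x y v j j.
Proof. by move=> vj; split; rewrite ?le_refl // => z _; rewrite leE => /andP[]. Qed.

Variables (u v w j : V).
Hypothesis cnr : corner u v w j.

Let cuv : cov u v. Proof. by case: cnr. Qed.
Let cuw : cov u w. Proof. by case: cnr. Qed.
Let xvw : x v < x w. Proof. by case: cnr. Qed.
Let ywv : y w < y v. Proof. exact: cov_up_anti cuv cuw xvw. Qed.
Let vj : le v j. Proof. by case: cnr => _ _ _ _ []. Qed.
Let wj : le w j. Proof. by case: cnr => _ _ _ _ []. Qed.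
Let joinj (z : V) : le v z -> le w z -> le j z. Proof. by case: cnr => _ _ _ _ [_ _]; exact. Qed.

Lemma le_x (a b : V) : le a b -> x a <= x b. Proof. by rewrite leE => /andP[]. Qed.
Lemma le_y (a b : V) : le a b -> y a <= y b. Proof. by rewrite leE => /andP[]. Qed.
Lemma le_xy (a b : V) : x a <= x b -> y a <= y b -> le a b. Proof. by rewrite leE => -> ->. Qed.

Lemma corner_neq : v <> j /\ w <> j.
Proof.
split=> e; [have := le_x wj | have := le_y vj]; rewrite -e; nat_lia.
Qed.

(** Otherwise z is above u, and a cover of u below z would fall strictly between the consecutive
    covers v and w. *)
Lemma gap (z : V) : x v < x z -> x z < x w -> y z < y v -> y z < y u.
Proof.
move=> xvz xzw yzv; rewrite ltnNge; apply/negP => yuz.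
have [xuv yuv] := cov_lt cuv; have [xuw yuw] := cov_lt cuw.
have nuz : u <> z by move=> e; move: xvz; rewrite -e; nat_lia.
have [|k cuk kz] := cov_above _ nuz; first by apply: le_xy; nat_lia.
have [xkz ykz] := (le_x kz, le_y kz).
have xvk : x v < x k.
  rewrite ltnNge leq_eqVlt; apply/negP => /orP[/eqP/x_inj e|xkv].
    by move: ykz; rewrite e; nat_lia.
  by have := cov_up_anti cuk cuv xkv; nat_lia.
by case: cnr => _ _ _ /(_ k cuk xvk) + _; nat_lia.
Qed.

(** No such z exists: an element between u, z and w, c is u or w since w covers u, but z is not
    below u and w is not below c. *)
Lemma pocket (z c : V) : x u < x z -> le z w -> le z c -> le u c -> ~~ le w c -> y u <= y z.
Proof.
move=> xuz zw zc uc nwc; case: (lat (cov_le cuw) uc zw zc) => m [um zm mw mc].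
have [_ _ /(_ m um mw)[mu|mw']] := covP cuw.
  by have := le_x zm; rewrite mu; nat_lia.
by move: nwc; rewrite -mw' mc.
Qed.

(** An element covered by v to the right of u would be lower than u in y and below both v and w,
    which [pocket] forbids. *)
Lemma corner_rightmost_in (z : V) : cov z v -> x z <= x u.
Proof.
move=> czv; rewrite leqNgt; apply/negP => xuz; have := cov_down_anti cuv czv xuz.
have [xzv yzv] := cov_lt czv; have [xuw yuw] := cov_lt cuw => yzu.
suff : y u <= y z by nat_lia.
apply: (pocket (c := v)) => //; [by apply: le_xy; nat_lia|exact: cov_le|exact: cov_le|].
by apply/negP => /le_x; nat_lia.
Qed.

(** The right boundary climbs through rightmost covers. If c' were not below j, then j would be to
    the left of c', and c' would be an upper bound of v and w that is not above j. *)
Lemma chain_up (c c' : V) : chain le x y v j c -> c <> j -> cov c c' ->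
  (forall k, cov c k -> x k <= x c') -> chain le x y v j c'.
Proof.
case=> vc cj ext ncj ccc' c'_max; have [k ck kj] := cov_above cj ncj.
have [xcc' ycc'] := cov_lt ccc'.
have [xvc yvc] := (le_x vc, le_y vc).
have vc' : le v c' by apply: le_trans vc (cov_le ccc').
have c'j : le c' j.
  apply: contraT => nc'j; have xkc' : x k < x c'.
    rewrite ltn_neqAle c'_max // andbT; apply/eqP => /x_inj e; move: nc'j.
    by rewrite -e kj.
  have ykc' := cov_up_anti ck ccc' xkc'; have ykj := le_y kj.
  have xjc' : x j < x c'.
    by rewrite ltnNge; apply/negP => h; move: nc'j; rewrite leE h /=; nat_lia.
  have wc' : le w c' by apply: le_xy; have := le_x wj; nat_lia.
  by have := le_y (joinj vc' wc'); nat_lia.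
split=> // z vz zj yzc'; rewrite leqNgt; apply/negP => xc'z.
case: (ltngtP (y z) (y c)) => [yzc|ycz|/y_inj e].
- by have := ext z vz zj yzc; nat_lia.
- have ncz : c <> z by move=> e; rewrite e ltnn in ycz.
  have [|q cq qz] := cov_above _ ncz; first by apply: le_xy; nat_lia.
  have := c'_max q cq; rewrite leq_eqVlt => /orP[/eqP/x_inj e|xqc'].
    by have := le_y qz; rewrite e; nat_lia.
  by have := cov_up_anti cq ccc' xqc'; have := le_y qz; nat_lia.
by move: xc'z; rewrite e; nat_lia.
Qed.

Lemma chain_not_w (c : V) : chain le x y v j c -> c <> j -> ~~ le w c.
Proof. by case=> vc cj _ ncj; apply/negP => wc; case: ncj; apply: le_anti (joinj vc wc). Qed.

(** The boundary descends through the rightmost elements covered. A step out of the interval would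
    land lower than v in y, between v and w in x; [gap] puts such a point lower than u, and [pocket]
    excludes it. *)
Lemma chain_down (c c' : V) : chain le x y v j c -> c <> v -> c <> j -> cov c' c ->
  (forall k, cov k c -> x k <= x c') -> chain le x y v j c'.
Proof.
move=> chc ncv ncj cc'c c'_max; have nwc := chain_not_w chc ncj; case: chc => vc cj ext.
have [k kc vk] := cov_below vc (not_eq_sym ncv).
have [xc'c yc'c] := cov_lt cc'c; have [xvc yvc] := (le_x vc, le_y vc).
have xcw : x c < x w by rewrite ltnNge; apply/negP => h; move: nwc; rewrite leE h /=; nat_lia.
have xkc' := c'_max k kc; have xvk := le_x vk; have yvk := le_y vk.
have [xuv yuv] := cov_lt cuv; have [xuw yuw] := cov_lt cuw.
have vc' : le v c'.
  apply: le_xy; first nat_lia.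
  rewrite leqNgt; apply/negP => yc'v.
  have xvc' : x v < x c'.
    by rewrite ltn_neqAle (leq_trans xvk) // andbT; apply/eqP => /x_inj e; move: yc'v; rewrite e ltnn.
  have yc'u : y c' < y u by apply: gap => //; nat_lia.
  suff : y u <= y c' by nat_lia.
  apply: (pocket (c := c)) => //; [nat_lia | by apply: le_xy; nat_lia | exact: cov_le |].
  exact: le_trans (cov_le cuv) vc.
split=> //; first exact: le_trans (cov_le cc'c) cj.
move=> q vq qj yqc'; rewrite leqNgt; apply/negP => xc'q.
case: (ltngtP (x q) (x c)) => [xqc|xcq|/x_inj e].
- have nqc : q <> c by move=> e; rewrite e ltnn in xqc.
  have [|q' q'c qq'] := cov_below _ nqc; first by apply: le_xy; nat_lia.
  by have := c'_max q' q'c; have := le_x qq'; nat_lia.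
- by have := ext q vq qj (ltn_trans yqc' yc'c); nat_lia.
by move: yqc'; rewrite e; nat_lia.
Qed.

(** Converse of [chain_up]: the rightmost cover of c lies in the interval, and the boundary property
    of c' keeps it from being farther right. *)
Lemma chain_rightmost (c c' : V) : chain le x y v j c -> chain le x y v j c' -> cov c c' ->
  forall k, cov c k -> x k <= x c'.
Proof.
move=> chc [vc' c'j ext] ccc'; have ncj : c <> j.
  by move=> e; have [] := cov_lt ccc'; have := le_x c'j; rewrite e; nat_lia.
case: (@arg_maxnP V c' (cov c) x ccc') => k ck k_max.
have [vk kj _] := chain_up chc ncj ck k_max.
have xkc' : x k <= x c'.
  rewrite leqNgt; apply/negP => xc'k.
  by have := ext k vk kj (cov_up_anti ccc' ck xc'k); nat_lia.
by move=> z cz; apply: leq_trans xkc'; exact: k_max.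
Qed.

(** An element p covered by j, above v and not to the left of c, would also be above w, so the join
    j would be below p. *)
Lemma top_left_in (c : V) : chain le y x w j c -> cov c j -> exists2 p, cov p j & le v p /\ x p < x c.
Proof.
case=> wc cj ext cov_cj; have [nvj nwj] := corner_neq.
have [p pj vp] := cov_below vj nvj; exists p => //; split=> //.
have [[xpj ypj] [xcj ycj]] := (cov_lt pj, cov_lt cov_cj).
rewrite ltnNge leq_eqVlt; apply/negP => /orP[/eqP/x_inj e|xcp].
  by have := le_x (joinj _ wc); rewrite e => /(_ vp); nat_lia.
have wp : le w p by apply: le_xy; have := le_x wc; have := le_y vp; nat_lia.
by have := le_x (joinj vp wp); nat_lia.
Qed.

(** At the top, the face turns from c to the next element z on the left covered by j; this shows
    that z is on the other side of the same face. *)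
Lemma top_chain (c z : V) : chain le y x w j c -> cov c j -> cov z j -> x z < x c ->
  (forall k, cov k j -> x k < x c -> x k <= x z) -> chain le x y v j z.
Proof.
move=> rc cov_cj zj xzc z_max; have [p pj [vp xpc]] := top_left_in rc cov_cj.
case: rc => wc cj ext; have xpz := z_max p pj xpc.
have [[xzj yzj] [xcj ycj]] := (cov_lt zj, cov_lt cov_cj).
have ycz := cov_down_anti zj cov_cj xzc; have [xwc ywc] := (le_x wc, le_y wc).
have [xvp yvp] := (le_x vp, le_y vp); have [xuw yuw] := cov_lt cuw.
have vz : le v z.
  apply: le_xy; first nat_lia.
  rewrite leqNgt; apply/negP => yzv.
  have xvz : x v < x z.
    by rewrite ltn_neqAle (leq_trans xvp) // andbT; apply/eqP => /x_inj e; move: yzv; rewrite e ltnn.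
  case: (ltnP (x z) (x w)) => xzw; first by have := gap xvz xzw yzv; nat_lia.
  have wz : le w z by apply: le_xy; nat_lia.
  by have := ext z wz (cov_le zj) xzc; nat_lia.
split=> //; first exact: cov_le.
move=> q vq qj yqz; rewrite leqNgt; apply/negP => xzq.
have nqj : q <> j by move=> e; move: yqz; rewrite e; nat_lia.
have [q' q'j qq'] := cov_below qj nqj.
have [xqq' yqq'] := (le_x qq', le_y qq').
have xcq' : x c <= x q'.
  by rewrite leqNgt; apply/negP => xq'c; have := z_max q' q'j xq'c; nat_lia.
have yq'c : y q' <= y c.
  move: xcq'; rewrite leq_eqVlt => /orP[/eqP/x_inj->//|xcq']; apply: ltnW.
  exact: cov_down_anti cov_cj q'j xcq'.
have vc : le v c by apply: le_xy; have := le_y vq; nat_lia.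
by have := le_x (joinj vc wc); nat_lia.
Qed.

End Plane.

Section Mirror.
Variables (V : finType) (le : rel V) (x y : V -> nat).
Hypotheses (leE : forall u v, le u v = (x u <= x v) && (y u <= y v))
  (x_inj : injective x).

(** The covers of u form an antichain, so y lists them in the opposite order to x. This gives the
    boundary lemmas for the other side of the face. *)
Lemma corner_sym (u v w j : V) : corner le x u v w j -> corner le y u w v j.
Proof.
case=> cuv cuw xvw next_vw [vj wj joinj]; have anti := cov_up_anti leE.
split=> //.
- exact: anti cuv cuw xvw.
- move=> k cuk ywk; rewrite leqNgt; apply/negP => ykv.
  have xvk : x v < x k.
    rewrite ltnNge leq_eqVlt; apply/negP => /orP[/eqP/x_inj e|xkv].
      by move: ykv; rewrite e; nat_lia.
    by have := anti _ _ _ cuk cuv xkv; nat_lia.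
  have := next_vw k cuk xvk; rewrite leq_eqVlt => /orP[/eqP/x_inj e|xwk].
    by move: ywk; rewrite e; nat_lia.
  by have := anti _ _ _ cuw cuk xwk; nat_lia.
by split=> // z wz vz; exact: joinj.
Qed.

End Mirror.

(** * The Hasse diagram of a permutation *)

Section NextFacts.
Variable T : eqType.

Lemma next_rot_eq (s s' : seq T) (a b : T) (i : nat) :
  uniq s -> rot i s = a :: b :: s' -> next s a = b.
Proof. by move=> us e; rewrite -(next_rot i us) e /= eqxx. Qed.

Lemma next_mid (s1 s2 : seq T) (a b : T) : uniq (s1 ++ a :: b :: s2) ->
  next (s1 ++ a :: b :: s2) a = b.
Proof. by move=> us; apply: (next_rot_eq us (i := size s1)); rewrite rot_size_cat. Qed.

Lemma next_wrap (s : seq T) (a b : T) : uniq (b :: rcons s a) ->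
  next (b :: rcons s a) a = b.
Proof.
move=> us; apply: (next_rot_eq us (s' := s) (i := size (b :: s))).
by rewrite -rcons_cons -cats1 rot_size_cat.
Qed.

Lemma sorted_adjacent (f : T -> nat) (s : seq T) (a b : T) :
  pairwise (fun c d => f c < f d) s -> a \in s -> b \in s -> f a < f b ->
  (forall c, c \in s -> f a < f c -> f b <= f c) ->
  exists s1 s2, s = s1 ++ a :: b :: s2.
Proof.
move=> + aS; case/splitPr: aS => s1 s2; rewrite pairwise_cat => /and3P[/allrelP h1 _ /= /andP[/allP h2 h3]].
rewrite mem_cat inE => /or3P[b1|/eqP->|bs2] ab ab_min.
- by have := h1 b a b1 (mem_head _ _); lia.
- by rewrite ltnn in ab.
case: s2 h1 h2 h3 bs2 ab_min => // c s2 h1 h2 /= /andP[/allP h3 _] bs2 ab_min.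
exists s1, s2; congr (_ ++ [:: _ , _ & _]); move: bs2; rewrite inE => /predU1P[->//|bs2].
have := ab_min c; rewrite mem_cat !inE eqxx !orbT => /(_ isT (h2 c (mem_head _ _))).
by have := h3 b bs2; lia.
Qed.

Lemma sorted_last (f : T -> nat) (s : seq T) (a : T) :
  pairwise (fun c d => f c < f d) s -> a \in s -> (forall c, c \in s -> f c <= f a) ->
  exists s', s = rcons s' a.
Proof.
move=> + aS; case/splitPr: aS => s1 s2; rewrite pairwise_cat => /and3P[_ _ /= /andP[/allP h2 _]] a_max.
case: s2 h2 a_max => [_ _|c s2 h2 a_max]; first by exists s1; rewrite cats1.
have := h2 c (mem_head _ _); have := a_max c; rewrite mem_cat !inE eqxx !orbT => /(_ isT); lia.
Qed.

Lemma sorted_head (f : T -> nat) (s : seq T) (a : T) :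
  pairwise (fun c d => f c < f d) s -> a \in s -> (forall c, c \in s -> f a <= f c) ->
  exists s', s = a :: s'.
Proof.
case: s => // c s /= /andP[/allP h _]; rewrite inE => /predU1P[->|aS] a_min; first by exists s.
by have := h a aS; have := a_min c (mem_head _ _); lia.
Qed.

End NextFacts.

Section Hasse.
Variables (n : nat) (p : 'S_n.+2).
Local Notation V := 'I_n.+2.

Definition dle (u v : V) : bool := (u <= v) && (p u <= p v).

Definition lattice_like : Prop := forall u z v w, dle u v -> dle u w -> dle z v -> dle z w ->
    exists m, [/\ dle u m, dle z m, dle m v & dle m w].

Hypotheses (p0 : p ord0 = ord0) (pmax : p ord_max = ord_max) (lat : lattice_like).

Local Notation cov := (cov dle).
Let x (u : V) : nat := u.
Let y (u : V) : nat := p u.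

Let leE u v : dle u v = (x u <= x v) && (y u <= y v). Proof. by []. Qed.
Let x_inj : injective x. Proof. exact: val_inj. Qed.
Let y_inj : injective y. Proof. by move=> u v /val_inj/perm_inj. Qed.

Definition ups (u : V) : seq V := [seq v <- enum 'I_n.+2 | cov u v].
Definition downs (u : V) : seq V := [seq v <- enum 'I_n.+2 | cov v u].

(* The neighbours of u in the Hasse diagram, clockwise: x increases along the
   covers of u, then decreases along the elements covered by u. *)
Definition nbrs (u : V) : seq V := ups u ++ rev (downs u).

Lemma mem_ups (u v : V) : (v \in ups u) = cov u v.
Proof. by rewrite mem_filter mem_enum andbT. Qed.

Lemma mem_downs (u v : V) : (v \in downs u) = cov v u.
Proof. by rewrite mem_filter mem_enum andbT. Qed.

Lemma mem_nbrs (u v : V) : (v \in nbrs u) = cov u v || cov v u.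
Proof. by rewrite mem_cat mem_rev mem_ups mem_downs. Qed.

Lemma enum_sorted : pairwise (fun u v : V => u < v) (enum 'I_n.+2).
Proof.
rewrite -(pairwise_map (@nat_of_ord _) ltn) val_enum_ord -sorted_pairwise; last exact: ltn_trans.
exact: iota_ltn_sorted.
Qed.

Lemma ups_sorted (u : V) : pairwise (fun v w : V => v < w) (ups u).
Proof. exact/pairwise_filter/enum_sorted. Qed.

Lemma downs_sorted (u : V) : pairwise (fun v w : V => v < w) (downs u).
Proof. exact/pairwise_filter/enum_sorted. Qed.

Lemma nbrs_uniq (u : V) : uniq (nbrs u).
Proof.
rewrite cat_uniq rev_uniq; apply/and3P; split; try exact/filter_uniq/enum_uniq.
apply/hasPn => v; rewrite mem_rev mem_downs mem_ups.
exact: (cov_asym leE x_inj y_inj).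
Qed.

Lemma cov_next (u v : V) : cov u v || cov v u ->
  cov u (next (nbrs u) v) || cov (next (nbrs u) v) u.
Proof. by rewrite -!mem_nbrs mem_next. Qed.

Definition hdart := {d : V * V | cov d.1 d.2 || cov d.2 d.1}.

Definition hopp (d : hdart) : hdart :=
  exist _ ((val d).2, (val d).1) (etrans (orbC _ _) (valP d)).

Definition hcw (d : hdart) : hdart :=
  exist _ ((val d).1, next (nbrs (val d).1) (val d).2) (cov_next (valP d)).

Lemma hoppK : involutive hopp.
Proof. by move=> d; apply: val_inj; case: d => -[]. Qed.

Lemma hcw_inj : injective hcw.
Proof.
move=> [[u v] uv] [[u' v'] uv'] /(congr1 val) /= [eu]; move: uv'; rewrite -{}eu => uv' ev.
apply: val_inj; congr (_, _); apply: (can_inj (prev_next (nbrs_uniq u)) ev).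
Qed.

Lemma next_up (u v w : V) : cov u v -> cov u w -> v < w ->
  (forall k, cov u k -> v < k -> w <= k) -> next (nbrs u) v = w.
Proof.
move=> uv uw vw next_vw; have un := nbrs_uniq u.
have [|||s1 [s2 e]] := sorted_adjacent (f := @nat_of_ord _) (ups_sorted u) _ _ vw _; rewrite ?mem_ups //.
  by move=> c; rewrite mem_ups; exact: next_vw.
by move: un; rewrite /nbrs e -catA; exact: next_mid.
Qed.

Lemma next_down (u v w : V) : cov v u -> cov w u -> w < v ->
  (forall k, cov k u -> k < v -> k <= w) -> next (nbrs u) v = w.
Proof.
move=> vu wu wv next_vw; have un := nbrs_uniq u.
have [|||s1 [s2 e]] := sorted_adjacent (f := @nat_of_ord _) (downs_sorted u) _ _ wv _; rewrite ?mem_downs //.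
  move=> c; rewrite mem_downs => cu wc; rewrite leqNgt; apply/negP => cv.
  by have := next_vw c cu cv; lia.
by move: un; rewrite /nbrs e rev_cat !rev_cons -!cats1 -!catA catA; exact: next_mid.
Qed.

Lemma next_last_up (u v w : V) : cov u v -> (forall k, cov u k -> k <= v) ->
  cov w u -> (forall k, cov k u -> k <= w) -> next (nbrs u) v = w.
Proof.
move=> uv v_max wu w_max; have un := nbrs_uniq u.
have [||s1 e1] := sorted_last (f := @nat_of_ord _) (a := v) (ups_sorted u) _ _; rewrite ?mem_ups //.
  by move=> c; rewrite mem_ups; exact: v_max.
have [||s2 e2] := sorted_last (f := @nat_of_ord _) (a := w) (downs_sorted u) _ _; rewrite ?mem_downs //.
  by move=> c; rewrite mem_downs; exact: w_max.
by move: un; rewrite /nbrs e1 e2 rev_rcons cat_rcons; exact: next_mid.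
Qed.

Lemma next_last_down (u v w : V) : cov v u -> (forall k, cov k u -> v <= k) ->
  cov u w -> (forall k, cov u k -> w <= k) -> next (nbrs u) v = w.
Proof.
move=> vu v_min uw w_min; have un := nbrs_uniq u.
have [||s1 e1] := sorted_head (f := @nat_of_ord _) (a := w) (ups_sorted u) _ _; rewrite ?mem_ups //.
  by move=> c; rewrite mem_ups; exact: w_min.
have [||s2 e2] := sorted_head (f := @nat_of_ord _) (a := v) (downs_sorted u) _ _; rewrite ?mem_downs //.
  by move=> c; rewrite mem_downs; exact: v_min.
by move: un; rewrite /nbrs e1 e2 rev_cons cat_cons -rcons_cat; exact: next_wrap.
Qed.

(** The clockwise list can wrap around from a cover of u to a cover of u only if u covers nothing,
    that is, at the minimum; that corner is the outer one. *)
Lemma next_up_inv (u v w : V) : cov u v -> cov u w -> next (nbrs u) v = w ->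
  (v < w /\ (forall k, cov u k -> v < k -> w <= k)) \/
  [/\ u = ord0, forall k, cov u k -> k <= v & forall k, cov u k -> w <= k].
Proof.
move=> uv uw e; case: (pickP [pred k : V | cov u k && (v < k)]) => [k0 /andP[uk0 vk0]|v_max].
  case: (@arg_minnP V k0 (fun k => cov u k && (v < k)) (@nat_of_ord _)) => [|k /andP[uk vk] k_min].
    by rewrite uk0.
  have k_next c : cov u c -> v < c -> k <= c by move=> uc vc; apply: k_min; rewrite uc.
  by left; rewrite -e (next_up uv uk vk k_next).
right; have v_max' k : cov u k -> k <= v.
  by move=> uk; have := v_max k; rewrite /= uk /= => /negbT; rewrite -leqNgt.
have d0 : downs u = [::].
  case ed : (downs u) => [//|c s]; have cu : cov c u by rewrite -mem_downs ed mem_head.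
  case: (@arg_maxnP V c (fun k => cov k u) (@nat_of_ord _) cu) => k ku k_max.
  by have := cov_asym leE x_inj y_inj uw; rewrite -e (next_last_up uv v_max' ku k_max) ku.
have u0 : u = ord0.
  apply/eqP; apply: contraT => /eqP nu0.
  have [||k ku _] := @cov_below _ _ x y leE x_inj ord0 u; [by rewrite leE /y p0|exact: not_eq_sym|].
  by move: ku; rewrite -mem_downs d0.
split=> // k uk; case: (@arg_minnP V v (cov u) (@nat_of_ord _) uv) => k' uk' k'_min.
suff <- : k' = w by exact: k'_min.
have [||s1 e1] := sorted_last (f := @nat_of_ord _) (a := v) (ups_sorted u) _ _; rewrite ?mem_ups //.
  by move=> c; rewrite mem_ups; exact: v_max'.
have [||s2 e2] := sorted_head (f := @nat_of_ord _) (a := k') (ups_sorted u) _ _; rewrite ?mem_ups //.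
  by move=> c; rewrite mem_ups; exact: k'_min.
have un := nbrs_uniq u; rewrite -e; move: un; rewrite /nbrs d0 cats0 e1.
case: s1 e1 => [|c s1] e1; first by move: e2; rewrite e1 /= eqxx => -[->].
by move: e2; rewrite e1 rcons_cons => -[-> _] un; rewrite next_wrap.
Qed.

Let leE' u v : dle u v = (y u <= y v) && (x u <= x v). Proof. by rewrite leE andbC. Qed.

Lemma min_of_y_max_up (c c' : V) : cov c c' -> (forall k, cov c k -> c' <= k) ->
  forall k, cov c k -> y k <= y c'.
Proof.
move=> cc' c'_min k ck; have := c'_min k ck; rewrite leq_eqVlt => /orP[/eqP/val_inj->//|lt].
exact/ltnW/(cov_up_anti leE cc' ck).
Qed.

Lemma min_of_y_max_down (c c' : V) : cov c' c -> (forall k, cov k c -> y k <= y c') ->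
  forall k, cov k c -> c' <= k.
Proof.
move=> cc' c'_max k kc; rewrite leqNgt; apply/negP => lt.
by have := cov_down_anti leE kc cc' lt; have := c'_max k kc; nat_lia.
Qed.

Lemma rightmost_out (c : V) : c != ord_max ->
  exists c', cov c c' /\ forall k, cov c k -> k <= c'.
Proof.
move=> /eqP cm; have [|k ck _] := cov_above leE x_inj _ cm.
  by rewrite /dle pmax !leq_ord.
by case: (@arg_maxnP V k (cov c) (@nat_of_ord _) ck) => k' ck' k'_max; exists k'.
Qed.

Lemma leftmost_out (c : V) : c != ord_max ->
  exists c', cov c c' /\ forall k, cov c k -> c' <= k.
Proof.
move=> /eqP cm; have [|k ck _] := cov_above leE x_inj _ cm.
  by rewrite /dle pmax !leq_ord.
by case: (@arg_minnP V k (cov c) (@nat_of_ord _) ck) => k' ck' k'_min; exists k'.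
Qed.

Lemma rightmost_in (c : V) : c != ord0 ->
  exists c', cov c' c /\ forall k, cov k c -> k <= c'.
Proof.
move=> /eqP c0; have [||k ck _] := cov_below leE x_inj (u := ord0) (v := c).
- by rewrite /dle p0.
- exact: not_eq_sym.
by case: (@arg_maxnP V k (fun k => cov k c) (@nat_of_ord _) ck) => k' ck' k'_max; exists k'.
Qed.

Lemma leftmost_in (c : V) : c != ord0 ->
  exists c', cov c' c /\ forall k, cov k c -> c' <= k.
Proof.
move=> /eqP c0; have [||k ck _] := cov_below leE x_inj (u := ord0) (v := c).
- by rewrite /dle p0.
- exact: not_eq_sym.
by case: (@arg_minnP V k (fun k => cov k c) (@nat_of_ord _) ck) => k' ck' k'_min; exists k'.
Qed.

Lemma gt_neq0 (a b : V) : a < b -> b != ord0.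
Proof. by move=> ab; apply/eqP => b0; rewrite b0 in ab. Qed.

Lemma lt_neq_max (a b : V) : a < b -> a != ord_max.
Proof. by move=> ab; apply/eqP => am; have := leq_ord b; rewrite am /= in ab; lia. Qed.

(** * The boundary walk of an inner face *)

Section Face.
Variables u v w j : V.
Hypothesis cnr : corner dle x u v w j.

Let cnr' : corner dle y u w v j. Proof. exact: corner_sym cnr. Qed.
Let left := chain dle x y v j.
Let right := chain dle y x w j.
Let cuv : cov u v. Proof. by case: cnr. Qed.
Let cuw : cov u w. Proof. by case: cnr. Qed.
Let vj : dle v j. Proof. by case: cnr => _ _ _ _ []. Qed.
Let wj : dle w j. Proof. by case: cnr => _ _ _ _ []. Qed.

(** A face lies on the left of its darts, so its right side, from u through w to j, is walked
    upwards and its left side downwards. The left side of the face is the right boundary of the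
    interval [v, j]. *)
Definition face_down (a b : V) : Prop := (a = v /\ b = u) \/ [/\ left a, left b & cov b a].
Definition face_up (a b : V) : Prop := (a = u /\ b = w) \/ [/\ right a, right b & cov a b].

Lemma face_down_cov (a b : V) : face_down a b -> cov b a.
Proof. by case=> [[-> ->]|[]]. Qed.

Lemma face_up_cov (a b : V) : face_up a b -> cov a b.
Proof. by case=> [[-> ->]|[]]. Qed.

(** As a is the rightmost cover of b, the clockwise turn leads to the rightmost element covered by
    b: u if b is v, and otherwise the next one on the side. *)
Lemma face_down_step (a b : V) : face_down a b -> (a = v /\ b = u) \/ face_down b (next (nbrs b) a).
Proof.
case=> [|[la lb ba]]; [by left|right].
have a_max := chain_rightmost leE x_inj y_inj cnr lb la ba.
have [xba yba] := cov_lt leE x_inj y_inj ba.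
have nbj : b <> j by move=> e; case: la => _ /(le_x leE); rewrite -e; nat_lia.
case: (b =P v) => [bv|nbv].
  left; split=> //; rewrite bv in a_max *; rewrite bv in ba.
  by apply: next_last_up => // k; exact: (corner_rightmost_in leE x_inj y_inj lat cnr).
have [] := @rightmost_in b.
  by case: lb => /(le_x leE) vb _ _; apply/eqP => b0; apply: nbv; apply: x_inj; move: vb; rewrite b0 /x /=; lia.
move=> c [cb c_max]; rewrite (next_last_up ba a_max cb c_max).
by right; split=> //; exact: (chain_down leE x_inj y_inj lat cnr lb nbv nbj cb c_max).
Qed.

Lemma face_up_step (a b : V) : face_up a b -> face_up b (next (nbrs b) a) \/ face_down b (next (nbrs b) a).
Proof.
move=> ab; have cab := face_up_cov ab.
have rb : right b.
  by case: ab => [[_ ->]|[]//]; exact: (chain_bottom leE' wj).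
case: (b =P j) => [bj|nbj].
  (* At the top j the walk turns to the element covered by j just to the left of a, where the left
     side begins its descent. *)
  right; right.
  have [nvj nwj] := corner_neq leE cnr.
  have ra : right a by case: ab => [[_ bw]|[]//]; case: nwj; rewrite -bw.
  rewrite bj in cab *; have [q qj [vq xqa]] := top_left_in leE x_inj y_inj cnr ra cab.
  case: (@arg_maxnP V q (fun k => cov k j && (k < a)) (@nat_of_ord _)); first by rewrite qj.
  move=> z /andP[zj xza] z_max'.
  have z_max k : cov k j -> k < a -> k <= z by move=> kj ka; apply: z_max'; rewrite kj.
  rewrite (next_down cab zj xza z_max); split=> //; first exact: (chain_top leE vj).
  exact: (top_chain leE x_inj y_inj cnr ra cab zj xza z_max).
left; right.
(* Below the top, a is the leftmost element covered by b, so the clockwise turn wraps around to the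
   leftmost cover of b. *)
have a_min : forall k, cov k b -> a <= k.
  apply: min_of_y_max_down => // k kb.
  case: (b =P w) => [bw|nbw].
    case: ab => [[-> _]|[ra _ _]].
      by rewrite bw in kb; exact: (corner_rightmost_in leE' y_inj x_inj lat cnr' kb).
    by have [] := cov_lt leE x_inj y_inj cab; case: ra => /(le_x leE); rewrite bw; nat_lia.
  have ra : right a by case: ab => [[_ bw]|[]//]; case: nbw.
  case: (@arg_maxnP V a (fun k => cov k b) y cab) => c cb c_max.
  have [wc cj _] := chain_down leE' y_inj x_inj lat cnr' rb nbw nbj cb c_max.
  apply: leq_trans (c_max k kb) _; rewrite leqNgt; apply/negP => yac.
  have xca : x c < x a.
    rewrite ltnNge leq_eqVlt; apply/negP => /orP[/eqP/x_inj e|xac].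
      by rewrite e ltnn in yac.
    by have := cov_down_anti leE cab cb xac; nat_lia.
  by case: ra => _ _ /(_ c wc cj xca); nat_lia.
have [] := @leftmost_out b.
  by case: rb => _ /(le_x leE) bj _; apply/eqP => bm; apply: nbj; apply: x_inj; move: bj; rewrite bm /x /=; have := leq_ord j; lia.
move=> c [bc c_min]; rewrite (next_last_down cab a_min bc c_min); split=> //.
exact: (chain_up leE' y_inj x_inj cnr' rb nbj bc (min_of_y_max_up bc c_min)).
Qed.

Lemma face_close : next (nbrs u) v = w.
Proof. by case: cnr => _ _ vw next_vw _; exact: next_up. Qed.

End Face.

(** * The Hasse diagram as a planar map *)

Definition vnext_h : {perm hdart} := ((perm hcw_inj)^-1)%g.
Definition opp_h : {perm hdart} := perm (can_inj hoppK).

Lemma opp_hE (d : hdart) : val (opp_h d) = ((val d).2, (val d).1).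
Proof. by rewrite permE. Qed.

Lemma cw_hE (d : hdart) : val ((vnext_h^-1)%g d) = ((val d).1, next (nbrs (val d).1) (val d).2).
Proof. by rewrite invgK permE. Qed.

Lemma opp_hK : involutive opp_h.
Proof. by move=> d; rewrite !permE hoppK. Qed.

Lemma opp_h_neq (d : hdart) : opp_h d != d.
Proof.
apply/eqP => /(congr1 val); rewrite opp_hE; case: d => [[u v] /= uv] [vu _].
by move: uv; rewrite vu /cov eqxx.
Qed.

Definition face_h : {perm hdart} := fnext vnext_h opp_h.

Lemma face_hE (d : hdart) : val (face_h d) = ((val d).2, next (nbrs (val d).2) (val d).1).
Proof. by rewrite /face_h /fnext permM cw_hE opp_hE. Qed.

Lemma vnext_h_tail (d : hdart) : (val (vnext_h d)).1 = (val d).1.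
Proof. by rewrite -[d in RHS](permK vnext_h) cw_hE. Qed.

Lemma mem_porbit_vnext (d d' : hdart) : (d' \in porbit vnext_h d) = ((val d').1 == (val d).1).
Proof.
apply/idP/eqP => [|eq1].
  move=> h; have := @porbit_iter_closed _ vnext_h [pred e | (val e).1 == (val d).1] d.
  by move=> /(_ _ _ d' h) /= /(_ _ (eqxx _))/eqP; apply => e; rewrite vnext_h_tail.
rewrite -porbitV; apply/porbit_iterP.
case: d d' eq1 => [[u v] uv] [[u' w] uw] /= eu; move: uw; rewrite {}eu => uw.
have : w \in nbrs u by rewrite mem_nbrs.
have vN : v \in nbrs u by rewrite mem_nbrs.
rewrite -(fconnect_cycle (cycle_next (nbrs_uniq u)) vN) => /iter_findex eqw.
exists (findex (next (nbrs u)) v w); apply: val_inj; set d := exist _ (u, v) uv.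
have -> i : val (iter i (vnext_h^-1)%g d) = (u, iter i (next (nbrs u)) v).
  by elim: i => [//|i IH]; rewrite iterS cw_hE IH.
by rewrite eqw.
Qed.

Definition up_h (d : hdart) : bool := cov (val d).1 (val d).2.

Lemma up_hN (d : hdart) : ~~ up_h d -> cov (val d).2 (val d).1.
Proof. by case: d => [[u v] /= uv]; rewrite /up_h /= => h; move: uv; rewrite (negbTE h). Qed.

Lemma up_opp_h (d : hdart) : up_h (opp_h d) = ~~ up_h d.
Proof.
rewrite /up_h opp_hE /=; apply/idP/idP => [|/up_hN//].
exact: (cov_asym leE x_inj y_inj).
Qed.

Definition dart_of (u v : V) (uv : cov u v || cov v u) : hdart :=
  exist (fun d : V * V => cov d.1 d.2 || cov d.2 d.1) (u, v) uv.

Lemma dart_ex (u : V) : exists d : hdart, (val d).1 = u.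
Proof.
case: (eqVneq u ord_max) => [->|/rightmost_out[c [uc _]]].
  have [|c [cu _]] := @rightmost_in ord_max; first exact: (@gt_neq0 ord0).
  have cu' : cov ord_max c || cov c ord_max by rewrite cu orbT.
  by exists (dart_of cu').
have uc' : cov u c || cov c u by rewrite uc.
by exists (dart_of uc').
Qed.

Lemma card_vertices_h : #|porbits vnext_h| = n.+2.
Proof.
pose g (u : V) := [set d : hdart | (val d).1 == u].
have porbitE d : porbit vnext_h d = g (val d).1.
  by apply/setP => e; rewrite mem_porbit_vnext inE.
have -> : porbits vnext_h = g @: [set: V].
  apply/setP => A; apply/imsetP/imsetP => [[d _ ->]|[u _ ->]].
    by exists (val d).1; rewrite ?inE.
  by have [d <-] := dart_ex u; exists d.
rewrite card_imset ?cardsT ?card_ord // => u v eq_uv.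
have [d du] := dart_ex u; have : d \in g u by rewrite inE du.
by rewrite eq_uv inE du => /eqP.
Qed.

Lemma card_edges_h : #|porbits opp_h| = #|[set d | up_h d]|.
Proof. exact: card_porbits_involution opp_hK up_opp_h. Qed.

Definition bottoms_h : {set hdart} := [set d | up_h d && up_h (vnext_h d)].

Lemma face_h_V (d : hdart) : (face_h^-1)%g d = opp_h (vnext_h d).
Proof.
by apply: (@perm_inj _ face_h); rewrite permKV /face_h /fnext permM opp_hK permK.
Qed.

Lemma up_h_lt (d : hdart) : up_h d -> (val d).1 < (val d).2.
Proof. by move=> /(cov_lt leE x_inj y_inj)[]. Qed.

Lemma down_h_lt (d : hdart) : ~~ up_h d -> (val d).2 < (val d).1.
Proof. by move=> /up_hN/(cov_lt leE x_inj y_inj)[]. Qed.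

(** On a face, the dart with the lowest tail goes up and the one with the highest tail goes down, so
    there is a rise. *)
Lemma face_bottom_h (d : hdart) : exists2 e, e \in bottoms_h & e \in porbit face_h d.
Proof.
have [||e ed] := @porbit_rise _ face_h up_h d.
- case: (@arg_minnP _ d [in porbit face_h d] (fun e => nat_of_ord (val e).1)) => [|e ed e_min].
    exact: porbit_id.
  exists e => //; apply: contraT => /down_h_lt lt.
  by have := e_min (face_h e); move: lt; rewrite /= porbit_next face_hE /= => lt /(_ ed); lia.
- case: (@arg_maxnP _ d [in porbit face_h d] (fun e => nat_of_ord (val e).1)) => [|e ed e_max].
    exact: porbit_id.
  exists e => //; apply/negP => /up_h_lt lt.
  by have := e_max (face_h e); move: lt; rewrite /= porbit_next face_hE /= => lt /(_ ed); lia.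
by rewrite face_h_V up_opp_h negbK => ee; exists e; rewrite ?inE.
Qed.

Lemma root_ex : exists w, cov ord0 w /\ forall k, cov ord0 k -> w <= k.
Proof. by apply: leftmost_out; exact: (@lt_neq_max ord0 ord_max). Qed.

Lemma bottom_cases (d : hdart) : d \in bottoms_h ->
  ((val d).1 = ord0 /\ forall k, cov ord0 k -> (val d).2 <= k) \/
  exists j, corner dle x (val d).1 (val (vnext_h d)).2 (val d).2 j.
Proof.
rewrite inE => /andP[ud uvd]; have := cw_hE (vnext_h d); rewrite permK vnext_h_tail.
move: ud uvd; rewrite /up_h vnext_h_tail.
case: (val d) => u w /=; set v := (val (vnext_h d)).2 => uw uv [e].
case: (next_up_inv uv uw (esym e)) => [[vw v_next]|[u0 _ w_min]]; last by left; rewrite -u0.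
right; have [||j [vj wj joinj]] := @join_ex _ dle x y leE x_inj lat v w ord_max.
- by rewrite /dle pmax !leq_ord.
- by rewrite /dle pmax !leq_ord.
by exists j; split.
Qed.

Definition in_face (u v w j : V) (d : hdart) : Prop :=
  face_up u w j (val d).1 (val d).2 \/ face_down u v j (val d).1 (val d).2.

Lemma in_face_orbit (u v w j : V) (d e : hdart) : corner dle x u v w j ->
  e \in porbit face_h d -> in_face u v w j d -> in_face u v w j e.
Proof.
move=> cnr /porbit_iterP[i ->] fd; elim: i => [//|i]; rewrite iterS.
move: (iter i _ _) => {}d {fd}; rewrite /in_face face_hE /=; case.
  exact: face_up_step.
case/(face_down_step cnr) => [[-> ->]|]; last by right.
by left; left; rewrite (face_close cnr).
Qed.

(** The face keeps to the described boundary, where only the descent from v to u is followed by an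
    ascent. *)
Lemma inner_bottom_uniq (d e : hdart) (u v w j : V) : corner dle x u v w j -> val d = (u, w) ->
  e \in bottoms_h -> e \in porbit face_h d -> e = d.
Proof.
move=> cnr dE; rewrite inE => /andP[ue uve] ed; pose e' := (face_h^-1)%g e.
have eE : e = face_h e' by rewrite permKV.
have ne' : ~~ up_h e' by rewrite /e' face_h_V up_opp_h negbK.
have : in_face u v w j e'.
  by apply: (@in_face_orbit _ _ _ _ d) => //; rewrite ?porbit_prev // /in_face dE; left; left.
case=> [fu|fd]; first by move: ne'; rewrite /up_h (face_up_cov cnr fu).
move: ue; rewrite eE /up_h face_hE /= => ue.
case: (face_down_step cnr fd) => [[e1 e2]|fd'].
  by apply: val_inj; rewrite face_hE e1 e2 (face_close cnr) dE.
by have := cov_asym leE x_inj y_inj ue; rewrite (face_down_cov cnr fd').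
Qed.

(** A face with an inner corner has no other bottom; two bottoms of the outer kind are both the
    leftmost edge at the minimum. *)
Lemma bottom_uniq_h : {in bottoms_h &, forall d e, e \in porbit face_h d -> d = e}.
Proof.
move=> d e dB eB ed; case: (bottom_cases dB) => [[d1 d2]|[j cnr]]; last first.
  by apply/esym/(inner_bottom_uniq cnr) => //; case: (val d).
case: (bottom_cases eB) => [[e1 e2]|[j cnr]]; last first.
  by apply: (inner_bottom_uniq cnr) => //; [case: (val e)|rewrite porbit_sym].
have [ud ue] : cov (val d).1 (val d).2 /\ cov (val e).1 (val e).2.
  by move: dB eB; rewrite !inE => /andP[ud _] /andP[ue _].
rewrite d1 in ud; rewrite e1 in ue; apply: val_inj.
rewrite (surjective_pairing (val d)) (surjective_pairing (val e)) d1 e1; congr (_, _).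
by apply/val_inj/eqP; rewrite eqn_leq /= d2 // e2.
Qed.

Lemma next_down_inv (u z w : V) : cov z u -> cov u w -> next (nbrs u) z = w ->
  forall k, cov u k -> w <= k.
Proof.
move=> zu uw e k0 uk0.
case: (@arg_minnP V w (cov u) (@nat_of_ord _) uw) => k uk k_min.
suff -> : w = k by exact: k_min.
case: (pickP [pred c : V | cov c u && (c < z)]) => [c0 /andP[c0u c0z]|z_min].
  case: (@arg_maxnP V c0 (fun c => cov c u && (c < z)) (@nat_of_ord _)) => [|c /andP[cu cz] c_max].
    by rewrite c0u.
  have c_next d : cov d u -> d < z -> d <= c by move=> du dz; apply: c_max; rewrite du.
  by have := cov_asym leE x_inj y_inj uw; rewrite -e (next_down zu cu cz c_next) cu.
have z_min' c : cov c u -> z <= c.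
  by move=> cu; have := z_min c; rewrite /= cu /= => /negbT; rewrite -leqNgt.
by rewrite -e (next_last_down zu z_min' uk k_min).
Qed.

Definition lefts_h : {set hdart} := [set d | up_h d && ~~ up_h (vnext_h d)].

(** Such a dart leads to the leftmost cover of an element that also covers something, and each of
    the n inner elements has exactly one. *)
Lemma card_lefts_h : #|lefts_h| = n.
Proof.
have inj : {in lefts_h &, injective (fun d : hdart => (val d).1)}.
  have left_min d : d \in lefts_h -> forall k, cov (val d).1 k -> (val d).2 <= k.
    rewrite inE => /andP[ud /up_hN uvd]; rewrite vnext_h_tail in uvd.
    apply: next_down_inv uvd ud _.
    by have := cw_hE (vnext_h d); rewrite permK vnext_h_tail => ->.
  move=> d e dL eL eq1; apply: val_inj.
  have [ud ue] : cov (val d).1 (val d).2 /\ cov (val e).1 (val e).2.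
    by move: dL eL; rewrite !inE => /andP[? _] /andP[? _].
  rewrite (surjective_pairing (val d)) (surjective_pairing (val e)) eq1; congr (_, _).
  by apply/val_inj/eqP; rewrite eqn_leq left_min ?left_min // ?eq1 // -eq1.
rewrite -(card_in_imset inj).
have -> : [set (val d).1 | d in lefts_h] = ~: [set ord0; ord_max].
  apply/setP => u; rewrite !inE negb_or; apply/imsetP/andP => [[d]|[u0 um]].
    rewrite inE => /andP[/up_h_lt ud /down_h_lt uvd] ->.
    by rewrite vnext_h_tail in uvd; rewrite (gt_neq0 uvd) (lt_neq_max ud).
  have [w [uw w_min]] := leftmost_out um; have [z [zu z_min]] := leftmost_in u0.
  have uw' : cov u w || cov w u by rewrite uw.
  have zu' : cov u z || cov z u by rewrite zu orbT.
  have vE : vnext_h (dart_of uw') = dart_of zu'.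
    apply: (@perm_inj _ (vnext_h^-1)%g); rewrite permK; apply: val_inj.
    by rewrite cw_hE /= (next_last_down zu z_min uw w_min).
  exists (dart_of uw') => //; rewrite inE vE /up_h /= uw.
  exact: (cov_asym leE x_inj y_inj).
have := cardsC [set ord0; ord_max : V]; rewrite card_ord cards2 /= => h.
by apply/eqP; rewrite -(eqn_add2l 2) h.
Qed.

Lemma euler_h : #|porbits vnext_h| + #|porbits (fnext vnext_h opp_h)| = #|porbits opp_h| + 2.
Proof.
rewrite card_vertices_h card_edges_h -/face_h.
rewrite (card_porbits_transversal face_bottom_h bottom_uniq_h).
have <- : #|bottoms_h| + #|lefts_h| = #|[set d | up_h d]|.
  rewrite -(cardsID [set d | up_h (vnext_h d)] [set d | up_h d]).
  by congr (_ + _); apply: eq_card => d; rewrite !inE // andbC.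
by rewrite card_lefts_h; move: #|bottoms_h| => b; clear; lia.
Qed.

Lemma opp_h_tail (d : hdart) : (val (opp_h d)).1 = (val d).2.
Proof. by rewrite opp_hE. Qed.

(** From any dart one can descend along covers to a dart at the minimum, and come back. *)
Lemma connected_h (d d' : hdart) :
  connect (fun a b => (b == vnext_h a) || (b == opp_h a)) d d'.
Proof.
pose e : rel hdart := fun a b => (b == vnext_h a) || (b == opp_h a).
change (connect e d d'); have same a b : (val a).1 = (val b).1 -> connect e a b.
  move=> eq1; have /porbit_iterP[i ->] : b \in porbit vnext_h a by rewrite mem_porbit_vnext eq1.
  elim: i => [|i IH]; first exact: connect0.
  by apply: connect_trans IH (connect1 _); rewrite /e iterS eqxx.
have opp a : connect e a (opp_h a) by apply: connect1; rewrite /e eqxx orbT.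
have [d0 d00] := dart_ex ord0.
have to0 m : forall a : hdart, (val a).1 < m -> connect e a d0 /\ connect e d0 a.
  elim: m => // m IH a am; case: (eqVneq (val a).1 ord0) => [a0|/leftmost_in[c [ca _]]].
    by split; apply: same; rewrite a0 d00.
  have ca' : cov (val a).1 c || cov c (val a).1 by rewrite ca orbT.
  pose b := opp_h (dart_of ca').
  have [b0 b0'] : connect e b d0 /\ connect e d0 b.
    apply: IH; rewrite opp_h_tail /=; have [+ _] := cov_lt leE x_inj y_inj ca.
    rewrite /x; lia.
  split.
    by apply: connect_trans b0; apply: connect_trans (opp (dart_of ca')); exact: same.
  apply: (connect_trans b0'); apply: connect_trans (opp b) _.
  by apply: same; rewrite opp_h_tail /b opp_hE.
apply: connect_trans (proj1 (to0 _ d (leqnn _))) _.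
exact: (proj2 (to0 _ d' (leqnn _))).
Qed.

Definition hasse_map : planar_map :=
  PlanarMap opp_hK opp_h_neq connected_h euler_h.

(** The root must be the leftmost edge at the minimum for the corner on its left to be the outer
    one. Under [pmax] the list is nonempty, so the default is never reached. *)
Definition root2 : V := seq.head ord_max (ups ord0).

Lemma root2P : cov ord0 root2 /\ forall k, cov ord0 k -> root2 <= k.
Proof.
have [w [cw w_min]] := root_ex.
have [||s' e] := sorted_head (f := @nat_of_ord _) (a := w) (ups_sorted ord0) _ _; rewrite ?mem_ups //.
  by move=> c; rewrite mem_ups; exact: w_min.
by rewrite /root2 e.
Qed.

Lemma root_proof : cov ord0 root2 || cov root2 ord0.
Proof. by have [-> _] := root2P. Qed.

Lemma fwd_h (d : hasse_map) : (opp hasse_map d \in [set d | up_h d]) = (d \notin [set d | up_h d]).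
Proof. by rewrite !inE -up_opp_h. Qed.

Definition hasse : oriented_map := @OrientedMap hasse_map (dart_of root_proof) [set d | up_h d] fwd_h.

End Hasse.

(** * The Hasse diagram is a plane bipolar poset *)

Section HassePoset.
Variables (n : nat) (p : 'S_n.+2).
Hypotheses (p0 : p ord0 = ord0) (pmax : p ord_max = ord_max) (lat : lattice_like p).
Local Notation V := 'I_n.+2.
Local Notation H := (hasse p0 pmax lat).
Local Notation dle := (dle p).
Local Notation cov := (cov dle).

Let x (u : V) : nat := u.
Let y (u : V) : nat := p u.
Let leE u v : dle u v = (x u <= x v) && (y u <= y v). Proof. by []. Qed.
Let x_inj : injective x. Proof. exact: val_inj. Qed.
Let y_inj : injective y. Proof. by move=> u v /val_inj/perm_inj. Qed.

Definition vnode (u : V) : {set H} := [set d : H | (val (d : hdart p)).1 == u].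

Lemma tail_hasse (d : H) : tail d = vnode (val d).1.
Proof. by apply/setP => e; rewrite inE; exact: mem_porbit_vnext. Qed.

Lemma head_hasse (d : H) : head d = vnode (val d).2.
Proof. by rewrite /head tail_hasse opp_h_tail. Qed.

Lemma vnode_inj : injective vnode.
Proof.
move=> u v eq_uv; have [d du] := dart_ex p0 pmax u.
have : d \in vnode u by rewrite inE du.
by rewrite eq_uv inE du => /eqP.
Qed.

Lemma vertices_hasse (A : {set H}) : A \in vertices H <-> exists u, A = vnode u.
Proof.
split=> [/imsetP[d _ ->]|[u ->]]; first by exists (val d).1; exact: tail_hasse.
have [d <-] := dart_ex p0 pmax u; rewrite -(tail_hasse d); exact: imset_f.
Qed.

Lemma fwd_hasse (d : H) : (d \in fwd H) = cov (val d).1 (val d).2.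
Proof. by rewrite inE. Qed.

Lemma root_vertex_hasse : root_vertex H = vnode ord0.
Proof. exact: tail_hasse. Qed.

Lemma dwalk_hasse (u : V) (q : seq H) (A : {set H}) : dwalk (vnode u) q A ->
  exists v, [/\ A = vnode v, dle u v & q <> [::] -> u < v].
Proof.
elim: q u => [|d q IH] u /=; first by move/eqP <-; exists u; rewrite leE !leqnn.
rewrite fwd_hasse tail_hasse head_hasse => /and3P[cd /eqP/vnode_inj du /IH[v [-> dv _]]].
have := cov_lt leE x_inj y_inj cd; rewrite du => -[xu yu].
move: dv; rewrite leE => /andP[xv yv]; exists v; split=> // [|_]; last exact: leq_trans xv.
by apply/andP; split; apply: ltnW; [exact: leq_trans xv|exact: leq_trans yv].
Qed.

Lemma acyclic_hasse : acyclic H.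
Proof.
move=> A [//|d q] w; have : tail d = A by move: w => /= /and3P[_ /eqP].
rewrite tail_hasse => e; rewrite -e in w; have [v [/vnode_inj <- _ h]] := dwalk_hasse w.
by have : (val d).1 < (val d).1 by [apply: h]; rewrite ltnn.
Qed.

Lemma source_hasse (A : {set H}) : source A <-> A = root_vertex H.
Proof.
rewrite root_vertex_hasse; split=> [[/vertices_hasse[u ->] noin]|->].
  congr vnode; apply/eqP; apply: contraT => /(rightmost_in p0)[c [cu _]].
  have cu' : cov c u || cov u c by rewrite cu.
  by case: (noin (dart_of cu')); rewrite ?fwd_hasse ?head_hasse.
split=> [|d]; first by apply/vertices_hasse; exists ord0.
rewrite fwd_hasse head_hasse => /(cov_lt leE x_inj y_inj)[lt _] /vnode_inj e.
by rewrite e in lt.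
Qed.

Lemma sink_hasse (A : {set H}) : sink A <-> A = vnode ord_max.
Proof.
split=> [[/vertices_hasse[u ->] noout]|->].
  congr vnode; apply/eqP; apply: contraT => /(rightmost_out pmax)[c [uc _]].
  have uc' : cov u c || cov c u by rewrite uc.
  by case: (noout (dart_of uc')); rewrite ?fwd_hasse ?tail_hasse.
split=> [|d]; first by apply/vertices_hasse; exists ord_max.
rewrite fwd_hasse tail_hasse => /(cov_lt leE x_inj y_inj)[lt _] /vnode_inj e.
by have := leq_ord (val d).2; move: lt; rewrite e /x /=; lia.
Qed.

(** The witness goes from the maximum to the rightmost element r it covers. If its face had an inner
    bottom, the maximum would be the top of that face, and the turn there would lead to the left of
    another covered element, unlike r. *)
Lemma sink_on_root_face : incident (vnode ord_max) (root_face H).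
Proof.
have [|r [cr r_max]] := @rightmost_in n p p0 ord_max; first exact: (@gt_neq0 n ord0).
have cr' : cov ord_max r || cov r ord_max by rewrite cr orbT.
pose tau : H := dart_of cr'; exists tau; split; first by rewrite tail_hasse.
have no_up a : cov ord_max a -> False.
  by move=> /(cov_lt leE x_inj y_inj)[]; have := leq_ord a; rewrite /x /=; lia.
have [e eB et] := face_bottom_h (tau : hdart p).
have [[e1 e_min]|[j cnr]] := bottom_cases p0 pmax lat eB.
  suff eR : e = root H.
    by apply/eqP; rewrite /left_face /root_face eq_porbit_mem -eR porbit_sym.
  have [r_cov r_min] := root2P pmax; apply: val_inj; rewrite (surjective_pairing (val e)) e1.
  have ce : cov ord0 (val e).2 by move: eB; rewrite inE => /andP[+ _]; rewrite /up_h e1.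
  by congr (_, _); apply/val_inj/eqP; rewrite eqn_leq e_min // r_min.
exfalso; pose e' := ((face_h p)^-1)%g tau.
have ine : in_face (val e).1 (val (vnext_h p e)).2 (val e).2 j e'.
  apply: (in_face_orbit p0 pmax lat cnr (d := e)); last by left; left.
  by rewrite porbit_prev porbit_sym.
have : val (face_h p e') = (ord_max, r) by rewrite permKV.
rewrite face_hE => -[e2]; rewrite e2 => next_r.
have [nvj nwj] := corner_neq leE cnr.
have vj : dle (val (vnext_h p e)).2 j by case: cnr => _ _ _ _ [].
case: ine => [fu|fd]; last by have := face_down_cov cnr fd; rewrite e2 => /no_up.
have ce' := face_up_cov cnr fu; rewrite e2 in ce'.
case: fu => [[_ w2]|[ra rb _]].
  have wj : dle (val e).2 j by case: cnr => _ _ _ _ [].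
  apply: nwj; rewrite -w2 e2; apply: val_inj; move: wj; rewrite -w2 e2 leE => /andP[+ _].
  by have := leq_ord j; rewrite /x /=; lia.
have jm : j = ord_max.
  apply: val_inj; case: rb => _ + _; rewrite e2 leE => /andP[+ _].
  by have := leq_ord j; rewrite /x /=; lia.
rewrite jm in cnr ra; have [q qj [_ qe]] := top_left_in leE x_inj y_inj cnr ra ce'.
case: (@arg_maxnP V q (fun k => cov k ord_max && (k < (val e').1)) (@nat_of_ord _)).
  by rewrite qj.
move=> z /andP[zj ze] z_max.
have := r_max _ ce'; rewrite -next_r (next_down ce' zj ze); first by rewrite leqNgt ze.
by move=> k kj ke; apply: z_max; rewrite kj.
Qed.

Lemma irreducible_hasse (e : H) : ~ transitive_edge e.
Proof.
case; rewrite fwd_hasse tail_hasse head_hasse => ce [[|d q] [w nin]].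
  move: w => /= /eqP/vnode_inj e12.
  by have [lt _] := cov_lt leE x_inj y_inj ce; rewrite e12 ltnn in lt.
move: w nin; rewrite /= fwd_hasse tail_hasse head_hasse inE negb_or.
move=> /and3P[cd /eqP/vnode_inj d1 /dwalk_hasse[v [/vnode_inj <- dv _]]] /andP[/eqP ned _].
rewrite d1 in cd; have [_ _ h] := covP ce; have [nd _ _] := covP cd.
case: (h (val d).2 (cov_le cd) dv) => [e21|e22]; first by case: nd.
case: ned; apply: val_inj; rewrite (surjective_pairing (val d)) (surjective_pairing (val e)).
by rewrite d1 e22.
Qed.

Lemma hasse_bipolar_poset : bipolar_poset_on n.+2 H.
Proof.
split; last exact: card_vertices_h.
split; last exact: irreducible_hasse.
split; [exact: acyclic_hasse|exact: source_hasse|].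
by exists (vnode ord_max); split; [exact: sink_hasse|exact: sink_on_root_face].
Qed.

End HassePoset.

(** * The permutation is determined by its Hasse diagram *)

Lemma ord_mono_id (n : nat) (f : 'I_n -> 'I_n) :
  (forall i j : 'I_n, i < j -> f i < f j) -> forall i, f i = i.
Proof.
move=> mono; have ge m : forall i : 'I_n, i <= m -> i <= f i.
  elim: m => [|m IH] i im; first by rewrite (leq_trans im).
  case: i im => -[|i] //= lt_i im; have lt_i' : i < n by exact: ltnW.
  have := mono (Ordinal lt_i') (Ordinal lt_i) (leqnn _).
  by have := IH (Ordinal lt_i') im => /=; exact: leq_ltn_trans.
have le m : forall i : 'I_n, n <= i + m.+1 -> f i <= i.
  elim: m => [|m IH] i im; first by have := ltn_ord (f i); lia.
  case: (ltnP i.+1 n) => lt_i; last by have := ltn_ord (f i); lia.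
  have := mono i (Ordinal lt_i) (leqnn _).
  have : f (Ordinal lt_i) <= i.+1 by apply: IH => /=; rewrite addSnnS.
  by lia.
move=> i; apply/val_inj/eqP; rewrite eqn_leq (le n) ?(ge i) //.
by rewrite addnS ltnW // ltnS leq_addl.
Qed.

Lemma cov_morph_le (V V' : finType) (le : rel V) (le' : rel V') (x : V -> nat)
    (y : V -> nat) (f : V -> V') :
  (forall u v, le u v = (x u <= x v) && (y u <= y v)) -> injective x -> injective y ->
  reflexive le' -> transitive le' ->
  (forall u v, cov le u v -> cov le' (f u) (f v)) ->
  forall u v, le u v -> le' (f u) (f v).
Proof.
move=> leE xI yI refl' trans' fcov u v uv.
have [m] := ubnP (x v - x u); elim: m u uv => // m IH u uv xm.
case: (u =P v) => [->|nuv]; first exact: refl'.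
have [k uk kv] := cov_above leE xI uv nuv; have [xuk _] := cov_lt leE xI yI uk.
apply: (trans' (f k)); first exact/cov_le/fcov.
by apply: IH => //; have := le_x leE kv; nat_lia.
Qed.

Section SameOrder.
Variables (n : nat) (p q : 'S_n.+2).
Local Notation V := 'I_n.+2.

(** Comparing positions and values shows that [q] after the inverse of [p] is increasing, hence the
    identity. *)
Lemma dle_inj : (forall u v : V, dle p u v = dle q u v) -> p = q.
Proof.
move=> same; have inv i : q ((p^-1)%g i) = i.
  apply: (@ord_mono_id _ (fun i => q ((p^-1)%g i))) => {}i j lt_ij.
  set a := (p^-1)%g i; set b := (p^-1)%g j.
  have [pa pb] : p a = i /\ p b = j by rewrite !permKV.
  have nqab : q a != q b :> nat.
    by apply/eqP => /val_inj/perm_inj e; move: lt_ij; rewrite -pa -pb e ltnn.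
  rewrite ltn_neqAle nqab /=; case: (leqP a b) => ab.
    by have := same a b; rewrite /dle ab pa pb ltnW // => /esym/andP[].
  rewrite leqNgt; apply/negP => qba.
  by have := same b a; rewrite /dle (ltnW ab) pa pb (ltnW qba) /= leqNgt lt_ij.
by apply/permP => u; have := inv (p u); rewrite permK => ->.
Qed.

End SameOrder.

Section Separation.
Variables (n : nat) (p : 'S_n.+2).
Hypothesis p0 : p ord0 = ord0.
Local Notation V := 'I_n.+2.
Local Notation dle := (dle p).

Let x (u : V) : nat := u.
Let y (u : V) : nat := p u.
Let leE u v : dle u v = (x u <= x v) && (y u <= y v). Proof. by []. Qed.
Let x_inj : injective x. Proof. exact: val_inj. Qed.

(* Incomparable elements are ordered from left to right like the covers of a
   maximal common lower bound m that lie below them. *)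
Definition separated (u v k1 k2 : V) : Prop :=
  exists m, [/\ cov dle m k1, cov dle m k2, dle k1 u, dle k2 v & ~~ dle k1 v /\ ~~ dle k2 u].

Lemma separated_ex (u v : V) : ~~ dle u v -> ~~ dle v u -> exists k1 k2, separated u v k1 k2.
Proof.
move=> nuv nvu.
have low w : dle ord0 w by rewrite leE /y p0.
case: (@arg_maxnP V ord0 (fun m => dle m u && dle m v) x); first by rewrite !low.
move=> m /andP[mu mv] m_max.
have top k : cov dle m k -> dle k u -> dle k v -> False.
  move=> /covP[nmk /andP[xmk _] _] ku kv; case: nmk; apply/val_inj/eqP.
  by rewrite eqn_leq xmk; apply: m_max; rewrite ku.
have [k1 mk1 k1u] := cov_above leE x_inj mu (fun e => negP nuv (eq_ind m (fun w => dle w v) mv u e)).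
have [k2 mk2 k2v] := cov_above leE x_inj mv (fun e => negP nvu (eq_ind m (fun w => dle w u) mu v e)).
exists k1, k2, m; split=> //; split; apply/negP => h.
  exact: (top k1).
exact: (top k2).
Qed.

(** Were k2 to the left of k1, then k1 would be lower than k2 in y and so below v, against the
    separation. *)
Lemma separated_lt (u v k1 k2 : V) : separated u v k1 k2 -> u < v -> k1 < k2.
Proof.
case=> m [mk1 mk2 k1u k2v [nk1v nk2u]] uv.
rewrite ltnNge leq_eqVlt; apply/negP => /orP[/eqP/val_inj e|lt]; first by move: nk2u; rewrite e k1u.
have := cov_up_anti leE mk2 mk1 lt => ylt.
move: nk1v; rewrite leE /x /y; move: k1u k2v; rewrite !leE => /andP[a _] /andP[_ b].
by rewrite (leq_trans a (ltnW uv)) (leq_trans (ltnW ylt) b).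
Qed.

End Separation.

Section Uniqueness.
Variables (n : nat) (p q : 'S_n.+2).
Hypotheses (p0 : p ord0 = ord0) (pmax : p ord_max = ord_max) (latp : lattice_like p)
  (q0 : q ord0 = ord0) (qmax : q ord_max = ord_max) (latq : lattice_like q).
Local Notation V := 'I_n.+2.
Local Notation Hp := (hasse p0 pmax latp).
Local Notation Hq := (hasse q0 qmax latq).

Lemma dle_refl (r : 'S_n.+2) : reflexive (dle r).
Proof. by move=> u; rewrite /dle !leqnn. Qed.

Lemma dle_trans (r : 'S_n.+2) : transitive (dle r).
Proof. by move=> v u w /andP[a b] /andP[c d]; rewrite /dle (leq_trans a) ?(leq_trans b). Qed.

Lemma dle_mono (r : 'S_n.+2) (f : V -> V) (r' : 'S_n.+2) :
  (forall u v, cov (dle r) u v -> cov (dle r') (f u) (f v)) ->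
  forall u v, dle r u v -> dle r' (f u) (f v).
Proof.
apply: (@cov_morph_le _ _ _ _ (@nat_of_ord _) (fun u => nat_of_ord (r u))) => //.
- exact: val_inj.
- by move=> u v /val_inj/perm_inj.
- exact: dle_refl.
- exact: dle_trans.
Qed.

(** The isomorphism induces a bijection [phi] of the elements that preserves covers, hence the
    order, as well as the left-to-right order of covers. These make [phi] increasing, so it is the
    identity. *)
Lemma hasse_iso_inj : map_iso Hp Hq -> p = q.
Proof.
case=> f [f_bij fv fo fr ff]; have f_inj := bij_inj f_bij.
have fcw (d : hdart p) : f (((vnext_h p)^-1)%g d) = ((vnext_h q)^-1)%g (f d).
  by apply: (@perm_inj _ (vnext_h q)); rewrite permKV -[vnext_h q _]fv permKV.
have fiter (d : hdart p) i : f (iter i (vnext_h p) d) = iter i (vnext_h q) (f d).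
  by elim: i => //= i <-; exact: fv.
have same_tail (d e : hdart p) : (val (f d : hdart q)).1 = (val (f e : hdart q)).1 <-> (val d).1 = (val e).1.
  split=> eq1.
    have /porbit_iterP[i] : f e \in porbit (vnext_h q) (f d) by rewrite mem_porbit_vnext eq1.
    rewrite -fiter => /f_inj ->; elim: i {eq1} => //= i ->; exact/esym/vnext_h_tail.
  have /porbit_iterP[i ->] : e \in porbit (vnext_h p) d by rewrite mem_porbit_vnext eq1.
  rewrite fiter; elim: i => //= i ->; exact/esym/vnext_h_tail.
have /fin_all_exists[phi phiP] : forall u : V, exists v : V, forall d : hdart p, (val d).1 = u ->
    (val (f d : hdart q)).1 = v.
  move=> u; have [d0 d0u] := dart_ex p0 pmax u; exists (val (f d0 : hdart q)).1 => d du.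
  by apply/same_tail; rewrite du d0u.
have f1 (d : hdart p) : (val (f d : hdart q)).1 = phi (val d).1 by exact: phiP.
have f2 (d : hdart p) : (val (f d : hdart q)).2 = phi (val d).2.
  by rewrite -opp_h_tail -[opp_h q _]fo f1 opp_h_tail.
have fE (d : hdart p) : val (f d : hdart q) = (phi (val d).1, phi (val d).2).
  by rewrite -f1 -f2 -surjective_pairing.
have phi_inj : injective phi.
  move=> u v; have [d <-] := dart_ex p0 pmax u; have [e <-] := dart_ex p0 pmax v.
  by rewrite -!f1 => /same_tail.
have covE u v : cov (dle q) (phi u) (phi v) = cov (dle p) u v.
  apply/idP/idP => [c|c].
    have c' : cov (dle q) (phi u) (phi v) || cov (dle q) (phi v) (phi u) by rewrite c.
    have [g gK fK] := f_bij; pose d : hdart p := g (dart_of c').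
    have fd : f d = dart_of c' by exact: fK.
    have := fE d; rewrite fd => -[/phi_inj e1 /phi_inj e2].
    by have := ff d; rewrite fd !inE /up_h /= c -e1 -e2 => /esym.
  have c' : cov (dle p) u v || cov (dle p) v u by rewrite c.
  by have := ff (dart_of c'); rewrite !inE /up_h fE /= c.
have [psi phiK psiK] := injF_bij phi_inj.
have leE u v : dle q (phi u) (phi v) = dle p u v.
  apply/idP/idP; last by apply: dle_mono => a b; rewrite covE.
  rewrite -{2}(phiK u) -{2}(phiK v); apply: dle_mono => a b.
  by rewrite -{1}(psiK a) -{1}(psiK b) covE.
have phi0 : phi ord0 = ord0 by have := f1 (root Hp); rewrite fr.
have phir : phi (root2 p) = root2 q by have := f2 (root Hp); rewrite fr.
(* Clockwise rotation is preserved, so consecutive covers could be reversed only by the wrap at the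
   minimum; as the root is preserved, w would then be the leftmost cover. *)
have step u v w : cov (dle p) u v -> cov (dle p) u w -> v < w ->
    (forall k, cov (dle p) u k -> v < k -> w <= k) -> phi v < phi w.
  move=> uv uw vw vw_next; have c' : cov (dle p) u v || cov (dle p) v u by rewrite uv.
  have := congr1 val (fcw (dart_of c')); rewrite fE !cw_hE fE /=.
  rewrite (next_up uv uw vw vw_next) => -[e].
  have [uv' uw'] : cov (dle q) (phi u) (phi v) /\ cov (dle q) (phi u) (phi w) by rewrite !covE.
  have [[]//|[u0 _ w_min]] := next_up_inv q0 uv' uw' (esym e).
  have u00 : u = ord0 by apply: phi_inj; rewrite u0 phi0.
  have [r_cov r_min] := root2P qmax; have [_ rp_min] := root2P pmax.
  have : w = root2 p.
    apply: phi_inj; rewrite phir; apply/val_inj/eqP; rewrite eqn_leq.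
    rewrite u0 in uw' w_min; by rewrite r_min // w_min.
  rewrite u00 in uv; move=> wr; by have := rp_min v uv; rewrite -wr leqNgt vw.
have ups_mono u v w : cov (dle p) u v -> cov (dle p) u w -> v < w -> phi v < phi w.
  move=> uv; have [m] := ubnP w; elim: m w => // m IH w wm uw vw.
  case: (@arg_maxnP V v (fun k => cov (dle p) u k && (k < w)) (@nat_of_ord _)); first by rewrite uv.
  move=> k /andP[uk kw] k_max.
  have lt_kw : phi k < phi w.
    apply: (step u) => // c uc kc; rewrite leqNgt; apply/negP => cw.
    by have := k_max c; rewrite uc cw => /(_ isT); lia.
  have : v <= k by apply: k_max; rewrite uv.
  rewrite leq_eqVlt => /orP[/eqP/val_inj->//|vk]; apply: ltn_trans lt_kw.
  by apply: IH vk => //; lia.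
(* Comparable elements follow from the order; incomparable ones from separating covers k1, k2, whose
   images separate the images of u and v. *)
have phi_mono (u v : V) : u < v -> phi u < phi v.
  move=> uv; have nvu : ~~ dle p v u by rewrite /dle negb_and -ltnNge uv.
  have nphi : phi u != phi v :> nat by apply/eqP => /val_inj/phi_inj e; rewrite e ltnn in uv.
  case: (boolP (dle p u v)) => [|nuv].
    by rewrite -leE => /andP[h _]; rewrite ltn_neqAle nphi.
  have [k1 [k2 sep]] := separated_ex p0 nuv nvu.
  have [m [mk1 mk2 k1u k2v [nk1v nk2u]]] := sep.
  rewrite ltn_neqAle nphi leqNgt; apply/negP => lt_vu.
  have := ups_mono m k1 k2 mk1 mk2 (separated_lt sep uv); rewrite ltnNge => /negP; apply.
  apply/ltnW; apply: (@separated_lt _ q _ _ _ _ _ lt_vu).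
  by exists (phi m); rewrite !covE !leE; split.
have phi_id := ord_mono_id phi_mono.
by apply: dle_inj => u v; rewrite -leE !phi_id.
Qed.

End Uniqueness.

(** * Every plane bipolar poset is a Hasse diagram *)

Lemma next_map_in (T T' : eqType) (h : T -> T') (s : seq T) (a : T) :
  uniq s -> {in s &, injective h} -> a \in s -> next (map h s) (h a) = h (next s a).
Proof.
move=> us h_inj aS; have [i s' rot_s] := rot_to aS.
have uh : uniq (map h s) by rewrite map_inj_in_uniq.
by rewrite -(next_rot i uh) -(next_rot i us) -map_rot rot_s; case: s' {rot_s} => [|b s'] /=; rewrite !eqxx.
Qed.

Section Rank.
Variables (T : finType) (A : {set T}) (f : T -> nat).

(** Compresses the values of f to consecutive integers from 0, so that coordinates become positions
    and values of a permutation. *)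
Definition rank_in (v : T) : nat := #|[set u in A | f u < f v]|.

Lemma rank_in_lt (u v : T) : u \in A -> v \in A -> (rank_in u < rank_in v) = (f u < f v).
Proof.
move=> uA vA; apply/idP/idP => [|uv].
  apply: contraLR; rewrite -!leqNgt => vu; apply: subset_leq_card; apply/subsetP => w.
  by rewrite !inE => /andP[-> wv]; exact: leq_trans vu.
apply: proper_card; apply/properP; split.
  by apply/subsetP => w; rewrite !inE => /andP[-> wv]; exact: ltn_trans uv.
by exists u; rewrite !inE uA ?uv ?ltnn.
Qed.

Lemma rank_in_le (u v : T) : u \in A -> v \in A -> (rank_in u <= rank_in v) = (f u <= f v).
Proof. by move=> uA vA; rewrite leqNgt rank_in_lt // -leqNgt. Qed.

Lemma rank_in_bound (v : T) : v \in A -> rank_in v < #|A|.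
Proof.
move=> vA; apply: proper_card; apply/properP; split.
  by apply/subsetP => w; rewrite !inE => /andP[].
by exists v; rewrite ?inE ?vA ?ltnn.
Qed.

End Rank.

Section Representation.
Variables (n : nat) (M : oriented_map) (t : {set M}) (tau : M).
Hypotheses (acyM : acyclic M)
  (sourceM : forall v : {set M}, source v <-> v = root_vertex M)
  (sinkM : forall v : {set M}, sink v <-> v = t)
  (tail_tau : tail tau = t) (face_tau : left_face tau = root_face M)
  (irredM : forall e : M, ~ transitive_edge e)
  (cardM : #|vertices M| = n.+2).

Local Notation s := (root_vertex M).
Local Notation V := 'I_n.+2.
Local Notation outs := (outs t tau).
Local Notation ins := (ins t tau).
Local Notation around := (around t tau).

Let memV (d : M) : tail d \in vertices M := tail_vertices d.

(** The ranks in x are the positions of p and the ranks in y its values. Edges are covers as none is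
    transitive, and [sorted_xy] matches the clockwise lists at the vertices, which gives the
    isomorphism of maps. *)
Lemma hasse_representation : exists p : 'S_n.+2,
  [/\ p ord0 = ord0, p ord_max = ord_max, lattice_like p &
    forall (p0 : p ord0 = ord0) (pmax : p ord_max = ord_max) (latp : lattice_like p),
      map_iso M (hasse p0 pmax latp)].
Proof.
have [x [y [xI yI reachE sorted_xy latM]]] :=
  coordinates_ex acyM sourceM sinkM tail_tau face_tau irredM.
pose X v : V := inord (rank_in (vertices M) x v).
pose Y v : V := inord (rank_in (vertices M) y v).
have XE v : v \in vertices M -> X v = rank_in (vertices M) x v :> nat.
  by move=> vV; rewrite inordK // -cardM rank_in_bound.
have YE v : v \in vertices M -> Y v = rank_in (vertices M) y v :> nat.
  by move=> vV; rewrite inordK // -cardM rank_in_bound.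
have Xlt u v : u \in vertices M -> v \in vertices M -> (X u < X v) = (x u < x v).
  by move=> uV vV; rewrite !XE // rank_in_lt.
have Xle u v : u \in vertices M -> v \in vertices M -> (X u <= X v) = (x u <= x v).
  by move=> uV vV; rewrite !XE // rank_in_le.
have Yle u v : u \in vertices M -> v \in vertices M -> (Y u <= Y v) = (y u <= y v).
  by move=> uV vV; rewrite !YE // rank_in_le.
have XI : {in vertices M &, injective X}.
  by move=> u v uV vV e; apply: xI => //; apply/eqP; rewrite eqn_leq -!Xle // e leqnn.
have YI : {in vertices M &, injective Y}.
  by move=> u v uV vV e; apply: yI => //; apply/eqP; rewrite eqn_leq -!Yle // e leqnn.
have imX : X @: vertices M = [set: V].
  by apply/eqP; rewrite eqEcard subsetT cardsT card_ord (card_in_imset XI) cardM leqnn.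
have /fin_all_exists[node nodeP] : forall i : V, exists v, v \in vertices M /\ X v = i.
  move=> i; have : i \in X @: vertices M by rewrite imX inE.
  by case/imsetP => v vV ->; exists v.
have nodeV i : node i \in vertices M by case: (nodeP i).
have Xnode i : X (node i) = i by case: (nodeP i).
have nodeX v : v \in vertices M -> node (X v) = v by move=> vV; apply: XI.
have node_inj : injective (Y \o node).
  by move=> i j /= /YI e; rewrite -(Xnode i) -(Xnode j) e.
pose p : 'S_n.+2 := perm node_inj.
have pX v : v \in vertices M -> p (X v) = Y v by move=> vV; rewrite permE /= nodeX.
have dleE u v : u \in vertices M -> v \in vertices M -> dle p (X u) (X v) = reach u v.
  by move=> uV vV; rewrite /dle !pX // Xle // Yle // reachE.
have sV : s \in vertices M by exact: tail_vertices.
have tV : t \in vertices M by rewrite -tail_tau.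
have low i : dle p (X s) i.
  by rewrite -(Xnode i) dleE //; exact: source_reach.
have high i : dle p i (X t).
  by rewrite -(Xnode i) dleE //; exact: reach_sink.
have Xs : X s = ord0.
  by apply: val_inj; have /andP[] := low ord0; rewrite leqn0 => /eqP.
have Xt : X t = ord_max.
  by apply/val_inj/eqP; rewrite eqn_leq leq_ord; have /andP[] := high ord_max.
have p0 : p ord0 = ord0.
  apply: val_inj; have /andP[_] := low ((p^-1)%g ord0).
  by rewrite Xs permKV leqn0 => /eqP.
have pmax : p ord_max = ord_max.
  apply/val_inj/eqP; rewrite eqn_leq leq_ord; have /andP[_] := high ((p^-1)%g ord_max).
  by rewrite Xt permKV.
have latp : lattice_like p.
  move=> a b c d; rewrite -(Xnode a) -(Xnode b) -(Xnode c) -(Xnode d) !dleE // => h1 h2 h3 h4.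
  have [m [mV m1 m2 m3 m4]] := latM _ _ _ _ (nodeV a) (nodeV b) (nodeV c) (nodeV d) h1 h2 h3 h4.
  by exists (X m); rewrite !dleE.
(* [hasse] takes these proofs as arguments, so the isomorphism is built for arbitrary ones. *)
exists p; split=> // {}p0 {}pmax {}latp.
have edge_cov (d : M) : d \in fwd M -> cov (dle p) (X (tail d)) (X (head d)).
  move=> fd; have tdhd := edge_neq acyM fd.
  have hV : head d \in vertices M by exact: memV.
  apply/and3P; split; first by apply/eqP => /XI e; apply: tdhd; rewrite e.
    by rewrite dleE //; exact: fwd_reach.
  apply/forallP => i; rewrite -(Xnode i) !dleE //; apply/implyP => /andP[r1 r2].
  case: (node i =P tail d) => [->|nt]; first by rewrite eqxx.
  case: (node i =P head d) => [->|nh]; first by rewrite eqxx orbT.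
  have [//|[e [fe he r3]]] := reach_last r2.
  have ned : e <> d.
    move=> ed; apply: nt; apply: (reach_anti acyM) r1 => //.
    by move: r3; rewrite ed.
  have := no_detour acyM irredM fd fe ned (reach_trans r1 r3).
  by rewrite he reach_refl.
have cov_edge i j : cov (dle p) i j -> exists d, [/\ d \in fwd M, X (tail d) = i & X (head d) = j].
  move=> cij; have [nij] := covP cij; rewrite -{1}(Xnode i) -{1}(Xnode j) dleE // => rij h.
  have [e|[d [fd hd rd]]] := reach_last rij; first by case: nij; rewrite -(Xnode i) e Xnode.
  exists d; split=> //; last by rewrite hd Xnode.
  have [] := h (X (tail d)) => //.
  - by rewrite -{1}(Xnode i) dleE.
  - by rewrite -{1}(Xnode j) dleE // -hd; exact: fwd_reach.
  move=> e; have := edge_neq acyM fd; rewrite hd -(Xnode j) in e *.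
  by case; apply: XI; rewrite // e Xnode.
have dart_cov (d : M) : cov (dle p) (X (tail d)) (X (head d)) || cov (dle p) (X (head d)) (X (tail d)).
  case: (boolP (d \in fwd M)) => fd; first by rewrite edge_cov.
  by have := @edge_cov (opp M d); rewrite fwd_oppN fd head_opp => /(_ isT) ->; rewrite orbT.
pose f (d : M) : hdart p := dart_of (dart_cov d).
have fE d : val (f d) = (X (tail d), X (head d)) by [].
have f_opp d : f (opp M d) = opp_h p (f d).
  by apply: val_inj; rewrite opp_hE !fE head_opp.
have f_fwd d : up_h (f d) = (d \in fwd M).
  case: (boolP (d \in fwd M)) => fd; first exact: edge_cov.
  apply/negbTE; rewrite -up_opp_h -f_opp; apply: edge_cov; by rewrite fwd_oppN.
have f_inj : injective f.
  have inj_fwd d e : d \in fwd M -> f d = f e -> d = e.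
    move=> fd eq_f; have fe : e \in fwd M by rewrite -f_fwd -eq_f f_fwd.
    have := congr1 val eq_f; rewrite !fE => -[/XI e1 /XI e2].
    have {}e1 : tail d = tail e by exact: e1.
    have {}e2 : head d = head e by apply: e2; exact: memV.
    case: (e =P d) => // ned; have := no_detour acyM irredM fd fe ned.
    by rewrite e1 e2 !reach_refl => /(_ isT).
  move=> d e eq_f; case: (boolP (d \in fwd M)) => fd; first exact: inj_fwd.
  rewrite -[d]oppP -[e]oppP; congr (opp M _); apply: inj_fwd; first by rewrite fwd_oppN.
  by rewrite !f_opp eq_f.
have f_surj (h : hdart p) : exists d, f d = h.
  case: (boolP (up_h h)) => [/cov_edge[d [_ d1 d2]]|/up_hN/cov_edge[d [_ d1 d2]]].
    by exists d; apply: val_inj; rewrite fE d1 d2 -surjective_pairing.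
  by exists (opp M d); apply: val_inj; rewrite f_opp opp_hE fE /= d1 d2 -surjective_pairing.
have sorted_eq (l1 l2 : seq V) : pairwise (fun i j : V => i < j) l1 ->
    pairwise (fun i j : V => i < j) l2 -> l1 =i l2 -> l1 = l2.
  move=> s1 s2; apply: (irr_sorted_eq (leT := fun i j : V => i < j)).
  - by move=> a b c; exact: ltn_trans.
  - by move=> a; exact: ltnn.
  - exact: pairwise_sorted.
  - exact: pairwise_sorted.
have ups_outs v : v \in vertices M -> ups p (X v) = map (fun d => X (head d)) (outs v).
  move=> vV; apply: sorted_eq; first exact: ups_sorted.
    rewrite pairwise_map; apply: pairwise_in (proj1 (sorted_xy v vV)) _ => d e _ _ /= lt.
    by rewrite Xlt //; exact: memV.
  move=> i; rewrite mem_ups; apply/idP/mapP => [/cov_edge[d [fd /XI dv <-]]|[d]].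
    by exists d; rewrite // mem_outs // fd dv ?memV /=.
  by rewrite mem_outs // => /andP[fd /eqP <-] ->; exact: edge_cov.
have downs_ins v : v \in vertices M -> downs p (X v) = map (fun d => X (tail d)) (ins v).
  move=> vV; apply: sorted_eq; first exact: downs_sorted.
    rewrite pairwise_map; apply: pairwise_in (proj2 (sorted_xy v vV)) _ => d e _ _ /= lt.
    by rewrite Xlt.
  move=> i; rewrite mem_downs; apply/idP/mapP => [/cov_edge[d [fd <- /XI dv]]|[d]].
    by exists d; rewrite // mem_ins // fd dv ?memV /=.
  by rewrite mem_ins // => /andP[fd /eqP <-] ->; exact: edge_cov.
have nbrs_around v : v \in vertices M -> nbrs p (X v) = map (fun d => X (head d)) (around v).
  move=> vV; rewrite around_split // map_cat /nbrs ups_outs // downs_ins //; congr (_ ++ _).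
  by rewrite -map_rev -map_comp; apply: eq_map => d /=; rewrite head_opp.
have f_cw d : f (cw M d) = ((vnext_h p)^-1)%g (f d).
  apply: val_inj; rewrite cw_hE !fE /= tail_cw; congr (_, _).
  rewrite nbrs_around //; rewrite (next_map_in (h := fun e => X (head e))).
  - congr (X (head _)); apply/eqP.
    apply: (next_cycle (e := frel (cw M))); first exact: around_cycle.
    by rewrite mem_around ?eqxx.
  - exact: around_uniq.
  - move=> a b; rewrite !mem_around // => /eqP ta /eqP tb eX.
    by apply: f_inj; apply: val_inj; rewrite !fE eX ta tb.
  - by rewrite mem_around ?eqxx.
exists f; split.
- have /fin_all_exists[g gK] := f_surj; exists g => [d|h]; last exact: gK.
  by apply: f_inj; rewrite gK.
- by move=> d; apply: (@perm_inj _ ((vnext_h p)^-1)%g); rewrite permK -f_cw /cw permK.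
- exact: f_opp.
- apply: val_inj; rewrite fE -/(root_vertex M) Xs; congr (_, _).
  rewrite /root2 -Xs ups_outs // -around_source //.
  have [l ->] := around_start t tau s.
  by rewrite /= /start eqxx.
by move=> d; rewrite inE f_fwd.
Qed.

End Representation.

(** * Plane permutations *)

Section Extension.
Variable n : nat.

Definition mid (i : 'I_n) : 'I_n.+2 := lift ord_max (lift ord0 i).

Definition ext (s : 'S_n) : 'S_n.+2 := lift_perm ord_max ord_max (lift_perm ord0 ord0 s).

Lemma val_mid (i : 'I_n) : mid i = i.+1 :> nat.
Proof. by rewrite /= /bump leq0n add1n leqNgt ltnS ltn_ord. Qed.

Lemma mid_inj : injective mid.
Proof. by move=> i j /lift_inj/lift_inj. Qed.

Lemma mid_ex (u : 'I_n.+2) : 0 < u -> u < n.+1 -> exists i, u = mid i.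
Proof.
move=> u0 un; have lt : u.-1 < n by rewrite -ltnS prednK.
by exists (Ordinal lt); apply: ord_inj; rewrite val_mid prednK.
Qed.

Lemma ext_mid (s : 'S_n) (i : 'I_n) : ext s (mid i) = mid (s i).
Proof. by rewrite /ext !lift_perm_lift. Qed.

Lemma ext_max (s : 'S_n) : ext s ord_max = ord_max.
Proof. by rewrite /ext lift_perm_id. Qed.

Lemma ext0 (s : 'S_n) : ext s ord0 = ord0.
Proof.
have -> : ord0 = lift ord_max ord0 :> 'I_n.+2 by exact: ord_inj.
by rewrite /ext lift_perm_lift lift_perm_id.
Qed.

Lemma ext_inj : injective ext.
Proof. by move=> s q eq_sq; apply/permP => i; apply: mid_inj; rewrite -!ext_mid eq_sq. Qed.

Lemma ext_surj (p : 'S_n.+2) : p ord0 = ord0 -> p ord_max = ord_max -> exists s, p = ext s.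
Proof.
move=> p0 pmax; have /fin_all_exists[f fP] : forall i, exists k, p (mid i) = mid k.
  move=> i; apply: mid_ex.
    rewrite lt0n; apply/eqP => e.
    have /perm_inj/(congr1 (@nat_of_ord _)) : p (mid i) = p ord0 by rewrite p0; exact: ord_inj.
    by rewrite val_mid.
  rewrite ltn_neqAle -ltnS ltn_ord andbT; apply/eqP => e.
  have /perm_inj/(congr1 (@nat_of_ord _)) : p (mid i) = p ord_max by rewrite pmax; exact: ord_inj.
  by rewrite val_mid => -[] ei; have := ltn_ord i; rewrite ei ltnn.
have f_inj : injective f by move=> i j e; apply/mid_inj/(@perm_inj _ p); rewrite !fP e.
exists (perm f_inj); apply/permP => u.
case: (posnP u) => [u0|u0]; first by rewrite (_ : u = ord0) ?p0 ?ext0 //; exact: ord_inj.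
case: (ltnP u n.+1) => un; last first.
  by rewrite (_ : u = ord_max) ?pmax ?ext_max //; apply/ord_inj/eqP; rewrite eqn_leq leq_ord.
by have [i ->] := mid_ex u0 un; rewrite ext_mid permE fP.
Qed.

(** In an occurrence of the pattern, i and j are below j + 1 and k; an interpolating point would
    have position j or j + 1, and both have unsuitable values. *)
Lemma lattice_like_ext (s : 'S_n) : lattice_like (ext s) <-> ~~ has_2_14_3 s.
Proof.
pose p := ext s; have p_mid i : p (mid i) = (s i).+1 :> nat by rewrite ext_mid val_mid.
split=> [lat|nopat].
  apply/negP => /existsP[i /existsP[j /existsP[j' /existsP[k /and5P[ij /eqP ej jk h1 /andP[h2 h3]]]]]].
  have [||||m [im jm mj mk]] := lat (mid i) (mid j) (mid j') (mid k);
    rewrite /dle ?p_mid -/p ?p_mid ?val_mid; try by apply/andP; split; lia.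
  move: im jm mj mk; rewrite /dle -/p !p_mid !val_mid => /andP[_ im] /andP[jm _] /andP[mj _] /andP[_ mk].
  have [e|e] : (m = j.+1 :> nat) \/ (m = j'.+1 :> nat) by lia.
    have me : m = mid j by apply: ord_inj; rewrite [RHS]val_mid.
    by move: im; rewrite me p_mid; lia.
  have me : m = mid j' by apply: ord_inj; rewrite [RHS]val_mid.
  by move: mk; rewrite me p_mid; lia.
have p0 : p ord0 = ord0 by exact: ext0.
have pmax : p ord_max = ord_max by exact: ext_max.
have pneq (a b : 'I_n.+2) : a < b -> p a != p b :> nat.
  by move=> ab; apply/eqP => /ord_inj/perm_inj e; rewrite e ltnn in ab.
(* Let a be the last position from z and before v with value below that of u, and b the next one.
   Either b interpolates, or u, a, b, w form the pattern. *)
have key (u z v w : 'I_n.+2) : u < z -> p z < p u -> v < w -> p w < p v ->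
    dle p u w -> dle p z v -> exists m, [/\ dle p u m, dle p z m, dle p m v & dle p m w].
  move=> uz pzu vw pwv /andP[uw puw] /andP[zv pzv].
  case: (@arg_maxnP _ z (fun k : 'I_n.+2 => (z <= k < v) && (p k < p u)) (@nat_of_ord _)).
    have zv' : z != v :> nat by apply/eqP => /ord_inj e; rewrite e in pzu; lia.
    by rewrite leqnn pzu andbT ltn_neqAle zv' zv.
  move=> a /andP[/andP[za av] pau] a_max.
  have lt_b : a.+1 < n.+2 by apply: leq_ltn_trans av _.
  pose b : 'I_n.+2 := Ordinal lt_b; have bE : b = a.+1 :> nat by [].
  have pub : p u < p b.
    have := pneq u b; rewrite bE => /(_ _) nub.
    rewrite ltn_neqAle nub /=; last by lia.
    case: (leqP (p u) (p b)) => // pbu; have [bv|bv] := ltnP b v.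
      have := a_max b; rewrite bv pbu bE (leqW za) => /(_ isT); lia.
    have be : b = v by apply: ord_inj; rewrite bE; lia.
    by rewrite be in pbu; lia.
  case: (leqP (p b) (p w)) => pbw.
    by exists b; split; apply/andP; split; rewrite ?bE; lia.
  have {}puw : p u < p w.
    by rewrite ltn_neqAle puw andbT; apply: pneq; nat_lia.
  have inner (c : 'I_n.+2) : 0 < c -> c < n.+1 -> exists i, c = mid i by exact: mid_ex.
  (* Neither u nor w is an added end point, so the pattern lies within s. *)
  have u_pos : 0 < u.
    rewrite lt0n; apply/eqP => e; have u0 : u = ord0 by exact: ord_inj.
    by rewrite u0 p0 in pzu.
  have w_max : w < n.+1.
    rewrite ltn_neqAle -ltnS ltn_ord andbT; apply/eqP => e.
    have wm : w = ord_max by exact: ord_inj.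
    by rewrite wm pmax in pwv; have := ltn_ord (p v); move: pwv => /=; lia.
  have [||i ui] := inner u; [lia|lia|]; have [||j aj] := inner a; [lia|lia|].
  have [||j' bj] := inner b; [rewrite bE; lia|rewrite bE; lia|]; have [||k wk] := inner w; [lia|lia|].
  case/negP: nopat; apply/existsP; exists i; apply/existsP; exists j.
  apply/existsP; exists j'; apply/existsP; exists k.
  have [e1 e2] := (val_mid i, val_mid j); have [e3 e4] := (val_mid j', val_mid k).
  rewrite -ui in e1; rewrite -aj in e2; rewrite -bj in e3; rewrite -wk in e4.
  have [e5 e6] := (p_mid i, p_mid j); have [e7 e8] := (p_mid j', p_mid k).
  rewrite -ui in e5; rewrite -aj in e6; rewrite -bj in e7; rewrite -wk in e8.
  apply/and5P; split; [| apply/eqP | | |apply/andP; split]; nat_lia.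
move=> u z v w uv uw zv zw.
case: (boolP (dle p u z)) => uz; first by exists z; split=> //; exact: dle_refl.
case: (boolP (dle p z u)) => zu; first by exists u; split=> //; exact: dle_refl.
case: (boolP (dle p v w)) => vw; first by exists v; split=> //; exact: dle_refl.
case: (boolP (dle p w v)) => wv; first by exists w; split=> //; exact: dle_refl.
have incomp (a b : 'I_n.+2) : ~~ dle p a b -> ~~ dle p b a -> a < b /\ p b < p a \/ b < a /\ p a < p b.
  by rewrite /dle; clear; lia.
have [[xuz yuz]|[xuz yuz]] := incomp u z uz zu; have [[xvw yvw]|[xvw yvw]] := incomp v w vw wv.
- exact: key.
- by have [m [m1 m2 m3 m4]] := key u z w v xuz yuz xvw yvw uv zw; exists m.
- by have [m [m1 m2 m3 m4]] := key z u v w xuz yuz xvw yvw zw uv; exists m.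
- by have [m [m1 m2 m3 m4]] := key z u w v xuz yuz xvw yvw zv uw; exists m.
Qed.

End Extension.

Theorem proposition3p3 (n : nat) :
  classes_number map_iso (bipolar_poset_on n.+2) #|plane_permutations n|.
Proof.
have plane_lattice (i : 'I_#|plane_permutations n|) : lattice_like (ext (enum_val i)).
  by apply/lattice_like_ext; have := enum_valP i; rewrite inE.
exists (fun i => hasse (ext0 _) (ext_max _) (plane_lattice i)); split.
- by move=> i; exact: hasse_bipolar_poset.
- by move=> i j /hasse_iso_inj/ext_inj/enum_val_inj.
move=> M [[[acyM srcM [t [snkM [tau [tauT tauF]]]]] irrM] cardM].
have [p [p0 pmax lat iso]] := hasse_representation acyM srcM snkM tauT tauF irrM cardM.
have [s ps] := ext_surj p0 pmax; rewrite {}ps in p0 pmax lat iso.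
have sP : s \in plane_permutations n by rewrite inE; exact/lattice_like_ext.
(* The lattice proof inside the representative depends on the permutation, so the equality is
   transported with that proof generalized. *)
have iso_eq s' : s' = s -> forall h : lattice_like (ext s'), map_iso M (hasse (ext0 s') (ext_max s') h).
  by move=> -> h; exact: iso.
by exists (enum_rank_in sP s); apply: iso_eq; exact: enum_rankK_in.
Qed.
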